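(* Let $\mu,\nu$ be compositions of $n$, let $\pi$ be a $\mu$-involution and let $\rho$ be a $\nu$-involution. Then $\rho$ covers $\pi$ in the Bruhat order on degenerate involutions (where $\pi\le\rho$ iff $\mathscr{X}^{\pi}\subseteq\mathscr{X}^{\rho}$) if and only if one of the following holds: (i) $\mu$ is covered by $\nu$ in the refinement order on compositions of $n$, and $\mathsf{W}(\pi)\subset \mathsf{W}(\rho)$. (ii) $\nu=\mu$, and moreover there exist a simple reflection $s_\alpha\in S_n$ and an element $\varpi\in S_n$ such that (a) $L_\mu(\varpi\star\pi)-L_\mu(\pi)=L_\mu(\varpi\star\rho)-L_\mu(\rho)=\ell(\varpi)$; (b) $s_\alpha\cdot(\varpi\cdot\pi)=\varpi\cdot\rho$ (equivalently, $s_\alpha\star(\varpi\star\rho)=\varpi\star\pi$); (c) $s_\alpha \mathsf{W}^{-1}(\varpi\star\pi)\cap \mathsf{W}^{-1}(\varpi\star\rho)\neq\emptyset$, where $s_\alpha \mathsf{W}^{-1}(\varpi\star\pi)=\{s_\alpha w\in S_n: w\in \mathsf{W}^{-1}(\varpi\star\pi)\}$ is the translate under the group multiplication of $S_n$.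
   Context: **Geometry.** Let $k$ be the base field, $n\ge 2$, $G=SL_n(k)$, and let $B\subset G$ be the Borel subgroup of upper triangular matrices. The variety of complete quadrics $\mathcal{X}_n$ is the wonderful compactification (De Concini–Procesi) of the homogeneous space $SL_n/SO_n$, i.e. of the space of nonsingular quadric hypersurfaces in $\mathbb{P}^{n-1}$, with its natural $G$-action. A point of $\mathcal{X}_n$ can be thought of as a complete quadric: a partial flag $0=V_0\subset V_1\subset\dots\subset V_r=k^n$ together with a nondegenerate quadric on (the projectivization of) each successive quotient $V_j/V_{j-1}$. **Compositions.** A composition of $n$ is a sequence $\mu=(\mu_1,\dots,\mu_r)$ of positive integers with sum $n$; put $I(\mu)=\{1,\dots,n-1\}\setminus\{\mu_1,\mu_1+\mu_2,\dots,\mu_1+\dots+\mu_{r-1}\}$. Refinement order: $\mu\preceq\nu$ iff $I(\mu)\subseteq I(\nu)$. **$\mu$-involutions.** A $\mu$-involution is a permutation of $[n]$ in one-line notation cut into consecutive strings $\pi=[\pi_1|\dots|\pi_r]$ with $\pi_j$ of length $\mu_j$, such that each $\pi_j$ is an involution when read as the one-line notation of a permutation of its own alphabet $\mathcal{A}_j$ (the set of its letters, in natural order). A degenerate involution is a $\mu$-involution for some composition $\mu$ of $n$. To $\pi$ one attaches the distinguished complete quadric $Q_\pi$: $V_j$ is spanned by the standard basis vectors $e_a$ with $a\in\mathcal{A}_1\cup\dots\cup\mathcal{A}_j$, and the quadric on $V_j/V_{j-1}$ is $\sum x_{a}x_{b}+\sum x_{c}^2$, summed over the two-cycles $(a,b)$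 and the one-cycles $(c)$ of $\pi_j$. The $B$-orbits in $\mathcal{X}_n$ are parametrized by the degenerate involutions; $\mathscr{O}^\pi$ denotes the $B$-orbit indexed by $\pi$ (the one containing $Q_\pi$) and $\mathscr{X}^\pi$ its closure. **Monoid action.** Let $s_i=(i,i+1)$ and let $\ell$ be the number of inversions. The Richardson–Springer monoid of $S_n$ (generators $s_1,\dots,s_{n-1}$, braid relations, $s_i^2=s_i$), whose elements are identified with those of $S_n$ through reduced expressions, acts on $\mu$-involutions as follows. For an involution $\pi$ of $[n]$ (one string), $s_i\cdot\pi=s_i\pi s_i$ if $\ell(s_i\pi s_i)=\ell(\pi)-2$; $s_i\cdot\pi=s_i\pi$ if $s_i\pi s_i=\pi$ and $\ell(s_i\pi)=\ell(\pi)-1$; $s_i\cdot\pi=\pi$ otherwise. For a $\mu$-involution $\pi=[\pi_1|\dots|\pi_r]$: if $i,i+1$ lie in the same string $\pi_j$, apply this rule to $\pi_j$ viewed as an involution of its alphabet; otherwise $s_i\cdot\pi$ interchanges the letters $i$ and $i+1$ if $i+1$ precedes $i$ in $\pi$, and $s_i\cdot\pi=\pi$ if not. For $w\in S_n$ with reduced expression $w=s_{i_1}\cdots s_{i_l}$, $w\cdot\pi=s_{i_1}\cdot(s_{i_2}\cdots(s_{i_l}\cdot\pi)\cdots)$. **Length.** For an involution $\pi$ of an ordered alphabet, $L(\pi)=\frac{\ell(\pi)+\mathrm{exc}(\pi)}2$, where $\mathrm{exc}(\pi)$ is the number of two-cycles. For a $\mu$-involution, $L_\mu(\pi)=\ell(w(\pi))+\sum_j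 L(\pi_j)$, where $w(\pi)$ is the permutation obtained by rearranging each string $\pi_j$ in increasing order. **$\mathsf{W}$-sets.** For fixed $\mu$, $\max$ (resp. $\min$) is the $\mu$-involution whose underlying word is $12\cdots n$ (resp. $n\cdots21$). For $\mu$-involutions $\pi,\rho$, $\mathsf{W}(\pi,\rho)=\{w\in S_n: w\cdot\pi=\rho,\ \ell(w)=L_\mu(\pi)-L_\mu(\rho)\}$; $\mathsf{W}(\pi)=\mathsf{W}(\pi,\max)$ and $\mathsf{W}^{-1}(\pi)=\mathsf{W}(\min,\pi)$. **Opposite action.** $\star$ denotes the opposite action of the monoid on $\mu$-involutions: $s\star\rho=\pi$ if and only if $s\cdot\pi=\rho$.
   Formalization: Condition (b) is taken as s_α⋆(ϖ⋆ρ)=ϖ⋆π, since the first formula, not equivalent to it, fails for π=[2|3|1], ρ=[2|1|3]; the G-action is A↦gAg^T, since with flags moved by V_j↦gV_j and B upper triangular the claim fails for n=2. *)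

(* Defs.v *)
From HB Require Import structures.
From mathcomp Require Import all_boot all_order all_algebra all_fingroup.
From mathcomp Require Import mpoly.

Set Implicit Arguments.
Unset Strict Implicit.
Unset Printing Implicit Defensive.

Import GRing.Theory.

(* Letters, positions and indices are 0-based: the letter a of [n] is the
   element a - 1 of 'I_n, and the simple reflections are indexed by
   'I_n.-1. *)

Definition covers (T : Type) (D : T -> Prop) (le : T -> T -> Prop) (x y : T) :
  Prop :=
  [/\ le x y, x <> y &
      forall z : T, D z -> le x z -> le z y -> z = x \/ z = y].

(** * Compositions *)

Definition is_comp (n : nat) (mu : seq nat) : bool :=
  all (fun a => 0 < a)%N mu && (sumn mu == n).

(* [scanl addn 0 mu] lists the partial sums mu_1, mu_1 + mu_2, ..., n. *)
Definition compI (mu : seq nat) : seq nat :=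
  [seq i <- iota 1 (sumn mu).-1 | i \notin scanl addn 0%N mu].

Definition refines (mu nu : seq nat) : Prop := {subset compI mu <= compI nu}.

(** * Words and simple reflections *)

Section Combinatorics.

Variable n : nat.
Implicit Types (i : 'I_n.-1) (s : seq 'I_n) (mu : seq nat).
Implicit Types (p r : seq (seq 'I_n)) (w : 'S_n).

Definition lo i : 'I_n := widen_ord (leq_pred n) i.
Definition hi i : 'I_n := ordS (lo i).
Definition sref i : 'S_n := tperm (lo i) (hi i).

Fixpoint ninv (s : seq 'I_n) : nat :=
  if s is x :: s' then (count (fun y : 'I_n => y < x) s' + ninv s')%N else 0%N.

Definition ell w : nat := ninv [seq w x | x <- enum 'I_n].

(* A reduced expression of w. The product of 'S_n in MathComp composes from
   left to right, so this is the group opposite to the one where permutations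
   compose from right to left; the isomorphism w |-> w^-1 between the two fixes
   the simple reflections, hence preserves words, and it preserves ell. *)
Definition redword w : seq 'I_n.-1 :=
  if [pick t : (ell w).-tuple 'I_n.-1 | (\prod_(i <- t) sref i)%g == w]
    is Some t then t else [::].

(** * mu-involutions, as sequences of strings *)

Definition alphabet s : seq 'I_n := sort (fun a b : 'I_n => a <= b)%N s.

(* The permutation of its own alphabet whose one-line notation is s; letters
   outside the alphabet are fixed. *)
Definition strmap s (x : 'I_n) : 'I_n := nth x s (index x (alphabet s)).

Definition involutive_string s : bool :=
  all (fun x => strmap s (strmap s x) == x) s.

Definition muinv mu p : bool :=
  [&& shape p == mu, perm_eq (flatten p) (enum 'I_n)
    & all involutive_string p].

Definition degenerate p : Prop := exists2 mu, is_comp n mu & muinv mu p.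

Definition mumax mu : seq (seq 'I_n) := reshape mu (enum 'I_n).
Definition mumin mu : seq (seq 'I_n) := reshape mu (rev (enum 'I_n)).

(** * The monoid action and its opposite *)

Definition string_act i s : seq 'I_n :=
  let sps := [seq sref i (strmap s (sref i x)) | x <- alphabet s] in
  let sp := [seq sref i (strmap s x) | x <- alphabet s] in
  if ninv s == (ninv sps + 2)%N then sps
  else if (sps == s) && (ninv s == (ninv sp + 1)%N) then sp
  else s.

Definition both_in i s : bool := (lo i \in s) && (hi i \in s).

Definition mact i p : seq (seq 'I_n) :=
  if has (both_in i) p
  then [seq if both_in i s then string_act i s else s | s <- p]
  else if (index (hi i) (flatten p) < index (lo i) (flatten p))%N
  then [seq [seq sref i x | x <- s] | s <- p]
  else p.

Definition muinvs mu : seq (seq (seq 'I_n)) :=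
  [seq p <- [seq reshape mu t | t <- permutations (enum 'I_n)] | muinv mu p].

(* The opposite of the action of a generator: the mu-involution p other than r
   with s_i . p = r (there is at most one), and r itself if there is none. *)
Definition mstar i r : seq (seq 'I_n) :=
  head r [seq p <- muinvs (shape r) | (p != r) && (mact i p == r)].

Definition word_act (f : 'I_n.-1 -> seq (seq 'I_n) -> seq (seq 'I_n)) w p :
  seq (seq 'I_n) := foldr f p (redword w).

Definition act w p := word_act mact w p.
Definition star w p := word_act mstar w p.

(** * Lengths and W-sets *)

(* A two-cycle (a, b) with a < b is counted at a. *)
Definition exc s : nat := count (fun x : 'I_n => x < strmap s x)%N s.

Definition Lstring s : nat := (ninv s + exc s)./2.

Definition Lmu p : nat :=
  (ninv (flatten [seq alphabet s | s <- p]) + sumn [seq Lstring s | s <- p])%N.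

Definition Wset p r : {set 'S_n} :=
  [set w | (act w p == r) && (ell w + Lmu r == Lmu p)%N].

Definition W p : {set 'S_n} := Wset p (mumax (shape p)).
Definition Winv p : {set 'S_n} := Wset (mumin (shape p)) p.

End Combinatorics.

(** * Complete quadrics *)

Local Open Scope ring_scope.

Section CompleteQuadrics.

Variables (k : closedFieldType) (n : nat).

(* The variety of complete quadrics is realized in the product over 0 < d < n
   of the projective spaces of bilinear forms on the d-th exterior power of k^n,
   as the closure of the set of all tuples (A, /\^2 A, ..., /\^(n-1) A), for A
   the Gram matrix of a nonsingular quadric. The coordinates on the d-th factor
   are indexed by the pairs of d-element subsets of 'I_n. *)
Definition coord : finType :=
  {c : {set 'I_n} * {set 'I_n} | (#|c.1| == #|c.2|) && (0 < #|c.1| < n)%N}.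

Definition cI (c : coord) : {set 'I_n} := (val c).1.
Definition cJ (c : coord) : {set 'I_n} := (val c).2.
Definition block (c : coord) : nat := #|cI c|.

(* Multihomogeneous coordinates of a point. *)
Definition mpoint : Type := {ffun coord -> k}.

Definition is_mpoint (P : mpoint) : Prop :=
  forall d : nat, (0 < d < n)%N -> exists2 c, block c = d & P c != 0.

Definition multihomog (f : {mpoly k[#|coord|]}) : Prop :=
  exists deg : nat -> nat, forall m, m \in msupp f -> forall d : nat,
    (\sum_(j < #|coord| | block (enum_val j) == d) m j)%N = deg d.

Definition vanishes (f : {mpoly k[#|coord|]}) (P : mpoint) : Prop :=
  f.@[fun j => P (enum_val j)] = 0.

Definition zariski_closure (S : mpoint -> Prop) (P : mpoint) : Prop :=
  is_mpoint P /\
  forall f, multihomog f -> (forall Q, S Q -> vanishes f Q) -> vanishes f P.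

(* For #|I| = #|J|, the minor of A with rows I and columns J. *)
Definition minor (A : 'M[k]_n) (I J : {set 'I_n}) : k :=
  \det (\matrix_(a < #|I|, b < #|I|) A (enum_val a) (nth (enum_val b) (enum J) b)).

Definition nonsingular_quadric (P : mpoint) : Prop :=
  exists A : 'M[k]_n,
    [/\ A^T = A, A \in unitmx & P = [ffun c => minor A (cI c) (cJ c)]].

Definition complete_quadric (P : mpoint) : Prop :=
  zariski_closure nonsingular_quadric P.

(* The action of SL_n extending A |-> g *m A *m g^T, that is, extending the
   action by left translation on SL_n / SO_n, where g SO_n is sent to
   g *m g^T. *)
Definition gact (g : 'M[k]_n) (P : mpoint) : mpoint :=
  [ffun c => \sum_(e : coord | block e == block c)
               minor g (cI c) (cI e) * P e * minor g (cJ c) (cJ e)].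

Definition borel (b : 'M[k]_n) : Prop :=
  \det b = 1 /\ forall i j : 'I_n, (j < i)%N -> b i j = 0.

Definition string_index (p : seq (seq 'I_n)) (a : 'I_n) : nat :=
  find (fun s => a \in s) p.

Definition deg_map (p : seq (seq 'I_n)) (a : 'I_n) : 'I_n :=
  strmap (nth [::] p (string_index p a)) a.

(* The Gram matrix of the sum over all strings of the quadratic forms
   sum x_a x_b + sum x_c ^ 2. *)
Definition gram (p : seq (seq 'I_n)) : 'M[k]_n :=
  \matrix_(a, b) (if deg_map p a == b then (if a == b then 1 else 2%:R^-1)
                  else 0).

(* A set I of letters satisfies this if it is the union of A_(j+1), ..., A_r
   and of a subset of A_j, for some j. *)
Definition saturated (p : seq (seq 'I_n)) (I : {set 'I_n}) : bool :=
  [forall a in I, forall b,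
    (string_index p a < string_index p b)%N ==> (b \in I)].

(* The complete quadric with flag (V_j) and quadratic form q_j on V_j / V_(j-1)
   has as d-th component, for d = dim (V_r / V_j) + t with
   0 <= t <= dim (V_j / V_(j-1)), the form
     /\^top q_r (x) ... (x) /\^top q_(j+1) (x) /\^t q_j,
   i.e. the leading term, as u tends to 0, of /\^d of the form
   q_r + u q_(r-1) + ... + u^(r-1) q_1. In particular the first component is
   q_r, a form on V_r = k^n with kernel V_(r-1). *)
Definition Qpoint (p : seq (seq 'I_n)) : mpoint :=
  [ffun c => if saturated p (cI c) && saturated p (cJ c)
             then minor (gram p) (cI c) (cJ c) else 0].

Definition Borbit (p : seq (seq 'I_n)) (P : mpoint) : Prop :=
  exists2 b, borel b & P = gact b (Qpoint p).

Definition Borbit_closure (p : seq (seq 'I_n)) (P : mpoint) : Prop :=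
  complete_quadric P /\ zariski_closure (Borbit p) P.

Definition bruhat_le (p r : seq (seq 'I_n)) : Prop :=
  forall P : mpoint, Borbit_closure p P -> Borbit_closure r P.

End CompleteQuadrics.

(* Main.v *)
Require Import Defs.
From HB Require Import structures.
From mathcomp Require Import all_boot all_order all_algebra all_fingroup.
From mathcomp Require Import mpoly ring zify.
From Stdlib Require Import Classical.

Set Implicit Arguments.
Unset Strict Implicit.
Unset Printing Implicit Defensive.

Import GRing.Theory.

(** Closures are handled through functions: [le_pt Q R] says that every multihomogeneous function
    vanishing on the B-orbit of R vanishes at Q. The only density argument is that a one-variable
    polynomial vanishing off the zeros of a nonzero polynomial is zero, so every limit and every
    generic choice is written as a family that is polynomial in one parameter. Invertibility of 2
    enters through the coefficient 1/2 that a two-cycle gives to the Gram matrix. Square roots enter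
    because s_i turns the form x_i x_(i+1) into a sum of two squares. The W-sets are computed from a
    chosen reduced word, so the braid relations are needed. To avoid a case analysis on involutions,
    an involution is treated as a bijection whose rows and columns are sorted independently; sorting
    satisfies the braid relations. In condition (b) the opposite action returns its argument when
    there is no lower partner, so (b) alone would allow the two raised elements to coincide; (c)
    excludes this by parity of length. *)

(* Write p <= r for inclusion of B-orbit closures. For each i the degenerate
   involutions of a given composition are matched in pairs q < s_i . q ("q is
   low at i"). The covering theorem follows formally from five facts:
     p <= s_i . p;
     p <= r implies s_i . p <= s_i . r;
     p <= s_i . r implies p <= r if p is low at i;
     max_mu <= r for a nu-involution r forces mu to refine nu and r = max_nu;
     max_mu <= max_nu if mu refines nu.
   Indeed, acting by w in W(p) carries p <= r to max_mu <= w . r, so that p <= r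
   if and only if mu refines nu and w . r = max_nu. In particular lengths are
   comparable along the order, and an induction on the length of p that raises p
   and r by the same s_i shows that covers change either the length by one
   within a composition, or the composition by one refinement step without
   changing the length.
   The first two facts hold because P_i O^r lies in the closure of O^(s_i . r),
   P_i being the minimal parabolic subgroup of s_i. The third one says that
   P_i Y is closed for Y = closure of O^r (P_i / B is complete). It is proved by
   elimination: for Q_p outside Y, choose f and h in the ideal of Y with
   f(Q_p) <> 0 and h(s_i Q_p) <> 0. As p is low at i, a one-parameter subgroup of
   the torus fixes Q_p and contracts the root subgroup y(t) of - alpha_i, so f
   can be taken constant along y(t) Q_p. The resultant in t of f(y(t) P) and
   h(s_i y(1/t) P), suitably read, vanishes on P_i Y but not at Q_p. The fourth
   fact follows from the vanishing of coordinates and of 2 x 2 minors of a single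
   component, the fifth from a degeneration along the torus. *)

(** * Degenerate involutions as pairs of maps on letters *)

Section Encoding.

Variable n : nat.
Implicit Types (x y : 'I_n) (s : seq 'I_n) (p q : seq (seq 'I_n)) (mu : seq nat).
Implicit Types (f : 'I_n -> nat) (g : 'I_n -> 'I_n).

Definition letters f j := [seq x <- enum 'I_n | f x == j].

(** With a string index [f] and one involution [g] of all letters, [s_i] acts by composition with
    [sref i] instead of by operations on lists. The number [R] of strings is separate, because [f]
    does not see trailing empty strings. *)
Definition dec R f g : seq (seq 'I_n) := mkseq (fun j => [seq g x | x <- letters f j]) R.

Definition good R f g : Prop :=
  [/\ forall x, f x < R, involutive g & forall x, f (g x) = f x].

Lemma mem_letters f j x : (x \in letters f j) = (f x == j).
Proof. by rewrite mem_filter mem_enum andbT. Qed.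

Lemma uniq_letters f j : uniq (letters f j).
Proof. by rewrite filter_uniq ?enum_uniq. Qed.

Lemma letters_sorted f j : sorted (fun x y : 'I_n => x < y) (letters f j).
Proof.
apply: sorted_filter; first by move=> y x z; apply: ltn_trans.
have: sorted ltn (map val (enum 'I_n)) by rewrite val_enum_ord iota_ltn_sorted.
by rewrite sorted_map.
Qed.

Lemma alphabet_eq s (A : seq 'I_n) : sorted (fun x y : 'I_n => x < y) A ->
  perm_eq s A -> alphabet s = A.
Proof.
move=> sA sperm; apply: (@sorted_eq _ (fun x y : 'I_n => x <= y)).
- by move=> y x z; apply: leq_trans.
- by move=> x y le; apply: val_inj; apply/eqP; rewrite eqn_leq.
- by apply: sort_sorted => x y; apply: leq_total.
- by apply: sub_sorted sA => x y; apply: ltnW.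
- by rewrite perm_sort.
Qed.

Lemma perm_map_letters f g j : involutive g -> (forall x, f (g x) = f x) ->
  perm_eq [seq g x | x <- letters f j] (letters f j).
Proof.
move=> gK fg; apply: uniq_perm.
- by rewrite map_inj_uniq ?uniq_letters //; apply: inv_inj.
- exact: uniq_letters.
move=> x; rewrite -{1}[x]gK mem_map; last exact: inv_inj.
by rewrite !mem_letters fg.
Qed.

Lemma alphabet_dec f g j : involutive g -> (forall x, f (g x) = f x) ->
  alphabet [seq g x | x <- letters f j] = letters f j.
Proof.
by move=> gK fg; apply: alphabet_eq (letters_sorted f j) (perm_map_letters j gK fg).
Qed.

Lemma strmap_dec f g j x : involutive g -> (forall x, f (g x) = f x) -> f x = j ->
  strmap [seq g x | x <- letters f j] x = g x.
Proof.
move=> gK fg fx; rewrite /strmap alphabet_dec // (nth_map x) ?nth_index //.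
  by rewrite mem_letters fx.
by rewrite index_mem mem_letters fx.
Qed.

Section Decoded.

Variables (R : nat) (f : 'I_n -> nat) (g : 'I_n -> 'I_n).
Hypothesis fg_good : good R f g.

Lemma size_dec : size (dec R f g) = R.
Proof. by rewrite size_mkseq. Qed.

Lemma nth_dec j : j < R -> nth [::] (dec R f g) j = [seq g x | x <- letters f j].
Proof. by move=> jR; rewrite nth_mkseq. Qed.

Lemma shape_dec : shape (dec R f g) =
  mkseq (fun j => count (fun x => f x == j) (enum 'I_n)) R.
Proof.
rewrite /shape -map_comp; apply: eq_map => j /=.
by rewrite size_map size_filter.
Qed.

Lemma mem_nth_dec x j : j < R -> (x \in nth [::] (dec R f g) j) = (f x == j).
Proof.
case: fg_good => _ gK fg jR; rewrite nth_dec //.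
by rewrite (perm_mem (perm_map_letters j gK fg)) mem_letters.
Qed.

Lemma string_index_dec x : string_index (dec R f g) x = f x.
Proof.
case: fg_good => fR gK fg; rewrite /string_index.
have hx : has (fun s => x \in s) (dec R f g).
  apply/hasP; exists (nth [::] (dec R f g) (f x)).
    by rewrite mem_nth // size_dec.
  by rewrite mem_nth_dec.
have lt : find (fun s => x \in s) (dec R f g) < R by rewrite -{2}size_dec -has_find.
by have := nth_find [::] hx; rewrite mem_nth_dec // => /eqP.
Qed.

Lemma deg_map_dec x : deg_map (dec R f g) x = g x.
Proof.
case: (fg_good) => fR gK fg; rewrite /deg_map string_index_dec nth_dec //.
exact: strmap_dec.
Qed.

Lemma flatten_dec_perm : perm_eq (flatten (dec R f g)) (enum 'I_n).
Proof.
case: (fg_good) => fR gK fg.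
have H : perm_eq (flatten (dec R f g)) [seq g x | x <- enum 'I_n].
  apply/seq.permP => a; rewrite count_flatten sumnE big_map /dec /mkseq big_map.
  rewrite count_map -sum1_count.
  under eq_bigr => j _ do rewrite count_map count_filter -sum1_count big_mkcond.
  rewrite exchange_big /= [RHS]big_mkcond; apply: eq_bigr => x _.
  rewrite (bigD1_seq (f x)) ?iota_uniq ?mem_iota //= big1 => [|j jf].
    by rewrite eqxx andbT addn0.
  by rewrite eq_sym (negPf jf) andbF.
apply: perm_trans H _; apply: uniq_perm; rewrite ?enum_uniq //.
  by rewrite map_inj_uniq ?enum_uniq //; apply: inv_inj.
by move=> x; rewrite -{1}[x]gK mem_map ?mem_enum //; apply: inv_inj.
Qed.

Lemma dec_involutive : all (@involutive_string n) (dec R f g).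
Proof.
case: (fg_good) => fR gK fg.
apply/allP => s /mapP[j _ ->]; apply/allP => x xs.
have fx : f x = j.
  by move: xs; rewrite (perm_mem (perm_map_letters j gK fg)) mem_letters => /eqP.
by rewrite !strmap_dec ?fg // gK.
Qed.

Lemma muinv_dec mu : shape (dec R f g) = mu -> muinv mu (dec R f g).
Proof. by move=> sh; rewrite /muinv sh eqxx flatten_dec_perm dec_involutive. Qed.

End Decoded.

Lemma flatten_uniq_nth p x i j : uniq (flatten p) ->
  x \in nth [::] p i -> x \in nth [::] p j -> i = j.
Proof.
elim: p i j => [|s p IH] [|i] [|j] //=; rewrite ?nth_nil //.
- rewrite cat_uniq => /and3P[_ /hasPn no _] xs xp.
  have: x \in flatten p.
    apply/flattenP; exists (nth [::] p j) => //.
    by case: (ltnP j (size p)) xp => [/mem_nth //|?]; rewrite nth_default.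
  by move/no; rewrite xs.
- rewrite cat_uniq => /and3P[_ /hasPn no _] xp xs.
  have: x \in flatten p.
    apply/flattenP; exists (nth [::] p i) => //.
    by case: (ltnP i (size p)) xp => [/mem_nth //|?]; rewrite nth_default.
  by move/no; rewrite xs.
by rewrite cat_uniq => /and3P[_ _ u] xi xj; rewrite (IH _ _ u xi xj).
Qed.

Lemma map_nth_index (s A : seq 'I_n) : uniq A -> size A = size s ->
  [seq nth x s (index x A) | x <- A] = s.
Proof.
move=> uA sz; case: s sz => [|y s]; first by case: A uA.
move=> sz; apply: (@eq_from_nth _ y); rewrite size_map // => i iA.
by rewrite (nth_map y) // index_uniq //; apply: set_nth_default; rewrite -sz.
Qed.

Section Encode.

Variables (mu : seq nat) (p : seq (seq 'I_n)).
Hypothesis p_inv : muinv mu p.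

Let mem_p x : x \in flatten p.
Proof. by case/and3P: p_inv => _ /perm_mem -> _; rewrite mem_enum. Qed.

Let uniq_p : uniq (flatten p).
Proof. by case/and3P: p_inv => _ /perm_uniq -> _; rewrite enum_uniq. Qed.

Lemma muinv_size : size p = size mu.
Proof. by case/and3P: p_inv => /eqP <- _ _; rewrite size_map. Qed.

Lemma string_index_lt x : string_index p x < size p.
Proof. by rewrite -has_find; have /flattenP[s sp xs] := mem_p x; apply/hasP; exists s. Qed.

Lemma mem_string_index x : x \in nth [::] p (string_index p x).
Proof.
have := string_index_lt x; rewrite -has_find.
by move/(nth_find [::]).
Qed.

Lemma string_indexP x j : (x \in nth [::] p j) = (string_index p x == j).
Proof.
apply/idP/eqP => [xj|<-]; last exact: mem_string_index.
exact: flatten_uniq_nth uniq_p (mem_string_index x) xj.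
Qed.

Lemma alphabet_nth j : j < size p -> alphabet (nth [::] p j) = letters (string_index p) j.
Proof.
move=> jp; apply: alphabet_eq (letters_sorted _ _) _.
apply: uniq_perm; last by move=> x; rewrite string_indexP mem_letters.
  move: (nth [::] p j) (mem_nth [::] jp) => t.
  move: uniq_p; elim: (p) => //= s q IH; rewrite cat_uniq inE.
  by case/and3P=> us _ uq /orP[/eqP -> //|]; apply: IH.
exact: uniq_letters.
Qed.

Lemma nth_string j : j < size p ->
  nth [::] p j = [seq deg_map p x | x <- letters (string_index p) j].
Proof.
move=> jp; rewrite -{1}(@map_nth_index (nth [::] p j) (letters (string_index p) j)).
- apply/eq_in_map => x; rewrite mem_letters => /eqP xj.
  by rewrite /deg_map /strmap xj alphabet_nth.
- exact: uniq_letters.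
by rewrite -alphabet_nth // size_sort.
Qed.

Lemma deg_map_mem x : deg_map p x \in nth [::] p (string_index p x).
Proof.
rewrite {1}/deg_map /strmap mem_nth //.
rewrite -[X in _ < X](size_sort (fun a b : 'I_n => a <= b)) -/(alphabet _).
by rewrite index_mem mem_sort mem_string_index.
Qed.

Lemma encode_good : good (size mu) (string_index p) (deg_map p).
Proof.
have fg x : string_index p (deg_map p x) = string_index p x.
  by apply/eqP; rewrite -string_indexP deg_map_mem.
split=> // x; first by rewrite -muinv_size string_index_lt.
rewrite {1}/deg_map fg.
case/and3P: p_inv => _ _ /allP/(_ (nth [::] p (string_index p x))).
move/(_ (mem_nth _ (string_index_lt x)))/allP/(_ x (mem_string_index x)).
by move/eqP.
Qed.

Lemma encodeK : p = dec (size mu) (string_index p) (deg_map p).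
Proof.
apply: (@eq_from_nth _ [::]); rewrite ?size_mkseq ?muinv_size // => j jp.
by rewrite nth_mkseq // nth_string // muinv_size.
Qed.

End Encode.

Lemma muinv_ext mu p q : muinv mu p -> muinv mu q ->
  string_index p =1 string_index q -> deg_map p =1 deg_map q -> p = q.
Proof.
move=> pI qI f g; rewrite (encodeK pI) (encodeK qI); apply: eq_map => j.
rewrite (eq_map g); congr map; apply: eq_filter => x; by rewrite f.
Qed.

(** Relabelling the letters by a permutation keeps the cardinality of each fibre of the string
    index, hence the shape. *)
Lemma muinv_dec_perm mu p f g (w : 'S_n) : muinv mu p ->
  good (size mu) f g -> (forall x, f x = string_index p (w x)) ->
  muinv mu (dec (size mu) f g).
Proof.
move=> pI fgG fE; apply: muinv_dec => //.
have [/eqP sh _ _] := and3P pI.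
transitivity (shape p) => //.
rewrite [in RHS](encodeK pI) !shape_dec; apply: eq_map => j.
rewrite -!size_filter -(size_map w); apply/perm_size/uniq_perm.
- by rewrite (map_inj_uniq (@perm_inj _ w)) filter_uniq ?enum_uniq.
- by rewrite filter_uniq ?enum_uniq.
move=> x; rewrite -{1}(permKV w x) (mem_map (@perm_inj _ w)).
by rewrite -!/(letters _ j) !mem_letters fE permKV.
Qed.

End Encoding.

(** * Inversions and multiplication by a simple reflection *)

Section Inversions.

Variable n : nat.
Implicit Types (i : 'I_n.-1) (x y : 'I_n) (s l : seq 'I_n).

Lemma hi_val i : hi i = (lo i).+1 :> nat.
Proof.
(* [ordS] is the cyclic successor; there is no wrap-around because i < n.-1. *)
rewrite [LHS]/= modn_small //; case: i => m /= mn; lia.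
Qed.

#[local] Opaque lo hi.

Lemma ord_eqE (x y : 'I_n) : (x == y) = (x == y :> nat).
Proof. by []. Qed.

Lemma lo_hi i : lo i != hi i.
Proof. by rewrite ord_eqE hi_val ltn_eqF. Qed.

Lemma srefE i x : sref i x = if x == lo i then hi i else if x == hi i then lo i else x.
Proof. by rewrite /sref; case: tpermP => [->|->|/eqP/negPf -> /eqP/negPf -> //]; rewrite eqxx // eq_sym (negPf (lo_hi i)). Qed.

Lemma srefK i : involutive (sref i).
Proof. exact: tpermK. Qed.

Lemma sref_lo i : sref i (lo i) = hi i. Proof. exact: tpermL. Qed.
Lemma sref_hi i : sref i (hi i) = lo i. Proof. exact: tpermR. Qed.

Lemma sref_fix i x : x != lo i -> x != hi i -> sref i x = x.
Proof. by rewrite srefE => /negPf -> /negPf ->. Qed.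

Lemma sref_lt i x y : (x, y) != (lo i, hi i) -> (x, y) != (hi i, lo i) ->
  (sref i x < sref i y) = (x < y).
Proof.
rewrite !xpair_eqE !srefE !ord_eqE.
have := hi_val i.
case: ((x : nat) =P lo i) => ?; case: ((y : nat) =P lo i) => ?;
case: ((x : nat) =P hi i) => ?; case: ((y : nat) =P hi i) => ? /=; lia.
Qed.

Lemma ninv_adj s1 s2 x y : y < x ->
  ninv (s1 ++ x :: y :: s2) = (ninv (s1 ++ y :: x :: s2)).+1.
Proof.
move=> yx; elim: s1 => [|z s1 IH] /=.
  have -> : (x < y) = false by apply/negbTE; rewrite -leqNgt ltnW.
  by rewrite yx; lia.
rewrite IH addnS; congr (_ + _).+1.
by rewrite !count_cat /=; lia.
Qed.

Definition before x y l := [&& x \in l, y \in l & index x l < index y l].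

Lemma before_cons x y z l : x != y -> z \notin l ->
  before x y (z :: l) = if z == x then y \in l else before x y l.
Proof.
move=> xy zl; rewrite /before !inE /= [x == z]eq_sym [y == z]eq_sym.
have [->|zx] := eqVneq z x; first by rewrite (negPf xy) ltnS leq0n andbT.
have [zy|zy] := eqVneq z y; last by rewrite ltnS.
by rewrite ltn0 !andbF -zy (negPf zl) andbF.
Qed.

(** Exchanging the values i and i+1 affects the inversion status of this pair only. The additive
    form also covers lists in which one of the two letters is missing. *)
Lemma ninv_sref i l : uniq l ->
  ninv [seq sref i x | x <- l] + before (hi i) (lo i) l =
  ninv l + before (lo i) (hi i) l.
Proof.
elim: l => //= z l IH /andP[zl ul]; move/IH: (ul).
have hl' : hi i != lo i by rewrite eq_sym lo_hi.
rewrite (before_cons (lo_hi i) zl) (before_cons hl' zl).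
rewrite count_map.
have hl := lo_hi i; have hv := hi_val i.
have [zlo|zlo] := eqVneq z (lo i).
  have -> : (z == hi i) = false by rewrite zlo (negPf hl).
  have -> : before (hi i) (lo i) l = false by rewrite /before -zlo (negPf zl) andbF.
  have -> : before (lo i) (hi i) l = false by rewrite /before -zlo (negPf zl).
  rewrite !addn0 => ->; rewrite addnAC; congr (_ + _).
  rewrite zlo sref_lo -(count_uniq_mem _ ul) -count_predUI.
  rewrite [X in _ = _ + X](eq_count (a2 := pred0)) ?count_pred0 ?addn0; last first.
    by move=> x /=; case: eqP => [->|]; rewrite ?andbF // hv; lia.
  apply: eq_in_count => x xl /=; rewrite srefE.
  have xlo : x != lo i by apply: contraNneq zl => xlo; rewrite zlo -xlo.
  by rewrite (negPf xlo); move: xlo; rewrite !ord_eqE hv; case: ((x : nat) =P (lo i).+1) => /=; lia.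
have [zhi|zhi] := eqVneq z (hi i).
  have -> : before (hi i) (lo i) l = false by rewrite /before -zhi (negPf zl).
  have -> : before (lo i) (hi i) l = false by rewrite /before -zhi (negPf zl) andbF.
  rewrite !addn0 => ->; rewrite addnAC; congr (_ + _).
  rewrite zhi sref_hi -(count_uniq_mem _ ul) -count_predUI.
  rewrite [X in _ + X = _](eq_count (a2 := pred0)) ?count_pred0 ?addn0; last first.
    by move=> x /=; rewrite srefE !ord_eqE hv; case: ((x : nat) =P lo i) => ?; case: ((x : nat) =P (lo i).+1) => ? /=; lia.
  apply: eq_in_count => x xl /=; rewrite srefE.
  have : x != hi i by apply: contraNneq zl => xhi; rewrite zhi -xhi.
  by rewrite !ord_eqE hv; case: ((x : nat) =P lo i) => ?; case: ((x : nat) =P (lo i).+1) => ? /=; lia.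
rewrite (sref_fix zlo zhi) -!addnA => ->; congr (_ + _); apply: eq_in_count => x xl /=.
rewrite -{1}(sref_fix zlo zhi) sref_lt //.
  by rewrite xpair_eqE (negPf zhi) andbF.
by rewrite xpair_eqE (negPf zlo) andbF.
Qed.

Lemma index_sorted s x y : sorted (fun x y : 'I_n => x < y) s ->
  x \in s -> y \in s -> (index x s < index y s) = (x < y).
Proof.
have tr : transitive (fun x y : 'I_n => x < y) by move=> b a c; apply: ltn_trans.
move=> so xs ys; have [ix iy] : index x s < size s /\ index y s < size s.
  by rewrite !index_mem.
case: (ltngtP (index x s) (index y s)) => lt.
- by have := sorted_ltn_nth tr x so; move/(_ _ _ ix iy lt); rewrite !nth_index // => ->.
- have := sorted_ltn_nth tr x so; move/(_ _ _ iy ix lt); rewrite !nth_index // => yx.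
  by apply/esym/negbTE; rewrite -leqNgt ltnW.
have -> : x = y by rewrite -(nth_index x xs) lt nth_index.
by rewrite ltnn.
Qed.

Lemma before_map s (g : 'I_n -> 'I_n) x y : injective g ->
  sorted (fun x y : 'I_n => x < y) s -> x \in s -> y \in s ->
  before (g x) (g y) [seq g z | z <- s] = (x < y).
Proof.
by move=> gI so xs ys; rewrite /before !mem_map // !index_map // xs ys index_sorted.
Qed.

Lemma index_flatten_lt (p : seq (seq 'I_n)) x y (i j : nat) : uniq (flatten p) ->
  x \in nth [::] p i -> y \in nth [::] p j -> i < j ->
  index x (flatten p) < index y (flatten p).
Proof.
elim: p i j => [|s p IH] [|i] [|j] //=; rewrite ?nth_nil // cat_uniq !index_cat.
  case/and3P=> _ /hasPn no _ xs yp _; rewrite xs.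
  have yin : y \in flatten p.
    apply/flattenP; exists (nth [::] p j) => //.
    by case: (ltnP j (size p)) yp => [/mem_nth //|?]; rewrite nth_default.
  rewrite (negPf (no y yin)).
  by apply: leq_trans (leq_addr _ _); rewrite index_mem.
case/and3P=> _ /hasPn no u xp yp ij.
have inF z m : z \in nth [::] p m -> z \in flatten p.
  move=> zp; apply/flattenP; exists (nth [::] p m) => //.
  by case: (ltnP m (size p)) zp => [/mem_nth //|?]; rewrite nth_default.
rewrite (negPf (no x (inF _ _ xp))) (negPf (no y (inF _ _ yp))) ltn_add2l.
exact: IH xp yp ij.
Qed.

Lemma enum_lo_hi i : exists E1 E2, enum 'I_n = E1 ++ lo i :: hi i :: E2.
Proof.
exists (take (lo i) (enum 'I_n)), (drop (hi i).+1 (enum 'I_n)).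
rewrite -{1}(cat_take_drop (lo i) (enum 'I_n)); congr (_ ++ _).
rewrite (drop_nth (lo i)) ?size_enum_ord // nth_ord_enum; congr (_ :: _).
by rewrite -hi_val (drop_nth (lo i)) ?size_enum_ord // nth_ord_enum.
Qed.

(** Letters i and i+1 of one string are neighbours in its sorted alphabet, so composing with
    [sref i] on the right exchanges two adjacent entries and [ninv_adj] applies. *)
Lemma letters_lo_hi (f : 'I_n -> nat) i : f (lo i) = f (hi i) -> exists A1 A2,
  letters f (f (lo i)) = A1 ++ lo i :: hi i :: A2 /\
  forall x, x \in A1 ++ A2 -> x != lo i /\ x != hi i.
Proof.
move=> fe; have [E1 [E2 E]] := enum_lo_hi i.
exists [seq x <- E1 | f x == f (lo i)], [seq x <- E2 | f x == f (lo i)].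
split; first by rewrite /letters E filter_cat /= -fe eqxx.
move=> x; rewrite -filter_cat mem_filter => /andP[_ xE].
have := enum_uniq 'I_n; rewrite E -[lo i :: _]/([:: lo i; hi i] ++ E2) uniq_catCA.
rewrite /= inE negb_or => /and3P[/andP[_ n1] n2 _].
by split; [apply: contraNneq n1|apply: contraNneq n2] => <-.
Qed.

End Inversions.

#[local] Opaque lo hi.

(** * The action of a generator inside one string *)

Section Step.

Variable n : nat.
Implicit Types (i : 'I_n.-1) (x y : 'I_n) (s l : seq 'I_n) (p : seq (seq 'I_n)).
Implicit Types (f : 'I_n -> nat) (g : 'I_n -> 'I_n).

(** A descent at i for the lexicographic order on the keys (string, image). It is exactly the
    condition under which [s_i] moves the element. *)
Definition lowfg f g i := (f (hi i) < f (lo i)) ||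
  (f (hi i) == f (lo i)) && (g (hi i) < g (lo i)).

(** At a descent, [s_i] commutes with [g] only if [g] exchanges i and i+1: two fixed points i, i+1
    of one string are not a descent. So this test separates multiplication from conjugation. *)
Definition stepg g i x :=
  if g (lo i) == hi i then sref i (g x) else sref i (g (sref i x)).

Definition low i p := lowfg (string_index p) (deg_map p) i.

Section Letters.

Variables (i : 'I_n.-1) (f : 'I_n -> nat) (g : 'I_n -> 'I_n).
Hypotheses (gK : involutive g) (fg : forall x, f (g x) = f x).
Hypothesis fe : f (lo i) = f (hi i).

Local Notation ss := (sref i).
Local Notation L := (letters f (f (lo i))).

Let gI : injective g := inv_inj gK.

Lemma f_sref x : f (ss x) = f x.
Proof. by rewrite srefE; case: eqP => [->|_]; [|case: eqP => [->|]]. Qed.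

Let loL : lo i \in L. Proof. by rewrite mem_letters. Qed.
Let hiL : hi i \in L. Proof. by rewrite mem_letters fe. Qed.

Lemma ninv_right : g (hi i) < g (lo i) ->
  ninv [seq g x | x <- L] = (ninv [seq g (ss x) | x <- L]).+1.
Proof.
move=> lt; have [A1 [A2 [-> fx]]] := letters_lo_hi fe.
rewrite !map_cat /= sref_lo sref_hi ninv_adj //.
have E A : {subset A <= A1 ++ A2} -> [seq g (ss x) | x <- A] = [seq g x | x <- A].
  by move=> sA; apply/eq_in_map => x /sA/fx[xl xh]; rewrite sref_fix.
by rewrite !E // => x xA; rewrite mem_cat xA ?orbT.
Qed.

Lemma ninv_right_up : g (lo i) < g (hi i) ->
  ninv [seq g (ss x) | x <- L] = (ninv [seq g x | x <- L]).+1.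
Proof.
move=> lt; have [A1 [A2 [-> fx]]] := letters_lo_hi fe.
rewrite !map_cat /= sref_lo sref_hi ninv_adj //.
have E A : {subset A <= A1 ++ A2} -> [seq g (ss x) | x <- A] = [seq g x | x <- A].
  by move=> sA; apply/eq_in_map => x /sA/fx[xl xh]; rewrite sref_fix.
by rewrite !E // => x xA; rewrite mem_cat xA ?orbT.
Qed.

Lemma ninv_left (h : 'I_n -> 'I_n) a b : injective h -> h a = lo i -> h b = hi i ->
  a \in L -> b \in L ->
  ninv [seq ss (h x) | x <- L] + (b < a) = ninv [seq h x | x <- L] + (a < b).
Proof.
move=> hI ha hb aL bL.
have so := letters_sorted f (f (lo i)).
have u : uniq [seq h x | x <- L] by rewrite map_inj_uniq ?uniq_letters.
have := ninv_sref i u.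
have := before_map hI so bL aL; rewrite ha hb => ->.
have := before_map hI so aL bL; rewrite ha hb => ->.
by rewrite -map_comp.
Qed.

Let glo : g (lo i) \in L. Proof. by rewrite mem_letters fg. Qed.
Let ghi : g (hi i) \in L. Proof. by rewrite mem_letters fg fe. Qed.
Let ssL x : x \in L -> ss x \in L. Proof. by rewrite !mem_letters f_sref. Qed.

Lemma cross : g (lo i) == hi i -> g (hi i) = lo i.
Proof. by move/eqP <-; rewrite gK. Qed.

Lemma cross' : g (hi i) = lo i -> g (lo i) == hi i.
Proof. by move <-; rewrite gK. Qed.

Let ninv_conj : ninv [seq ss (g (ss x)) | x <- L] + (ss (g (hi i)) < ss (g (lo i))) =
  ninv [seq g (ss x) | x <- L] + (ss (g (lo i)) < ss (g (hi i))).
Proof.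
apply: (@ninv_left (g \o ss)) => /=; rewrite ?srefK ?gK ?ssL //.
by apply: inj_comp => //; apply: inv_inj (srefK i).
Qed.

Let ninv_one : ninv [seq ss (g x) | x <- L] + (g (hi i) < g (lo i)) =
  ninv [seq g x | x <- L] + (g (lo i) < g (hi i)).
Proof. by apply: ninv_left; rewrite ?gK. Qed.

Let ss_glt : g (lo i) != hi i -> g (lo i) != lo i \/ g (hi i) != hi i ->
  (ss (g (lo i)) < ss (g (hi i))) = (g (lo i) < g (hi i)) /\
  (ss (g (hi i)) < ss (g (lo i))) = (g (hi i) < g (lo i)).
Proof.
move=> nc nf; have nc' : g (hi i) != lo i by apply: contraNneq nc => /cross' ->.
split; apply: sref_lt; rewrite xpair_eqE ?(negPf nc) ?(negPf nc') ?andbF //.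
  by case: nf => /negPf ->; rewrite ?andbF.
by case: nf => /negPf ->; rewrite ?andbF.
Qed.

(** The length tests in the definition of the action reduce to comparing the images of i and i+1.
    Unless [g] exchanges or fixes both letters, left and right multiplication by [s_i] change the
    length in the same direction, so conjugation changes it by two. *)
Lemma string_act_dec : string_act i [seq g x | x <- L] =
  if g (hi i) < g (lo i) then [seq stepg g i x | x <- L] else [seq g x | x <- L].
Proof.
rewrite /string_act alphabet_dec //.
have sm x : x \in L -> strmap [seq g y | y <- L] x = g x.
  by rewrite mem_letters => /eqP fx; apply: strmap_dec.
rewrite (_ : [seq ss (strmap _ (ss x)) | x <- L] = [seq ss (g (ss x)) | x <- L]);
  last by apply/eq_in_map => x xL; rewrite sm // ssL.
rewrite (_ : [seq ss (strmap _ x) | x <- L] = [seq ss (g x) | x <- L]); last first.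
  by apply/eq_in_map => x xL; rewrite sm.
have inj_gl : g (lo i) != g (hi i) by rewrite (inj_eq gI) lo_hi.
have [cr|nc] := boolP (g (lo i) == hi i).
  have gl := eqP cr; have gh := cross cr.
  have lt : g (hi i) < g (lo i) by rewrite gl gh hi_val.
  have E : [seq ss (g (ss x)) | x <- L] = [seq g x | x <- L].
    apply: eq_map => x; rewrite (srefE i x).
    have [->|xl] := eqVneq x (lo i); first by rewrite gh gl sref_lo.
    have [->|xh] := eqVneq x (hi i); first by rewrite gh gl sref_hi.
    rewrite sref_fix //; first by rewrite -[lo i]gh (inj_eq gI).
    by rewrite -[hi i]gl (inj_eq gI).
  rewrite E eqxx lt /=.
  have -> : (ninv [seq g x | x <- L] == ninv [seq g x | x <- L] + 2) = false by lia.
  have := ninv_one; rewrite lt ltnNge (ltnW lt) addn0 /= => ->.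
  by rewrite eqxx; apply: eq_map => x; rewrite /stepg cr.
rewrite (_ : [seq stepg g i x | x <- L] = [seq ss (g (ss x)) | x <- L]); last first.
  by apply: eq_map => x; rewrite /stepg (negPf nc).
case: ltnP => lt.
  have nf : g (lo i) != lo i \/ g (hi i) != hi i.
    have [gl|?] := eqVneq (g (lo i)) (lo i); last by left.
    right; apply: contraTneq lt => ->; rewrite gl hi_val; lia.
  have [e1 e2] := ss_glt nc nf; have := ninv_conj; rewrite e1 e2 lt.
  rewrite ltnNge (ltnW lt) /= => e3; rewrite (ninv_right lt).
  by have -> : (ninv [seq g (ss x) | x <- L]).+1 ==
       ninv [seq ss (g (ss x)) | x <- L] + 2 by lia.
have {}lt : g (lo i) < g (hi i).
  by rewrite ltn_neqAle lt andbT -ord_eqE.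
have e1 := ninv_right_up lt.
have := ninv_one; rewrite lt ltnNge (ltnW lt) /= => e2.
have e3 := ninv_conj.
have -> : (ninv [seq g x | x <- L] == ninv [seq ss (g (ss x)) | x <- L] + 2) = false.
  by move: e3; case: (_ < _); case: (_ < _) => /=; lia.
have -> : (ninv [seq g x | x <- L] == ninv [seq ss (g x) | x <- L] + 1) = false by lia.
by rewrite andbF.
Qed.

(** Conjugation removes two inversions and keeps the number of two-cycles; splitting the two-cycle
    (i, i+1) removes one inversion and one two-cycle. Either way the half-sum drops by one. *)
Lemma count_step : g (hi i) < g (lo i) ->
  ninv [seq g x | x <- L] + count (fun x => x < g x) L =
  (ninv [seq stepg g i x | x <- L] + count (fun x => x < stepg g i x) L).+2.
Proof.
move=> lt.
have [cr|nc] := boolP (g (lo i) == hi i).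
  have gl := eqP cr; have gh := cross cr.
  have E : stepg g i =1 (fun x => ss (g x)) by move=> x; rewrite /stepg cr.
  rewrite (eq_map E) [X in _ = (_ + X).+2](eq_count (a2 := fun x => x < ss (g x))); last by move=> x /=; rewrite E.
  have := ninv_one; rewrite lt ltnNge (ltnW lt) /= => e2.
  suff : count (fun x => x < g x) L = (count (fun x => x < ss (g x)) L).+1 by lia.
  have [A1 [A2 [-> fx]]] := letters_lo_hi fe.
  have EA A : {subset A <= A1 ++ A2} ->
     count (fun x => x < ss (g x)) A = count (fun x => x < g x) A.
    move=> sA; apply: eq_in_count => x /sA/fx[xl xh]; rewrite sref_fix //.
      by rewrite -gh (inj_eq gI).
    by rewrite -gl (inj_eq gI).
  rewrite !count_cat /= !EA => [|x xA|x xA]; try by rewrite mem_cat xA ?orbT.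
  by rewrite gl gh sref_lo sref_hi !ltnn hi_val; lia.
have nf : g (lo i) != lo i \/ g (hi i) != hi i.
  have [gl|?] := eqVneq (g (lo i)) (lo i); last by left.
  right; apply: contraTneq lt => ->; rewrite gl hi_val; lia.
have E : stepg g i =1 (fun x => ss (g (ss x))) by move=> x; rewrite /stepg (negPf nc).
rewrite (eq_map E) [X in _ = (_ + X).+2](eq_count (a2 := fun x => x < ss (g (ss x)))); last by move=> x /=; rewrite E.
have [e1 e2] := ss_glt nc nf; have := ninv_conj; rewrite e1 e2 lt.
rewrite ltnNge (ltnW lt) /= => e3; rewrite (ninv_right lt).
suff : count (fun x => x < g x) L = count (fun x => x < ss (g (ss x))) L by lia.
have pL : perm_eq L [seq ss x | x <- L].
  apply: uniq_perm; rewrite ?uniq_letters ?(map_inj_uniq (inv_inj (srefK i))) ?uniq_letters //.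
  by move=> x; rewrite -{2}[x](srefK i) (mem_map (inv_inj (srefK i))) !mem_letters f_sref.
rewrite [RHS](seq.permP pL) count_map; apply: eq_count => x /=.
rewrite srefK sref_lt //.
  apply: contraNneq nc => -[-> <-]; by rewrite eqxx.
by apply: contraNneq nc => -[-> /cross' ->].
Qed.

End Letters.

End Step.

(** * The action on degenerate involutions and the drop of the length *)

Section Monoid.

Variable n : nat.
Implicit Types (i : 'I_n.-1) (x y : 'I_n) (s l : seq 'I_n) (p q : seq (seq 'I_n)).
Implicit Types (f : 'I_n -> nat) (g : 'I_n -> 'I_n) (mu : seq nat).

Lemma stepg_cross g i : involutive g -> g (lo i) == hi i ->
  forall x, sref i (g (sref i x)) = g x.
Proof.
move=> gK /eqP gl x; have gI := inv_inj gK.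
have gh : g (hi i) = lo i by rewrite -gl gK.
have [->|xl] := eqVneq x (lo i); first by rewrite sref_lo gh gl sref_lo.
have [->|xh] := eqVneq x (hi i); first by rewrite sref_hi gh gl sref_hi.
rewrite (sref_fix xl xh) sref_fix //; first by rewrite -[lo i]gh (inj_eq gI).
by rewrite -[hi i]gl (inj_eq gI).
Qed.

Lemma good_step R f g i : good R f g -> good R (fun x => f (sref i x)) (stepg g i).
Proof.
move=> [fR gK fg]; rewrite /stepg.
have [cr|nc] := boolP (g (lo i) == hi i); split=> //.
- by move=> x; rewrite (stepg_cross gK cr) gK.
- move=> x; rewrite srefK fg f_sref //.
  by rewrite -(eqP cr) fg.
- by move=> x; rewrite srefK gK srefK.
by move=> x; rewrite srefK fg.
Qed.

Lemma muinv_step mu p i : muinv mu p ->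
  muinv mu (dec (size mu) (fun x => string_index p (sref i x)) (stepg (deg_map p) i)).
Proof.
move=> pI; apply: (muinv_dec_perm (w := sref i) pI) => //.
exact: good_step (encode_good pI).
Qed.

Lemma stepg_in_other f g i j x : involutive g -> (forall y, f (g y) = f y) ->
  f (lo i) = f (hi i) -> f x = j -> (f (lo i) == j) = false -> stepg g i x = g x.
Proof.
move=> gK fg fe fx fj.
have xl : x != lo i by apply: contraFneq fj => <-; rewrite fx.
have xh : x != hi i by apply: contraFneq fj => xh; rewrite fe -xh fx.
have gl : g x != lo i by apply: contraFneq fj => <-; rewrite fg fx.
have gh : g x != hi i by apply: contraFneq fj => gh; rewrite fe -gh fg fx.
by rewrite /stepg (sref_fix xl xh) (sref_fix gl gh) if_same.
Qed.

(** With i and i+1 in different strings, [sref i] is increasing on each string, so the relabelled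
    alphabet is still sorted. *)
Lemma letters_sref f i j : f (lo i) != f (hi i) ->
  letters (fun x => f (sref i x)) j = [seq sref i x | x <- letters f j].
Proof.
move=> fne; have tr : transitive (fun x y : 'I_n => x < y).
  by move=> b a c; apply: ltn_trans.
apply: (@irr_sorted_eq _ (fun x y : 'I_n => x < y)) => //.
- by move=> x; apply: ltnn.
- exact: letters_sorted.
- apply: (homo_sorted_in (P := fun x => f x == j) (e := fun x y : 'I_n => x < y)).
  + move=> x y; rewrite !unfold_in => /eqP fx /eqP fy; rewrite sref_lt //.
      by apply: contraNneq fne => -[<- <-]; rewrite fx fy.
    by apply: contraNneq fne => -[<- <-]; rewrite fx fy.
  + by apply/allP => x; rewrite mem_letters.
  exact: letters_sorted.
move=> x; rewrite -{2}[x](srefK i) (mem_map (inv_inj (srefK i))).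
by rewrite !mem_letters.
Qed.

Section Action.

Variables (mu : seq nat) (p : seq (seq 'I_n)).
Hypothesis p_inv : muinv mu p.

Local Notation f := (string_index p).
Local Notation g := (deg_map p).
Local Notation R := (size mu).

Let fR : forall x, f x < R. Proof. by case: (encode_good p_inv). Qed.
Let gK : involutive g. Proof. by case: (encode_good p_inv). Qed.
Let fg : forall x, f (g x) = f x. Proof. by case: (encode_good p_inv). Qed.

Let both_inE i j : both_in i (nth [::] p j) = (f (lo i) == j) && (f (hi i) == j).
Proof. by rewrite /both_in !(string_indexP p_inv). Qed.

Let has_both i : has (both_in i) p = (f (lo i) == f (hi i)).
Proof.
apply/(has_nthP [::])/idP => [[j _]|/eqP fe].
  by rewrite both_inE => /andP[/eqP -> /eqP ->].
exists (f (lo i)); first exact: (string_index_lt p_inv).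
by rewrite both_inE fe eqxx.
Qed.

Let index_lt x y : f x < f y -> index x (flatten p) < index y (flatten p).
Proof.
apply: index_flatten_lt; last 2 first.
- exact: (mem_string_index p_inv).
- exact: (mem_string_index p_inv).
by case/and3P: p_inv => _ /perm_uniq -> _; rewrite enum_uniq.
Qed.

(** Across strings, exchanging the letters i and i+1 in the one-line notation relabels the alphabets
    as well as the images, which is conjugation of [g]; [g] cannot exchange letters of different
    strings. *)
Lemma mact_low i : low i p ->
  Defs.mact i p = dec R (fun x => f (sref i x)) (stepg g i).
Proof.
rewrite /low /lowfg /Defs.mact has_both => lw.
rewrite /dec /mkseq; case: ifP => [/eqP fe|/negbT fne].
  rewrite {1}(encodeK p_inv) /dec /mkseq -map_comp; apply/eq_in_map => j.
  rewrite mem_iota /= add0n => jR.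
  rewrite -(nth_string p_inv) ?(muinv_size p_inv) // both_inE.
  rewrite (nth_string p_inv) ?(muinv_size p_inv) //.
  rewrite (_ : letters (fun x => f (sref i x)) j = letters f j); last first.
    by apply: eq_filter => x; rewrite f_sref.
  case: ifP => [/andP[/eqP <- _]|].
    rewrite string_act_dec //; move: lw; rewrite fe ltnn eqxx /= => ->.
    by [].
  rewrite -fe andbb => fj; apply/eq_in_map => x; rewrite mem_letters => /eqP fx.
  by rewrite (stepg_in_other gK fg fe fx fj).
have lt : f (hi i) < f (lo i) by move: lw; rewrite eq_sym (negPf fne) orbF.
rewrite index_lt //.
rewrite {1}(encodeK p_inv) /dec /mkseq -map_comp; apply: eq_map => j.
rewrite letters_sref //= -!map_comp; apply: eq_map => x /=.
rewrite /stepg srefK; case: eqP => // gl.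
by case/eqP: fne; rewrite -gl fg.
Qed.

Lemma mact_up i : ~~ low i p -> Defs.mact i p = p.
Proof.
rewrite /low /lowfg /Defs.mact has_both negb_or => /andP[nlt ngt].
case: ifP => [/eqP fe|/negbT fne].
  rewrite {1 2}(encodeK p_inv) /dec /mkseq -map_comp; apply/eq_in_map => j.
  rewrite mem_iota /= add0n => jR.
  rewrite -(nth_string p_inv) ?(muinv_size p_inv) // both_inE.
  rewrite (nth_string p_inv) ?(muinv_size p_inv) //.
  case: ifP => [/andP[/eqP <- _]|//].
  by rewrite string_act_dec //; move: ngt; rewrite fe eqxx /= => /negPf ->.
have lt : f (lo i) < f (hi i) by rewrite ltn_neqAle fne leqNgt.
by rewrite ltnNge (ltnW (index_lt lt)).
Qed.

Lemma string_index_mact i : low i p -> string_index (Defs.mact i p) =1 (fun x => f (sref i x)).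
Proof.
move=> lw x; rewrite mact_low //.
exact: (string_index_dec (good_step i (encode_good p_inv))).
Qed.

Lemma deg_map_mact i : low i p -> deg_map (Defs.mact i p) =1 stepg g i.
Proof.
move=> lw x; rewrite mact_low //.
exact: (deg_map_dec (good_step i (encode_good p_inv))).
Qed.

Lemma muinv_mact i : muinv mu (Defs.mact i p).
Proof.
have [lw|up] := boolP (low i p); last by rewrite mact_up.
by rewrite mact_low //; apply: muinv_step.
Qed.

End Action.

Definition Lfg f g j :=
  (ninv [seq g x | x <- letters f j] + count (fun x => x < g x) (letters f j))./2.

Lemma Lmu_dec R f g : good R f g ->
  Lmu (dec R f g) = ninv (flatten (mkseq (letters f) R)) + \sum_(j < R) Lfg f g j.
Proof.
move=> [fR gK fg]; rewrite /Lmu /dec /mkseq -!map_comp sumnE big_map.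
congr (ninv (flatten _) + _).
  by apply: eq_map => j /=; rewrite alphabet_dec.
rewrite -(big_mkord xpredT (Lfg f g)) /index_iota subn0; apply: eq_bigr => j _ /=.
rewrite /Lstring /Lfg /exc; congr (_ + _)./2.
rewrite (seq.permP (perm_map_letters j gK fg)); apply: eq_in_count => x.
by rewrite mem_letters => /eqP fx; rewrite strmap_dec.
Qed.

Lemma flatten_letters_perm R f : (forall x, f x < R) ->
  perm_eq (flatten (mkseq (letters f) R)) (enum 'I_n).
Proof.
move=> fR; have H : good R f id by split.
have := flatten_dec_perm H; rewrite /dec.
by rewrite (_ : mkseq _ R = mkseq (letters f) R) //; apply: eq_map => j; rewrite map_id.
Qed.

(** Across strings, the sorted word loses one inversion while the pattern of every string is
    unchanged, no string containing both letters. Inside a string, the sorted word is unchanged and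
    only that string contributes, by [count_step]. *)
Lemma Lmu_mact mu p i : muinv mu p -> low i p -> Lmu p = (Lmu (Defs.mact i p)).+1.
Proof.
move=> pI lw; have G := encode_good pI; have [fR gK fg] := G.
rewrite (mact_low pI lw) {1}(encodeK pI) !Lmu_dec //; last exact: good_step.
move: lw; rewrite /low; set f := string_index p in G fR fg *.
set g := deg_map p in G gK fg *; set R := size mu in G fR *.
rewrite /lowfg; have [fe|fne] := eqVneq (f (lo i)) (f (hi i)); last first.
  rewrite ?orbF => lt.
  rewrite (_ : mkseq (letters (fun x => f (sref i x))) R =
     [seq [seq sref i x | x <- s] | s <- mkseq (letters f) R]); last first.
    by rewrite /mkseq -map_comp; apply: eq_map => j; rewrite letters_sref.
  rewrite -map_flatten.
  have pe := flatten_letters_perm fR.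
  have u : uniq (flatten (mkseq (letters f) R)) by rewrite (perm_uniq pe) enum_uniq.
  have inF x : x \in flatten (mkseq (letters f) R) by rewrite (perm_mem pe) mem_enum.
  have ix : index (hi i) (flatten (mkseq (letters f) R)) <
            index (lo i) (flatten (mkseq (letters f) R)).
    by apply: (index_flatten_lt u _ _ lt); rewrite nth_mkseq // mem_letters.
  have := ninv_sref i u; rewrite /before !inF ix ltnNge (ltnW ix) addn0 addn1 => <-.
  rewrite addSn; congr (_ + _).+1; apply: eq_bigr => j _.
  have ng : g (lo i) != hi i by apply: contraNneq fne => <-; rewrite fg.
  have E x : stepg g i x = sref i (g (sref i x)) by rewrite /stepg (negPf ng).
  rewrite /Lfg letters_sref // -map_comp count_map; congr (_ + _)./2.
    have M : [seq (stepg g i \o sref i) x | x <- letters f j] =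
        [seq (sref i \o g) x | x <- letters f j].
      by apply: eq_map => x; rewrite /= E srefK.
    rewrite M (map_comp (sref i) g).
    have ug : uniq [seq g x | x <- letters f j].
      by rewrite map_inj_uniq ?uniq_letters //; apply: inv_inj.
    have := ninv_sref i ug.
    have inL x : (x \in [seq g y | y <- letters f j]) = (f x == j).
      by rewrite (perm_mem (perm_map_letters j gK fg)) mem_letters.
    rewrite /before !inL.
    have nb : (f (lo i) == j) && (f (hi i) == j) = false.
      by apply: contraNF fne => /andP[/eqP -> /eqP ->].
    have nb' : (f (hi i) == j) && (f (lo i) == j) = false by rewrite andbC.
    by rewrite !andbA nb nb' /= !addn0 => /esym.
  apply: eq_in_count => x; rewrite mem_letters => /eqP fx /=.
  rewrite E srefK sref_lt //.
    by apply: contraNneq fne => -[<- <-]; rewrite fg.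
  by apply: contraNneq fne => -[<- <-]; rewrite fg.
rewrite fe ltnn /= => lt.
have lE j : letters (fun x => f (sref i x)) j = letters f j.
  by apply: eq_filter => x; rewrite f_sref.
rewrite (_ : mkseq (letters (fun x => f (sref i x))) R = mkseq (letters f) R); last first.
  exact: eq_map.
rewrite -addnS; congr (_ + _).
rewrite (bigD1 (Ordinal (fR (lo i)))) //= [in RHS](bigD1 (Ordinal (fR (lo i)))) //=.
rewrite -addSn; congr (_ + _).
  by rewrite /Lfg lE count_step.
apply: eq_bigr => j; rewrite -val_eqE /= eq_sym => /negPf fj.
have E x : x \in letters f j -> stepg g i x = g x.
  by rewrite mem_letters => /eqP fx; rewrite (stepg_in_other gK fg fe fx fj).
rewrite /Lfg lE; congr (_ + _)./2.
  by congr ninv; apply/eq_in_map => x /E.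
by apply: eq_in_count => x /E ->.
Qed.

End Monoid.

(** * Reduced words *)

Section Reduced.

Variable n : nat.
Implicit Types (i j : 'I_n.-1) (x y : 'I_n) (w : 'S_n) (t u : seq 'I_n.-1).

Local Notation prods t := (\prod_(i <- t) sref i)%g.

Lemma letters0 : letters (fun=> 0) 0 = enum 'I_n.
Proof. by rewrite /letters (eq_filter (a2 := predT)) ?filter_predT. Qed.

Lemma ell_sref w i : w (hi i) < w (lo i) -> ell w = (ell (sref i * w)%g).+1.
Proof.
move=> lt; rewrite /ell -letters0 (ninv_right (i := i) (f := fun=> 0) erefl lt).
by congr (ninv _).+1; apply: eq_map => x; rewrite permM.
Qed.

Lemma ell_sref_up w i : w (lo i) < w (hi i) -> ell (sref i * w)%g = (ell w).+1.
Proof.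
move=> lt; rewrite /ell -letters0 -(ninv_right_up (i := i) (f := fun=> 0) erefl lt).
by congr ninv; apply: eq_map => x; rewrite permM.
Qed.

Lemma desc_total w i : ~~ (w (hi i) < w (lo i)) -> w (lo i) < w (hi i).
Proof.
rewrite -leqNgt leq_eqVlt => /orP[/eqP/val_inj/perm_inj/eqP|//].
by rewrite (negPf (lo_hi i)).
Qed.

Lemma ell_sref_neq w i : ell (sref i * w)%g != ell w.
Proof.
have [lt|/desc_total lt] := boolP (w (hi i) < w (lo i)).
  by rewrite (ell_sref lt); lia.
by rewrite (ell_sref_up lt); lia.
Qed.

Lemma ell_sref_le w i : ell (sref i * w)%g <= (ell w).+1.
Proof.
have [lt|/desc_total lt] := boolP (w (hi i) < w (lo i)).
  by rewrite (ell_sref lt); lia.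
by rewrite (ell_sref_up lt).
Qed.

Lemma lo_hi_exists x y : y = x.+1 :> nat -> exists i, lo i = x /\ hi i = y.
Proof.
move=> yx; have lt : x < n.-1 by have := ltn_ord y; lia.
exists (Ordinal lt); have e : lo (Ordinal lt) = x by apply: val_inj.
by split=> //; apply: val_inj; rewrite /= hi_val e.
Qed.

Lemma adjacent_lt (A : 'I_n -> nat) : (forall i, A (lo i) < A (hi i)) ->
  forall x y, x < y -> A x < A y.
Proof.
move=> inc x y xy.
have [d yd] : exists d, y = x + d.+1 :> nat by exists (y - x).-1; lia.
elim: d x {xy} yd => [|d IH] x yd.
  by have [|i [<- <-]] := @lo_hi_exists x y; [lia|apply: inc].
have lt : x.+1 < n by have := ltn_ord y; lia.
have [z zx] : exists z : 'I_n, z = x.+1 :> nat by exists (Ordinal lt).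
have [i [lx hz]] := lo_hi_exists zx.
by apply: ltn_trans (IH z _); [rewrite -lx -hz|lia].
Qed.

Lemma desc_exists w : w != 1%g -> exists i, w (hi i) < w (lo i).
Proof.
move=> w1; have [/existsP[i lt]|no] := boolP [exists i : 'I_n.-1, w (hi i) < w (lo i)].
  by exists i.
case/eqP: w1; rewrite negb_exists in no; move/forallP: no => no.
have inc x y : x < y -> w x < w y.
  by apply: (@adjacent_lt (fun x => w x)) => i; apply: desc_total.
have E : [seq w x | x <- enum 'I_n] = enum 'I_n.
  apply: (@irr_sorted_eq _ (fun x y : 'I_n => x < y)) => //.
  - by move=> b a c; apply: ltn_trans.
  - by move=> x; apply: ltnn.
  - apply: (homo_sorted (e := fun x y : 'I_n => x < y)) => [x y|]; first exact: inc.
    by rewrite -letters0; apply: letters_sorted.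
  - rewrite -letters0; exact: letters_sorted.
  by move=> x; rewrite -{1}(permKV w x) (mem_map (@perm_inj _ w)) !mem_enum.
apply/permP => x; rewrite perm1.
have xe : x \in enum 'I_n by rewrite mem_enum.
transitivity (nth x [seq w y | y <- enum 'I_n] (index x (enum 'I_n))).
  by rewrite (nth_map x) ?nth_index ?index_mem.
by rewrite E nth_index.
Qed.

Lemma ell1 : ell (1%g : 'S_n) = 0.
Proof.
rewrite /ell (eq_map (g := id)) ?map_id; last by move=> x; rewrite perm1.
have := letters_sorted (fun=> 0) 0 (n := n); rewrite letters0.
elim: (enum _) => //= x s IH px.
rewrite (eq_in_count (a2 := pred0)) ?count_pred0; last first.
  move=> y ys; have tr : transitive (fun x y : 'I_n => x < y).
    by move=> b a c; apply: ltn_trans.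
  have /allP/(_ y ys) xy := order_path_min tr px.
  by apply/negbTE; rewrite -leqNgt ltnW.
by rewrite add0n IH //; apply: path_sorted px.
Qed.

Lemma ell_prods_le t : ell (prods t) <= size t.
Proof.
elim: t => [|i t IH]; first by rewrite big_nil ell1.
by rewrite big_cons; apply: leq_trans (ell_sref_le _ _) _.
Qed.

Definition reduced t := size t == ell (prods t).

Lemma reduced_exists w : exists t, prods t = w /\ reduced t.
Proof.
have [m] := ubnP (ell w); elim: m w => // m IH w wm.
have [->|w1] := eqVneq w 1%g; first by exists [::]; rewrite /reduced big_nil ell1.
have [i lt] := desc_exists w1.
have [|t [pt rt]] := IH (sref i * w)%g; first by have := ell_sref lt; lia.
exists (i :: t); have E : prods (i :: t) = w.
  by rewrite big_cons pt mulgA tperm2 mul1g.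
split=> //; rewrite /reduced E /= (eqP rt) pt.
by rewrite (ell_sref lt).
Qed.

Lemma redwordP w : prods (redword w) = w /\ size (redword w) = ell w.
Proof.
rewrite /redword; case: pickP => [t /eqP pt|no].
  by split; [exact: pt|exact: size_tuple].
have [t [pt /eqP rt]] := reduced_exists w.
have st : size t == ell w by rewrite rt pt.
by have := no (Tuple st); rewrite /= pt eqxx.
Qed.

Lemma reduced_redword w : reduced (redword w).
Proof. by have [p s] := redwordP w; rewrite /reduced p s. Qed.

Lemma reduced_cons i t : reduced (i :: t) ->
  reduced t /\ prods (i :: t) (hi i) < prods (i :: t) (lo i).
Proof.
rewrite /reduced big_cons /= => /eqP e.
have le1 := ell_prods_le t; have le2 := ell_sref_le (prods t) i.
have rt : size t = ell (prods t).
  by apply/eqP; rewrite eqn_leq le1 andbT -ltnS e le2.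
split; first by rewrite rt.
have [//|/desc_total lt] := boolP ((sref i * prods t)%g (hi i) < _).
have := ell_sref_up lt; rewrite mulgA tperm2 mul1g => E.
by move: le1; rewrite E -e ltnNge leqW.
Qed.

Section Matsumoto.

Variables (T : Type) (F : 'I_n.-1 -> T -> T).
Hypothesis F_comm : forall i j (x : T), i.+1 < j -> F i (F j x) = F j (F i x).
Hypothesis F_braid : forall i j (x : T), j = i.+1 :> nat ->
  F i (F j (F i x)) = F j (F i (F j x)).

Lemma sref_far i j : i.+1 < j ->
  [/\ sref i (lo j) = lo j, sref i (hi j) = hi j,
      sref j (lo i) = lo i & sref j (hi i) = hi i].
Proof.
move=> ij; have li : lo i = i :> nat by []. have lj : lo j = j :> nat by [].
by split; apply: sref_fix; rewrite ord_eqE ?hi_val li lj; lia.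
Qed.

Lemma sref_near i j : j = i.+1 :> nat ->
  [/\ hi i = lo j, sref i (hi j) = hi j & sref j (lo i) = lo i].
Proof.
move=> ij; have li : lo i = i :> nat by []. have lj : lo j = j :> nat by [].
have e : hi i = lo j by apply: val_inj; rewrite /= hi_val li lj.
by split=> //; apply: sref_fix; rewrite ord_eqE ?hi_val li lj; lia.
Qed.

Lemma sref_conj i j : (sref i * sref j * sref i = tperm (sref i (lo j)) (sref i (hi j)))%g.
Proof. by rewrite -tpermJ conjgE tpermV mulgA. Qed.

Lemma sref_far_comm i j : i.+1 < j -> (sref i * sref j = sref j * sref i)%g.
Proof.
move=> /sref_far[e1 e2 _ _]; have := sref_conj i j; rewrite e1 e2 => e.
by rewrite -[sref j in RHS]e -!mulgA tperm2 mulg1.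
Qed.

Lemma sref_near_braid i j : j = i.+1 :> nat ->
  (sref i * sref j * sref i = sref j * sref i * sref j)%g.
Proof.
move=> /sref_near[e1 e2 e3].
by rewrite !sref_conj e2 e3 -e1 sref_hi e1 sref_lo.
Qed.

Lemma reduced_up i t : prods t (lo i) < prods t (hi i) -> reduced t -> reduced (i :: t).
Proof. by move=> lt /eqP rt; rewrite /reduced big_cons /= (ell_sref_up lt) -rt. Qed.

(* If i and j are two left descents of w, the longest element of the subgroup
   generated by s_i and s_j splits off w from the left. *)
Lemma matsumoto t u (x : T) : reduced t -> reduced u -> prods t = prods u ->
  foldr F x t = foldr F x u.
Proof.
have [m] := ubnP (size t); elim: m t u x => // m IH [|i t] [|j u] x //=.
- by move=> _ _ ru; rewrite big_nil => e; move: ru; rewrite /reduced -e ell1.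
- by move=> _ rt _; rewrite big_nil => e; move: rt; rewrite /reduced e ell1.
rewrite ltnS => tm rit rju e.
have su : size u = size t.
  by move: rit rju; rewrite /reduced e /= => /eqP <- /eqP[].
have [rt di] := reduced_cons rit; have [ru dj] := reduced_cons rju.
rewrite -e in dj; set w := (\prod_(_ <- i :: t) _)%g in e di dj.
have pt : prods t = (sref i * w)%g by rewrite /w big_cons mulgA tperm2 mul1g.
have pu : prods u = (sref j * w)%g by rewrite e big_cons mulgA tperm2 mul1g.
have main a b ta ub : w (hi a) < w (lo a) -> w (hi b) < w (lo b) -> a < b ->
    reduced ta -> reduced ub -> size ta < m -> size ub < m ->
    prods ta = (sref a * w)%g -> prods ub = (sref b * w)%g ->
    F a (foldr F x ta) = F b (foldr F x ub).
  move=> da db lt rta rub sta sub pta pub.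
  have [far|near] : a.+1 < b \/ b = a.+1 :> nat by lia.
    have [e1 e2 e3 e4] := sref_far far.
    have [v [pv rv]] := reduced_exists (sref b * (sref a * w))%g.
    have cm := sref_far_comm far.
    have r1 : reduced (b :: v).
      by apply: reduced_up => //; rewrite pv !permM sref_lo sref_hi e1 e2.
    have r2 : reduced (a :: v).
      apply: reduced_up => //; rewrite pv mulgA -cm -mulgA !permM sref_lo sref_hi.
      by rewrite e3 e4.
    rewrite (IH ta (b :: v)) ?(IH ub (a :: v)) //=; first by rewrite F_comm.
      by rewrite big_cons pv mulgA cm -mulgA [X in (_ * X)%g]mulgA tperm2 mul1g.
    by rewrite big_cons pv mulgA tperm2 mul1g.
  have [e1 e2 e3] := sref_near near.
  have cm := sref_near_braid near.
  have [v [pv rv]] := reduced_exists (sref a * (sref b * (sref a * w)))%g.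
  have pv2 : prods v = (sref b * (sref a * (sref b * w)))%g.
    by rewrite pv !mulgA cm.
  have gt : w (hi b) < w (lo a) by rewrite -e1 in db; apply: ltn_trans db da.
  have pav : prods (a :: v) = (sref b * (sref a * w))%g.
    by rewrite big_cons pv mulgA tperm2 mul1g.
  have pbv : prods (b :: v) = (sref a * (sref b * w))%g.
    by rewrite big_cons pv2 mulgA tperm2 mul1g.
  have ra : reduced (a :: v).
    apply: reduced_up => //; rewrite pv !permM sref_lo sref_hi e3 sref_lo.
    by rewrite e1 sref_lo e2 -e1; rewrite -e1 in db.
  have rb : reduced (b :: v).
    apply: reduced_up => //; rewrite pv2 !permM sref_lo sref_hi e2 sref_hi.
    by rewrite -e1 sref_hi e3 e1; rewrite e1 in da.
  have rba : reduced (b :: a :: v).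
    apply: reduced_up => //; rewrite pav !permM sref_lo sref_hi e2 -e1.
    by rewrite sref_hi.
  have rab : reduced (a :: b :: v).
    apply: reduced_up => //; rewrite pbv !permM sref_lo sref_hi e3 e1.
    by rewrite sref_lo.
  rewrite (IH ta (b :: a :: v)) ?(IH ub (a :: b :: v)) //=; first exact: F_braid.
    by rewrite big_cons pbv mulgA tperm2 mul1g.
  by rewrite big_cons pav mulgA tperm2 mul1g.
have [ij|] := eqVneq i j.
  by subst j; rewrite (IH t u) // pt pu.
rewrite -val_eqE /= neq_ltn => /orP[lt|lt].
  by apply: main; rewrite ?su.
by apply/esym; apply: main; rewrite ?su.
Qed.

End Matsumoto.

End Reduced.

(** * The braid relations *)

Section Braid.

Variable n : nat.
Implicit Types (i j : 'I_n.-1) (x y : 'I_n) (w : 'S_n).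

Lemma hi_loF i : (hi i < lo i) = false.
Proof. by rewrite hi_val; lia. Qed.

(* A state is a bijection a.2 from rows to columns with a string index a.1 on
   the rows; rop sorts rows, cop sorts columns, and the action on a degenerate
   involution, seen as a symmetric state, is their product. *)
Definition state : Type := ({ffun 'I_n -> nat} * 'S_n)%type.
Implicit Types a : state.

Definition klt a x y := (a.1 x < a.1 y) || (a.1 x == a.1 y) && (a.2 x < a.2 y).
Definition rmv i a : state := ([ffun x => a.1 (sref i x)], (sref i * a.2)%g).
Definition rop i a := if klt a (hi i) (lo i) then rmv i a else a.
Definition trs a : state := ([ffun x => a.1 ((a.2^-1)%g x)], (a.2^-1)%g).
Definition cop i a := trs (rop i (trs a)).

Lemma trsK : involutive trs.
Proof.
case=> f g; rewrite /trs /= invgK; congr (_, _).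
by apply/ffunP => x; rewrite !ffunE permK.
Qed.

Lemma klt_rmv i a x y : klt (rmv i a) x y = klt a (sref i x) (sref i y).
Proof. by rewrite /klt !ffunE !permM. Qed.

Lemma rmv_comm i j a : i.+1 < j -> rmv i (rmv j a) = rmv j (rmv i a).
Proof.
move=> /sref_far_comm c; rewrite /rmv /= !mulgA c; congr (_, _).
by apply/ffunP => x; rewrite !ffunE -!permM c.
Qed.

Lemma rmv_braid i j a : j = i.+1 :> nat ->
  rmv i (rmv j (rmv i a)) = rmv j (rmv i (rmv j a)).
Proof.
move=> /sref_near_braid c; rewrite /rmv /= !mulgA c; congr (_, _).
by apply/ffunP => x; rewrite !ffunE -!permM !mulgA c.
Qed.

Lemma klt_asym a x y : klt a x y -> klt a y x = false.
Proof. by rewrite /klt; lia. Qed.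

Lemma klt_trans a y x z : klt a x y -> klt a y z -> klt a x z.
Proof. by rewrite /klt; lia. Qed.

Lemma klt_ntrans a y x z : klt a x z -> klt a x y || klt a y z.
Proof. by rewrite /klt; lia. Qed.

Lemma rop_comm i j a : i.+1 < j -> rop i (rop j a) = rop j (rop i a).
Proof.
move=> ij; have [e1 e2 e3 e4] := sref_far ij.
rewrite /rop; case ci: (klt a (hi i) (lo i)); case cj: (klt a (hi j) (lo j));
  rewrite ?klt_rmv ?e1 ?e2 ?e3 ?e4 ?ci ?cj //.
exact: rmv_comm.
Qed.

(** Both sides sort the three rows by their keys, whatever the initial order. [klt_trans] and
    [klt_ntrans] discard the inconsistent outcomes of the three comparisons. *)
Lemma rop_braid i j a : j = i.+1 :> nat ->
  rop i (rop j (rop i a)) = rop j (rop i (rop j a)).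
Proof.
move=> ij; have [e1 e2 e3] := sref_near ij.
set A := lo i; set B := hi i; set C := hi j.
have s1 : sref i A = B := sref_lo i. have s2 : sref i B = A := sref_hi i.
have s4 : sref j B = C by rewrite /B e1 sref_lo.
have s5 : sref j C = B by rewrite /C sref_hi -e1.
rewrite /rop -e1 -/A -/B -/C.
have t1 := @klt_trans a B C A; have t2 := @klt_ntrans a B C A.
have a1 := @klt_asym a B A; have a2 := @klt_asym a C B; have a3 := @klt_asym a C A.
case p: (klt a B A) t1 t2 a1 a3; case q: (klt a C B) a2 => /=;
  rewrite ?klt_rmv ?s1 ?s2 ?s4 ?s5 ?e2 ?e3 ?p ?q => a2 t1 t2 a1 a3;
  rewrite ?(a2 erefl) ?(a1 erefl) ?p ?q;
  (case r: (klt a C A) t1 t2 a3 => t1 t2 a3;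
   rewrite ?klt_rmv ?s1 ?s2 ?s4 ?s5 ?e2 ?e3 ?p ?q ?r ?(a3 erefl) ?(a1 erefl) ?(a2 erefl) //;
   rewrite ?klt_rmv ?s1 ?s2 ?s4 ?s5 ?e2 ?e3 ?p ?q ?r ?(a3 erefl) ?(a1 erefl) ?(a2 erefl) //).
  exact: rmv_braid.
by have := t1 erefl erefl.
Qed.

Lemma cop_comm i j a : i.+1 < j -> cop i (cop j a) = cop j (cop i a).
Proof. by move=> ij; rewrite /cop !trsK rop_comm. Qed.

Lemma cop_braid i j a : j = i.+1 :> nat ->
  cop i (cop j (cop i a)) = cop j (cop i (cop j a)).
Proof. by move=> ij; rewrite /cop !trsK rop_braid. Qed.

Definition cmv i a : state := (a.1, (a.2 * sref i)%g).
Definition kltc a x y := klt (trs a) x y.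

Lemma copE i a : cop i a = if kltc a (hi i) (lo i) then cmv i a else a.
Proof.
rewrite /cop /rop -/(kltc a _ _); case: ifP => _; last exact: trsK.
case: a => f g; rewrite /trs /cmv /rmv /= invMg invgK tpermV; congr (_, _).
by apply/ffunP => x; rewrite !ffunE !permM tpermK permK.
Qed.

Lemma kltcE a x y : kltc a x y =
  (a.1 ((a.2^-1)%g x) < a.1 ((a.2^-1)%g y)) ||
  (a.1 ((a.2^-1)%g x) == a.1 ((a.2^-1)%g y)) && ((a.2^-1)%g x < (a.2^-1)%g y).
Proof. by rewrite /kltc /klt !ffunE. Qed.

(* Row and column sorting only interact on two points occupying exactly the
   rows i, i+1 and the columns j, j+1 of one string. *)
Lemma rop_cop i j a : rop i (cop j a) = cop j (rop i a).
Proof.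
rewrite !copE /rop.
have mvC : rmv i (cmv j a) = cmv j (rmv i a) by rewrite /rmv /cmv /= mulgA.
set g := a.2; set g' := (a.2^-1)%g.
have gI : injective g by apply: perm_inj.
have g'I : injective g' by apply: perm_inj.
have gK : cancel g g' by move=> x; rewrite /g' permK.
have g'K : cancel g' g by move=> x; rewrite /g permKV.
have E1 : klt (cmv j a) (hi i) (lo i) = (a.1 (hi i) < a.1 (lo i)) ||
    (a.1 (hi i) == a.1 (lo i)) && (sref j (g (hi i)) < sref j (g (lo i))).
  by rewrite /klt /cmv /= !permM.
have E2 : kltc (rmv i a) (hi j) (lo j) = (a.1 (g' (hi j)) < a.1 (g' (lo j))) ||
    (a.1 (g' (hi j)) == a.1 (g' (lo j))) && (sref i (g' (hi j)) < sref i (g' (lo j))).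
  by rewrite kltcE /rmv /= !ffunE invMg tpermV !permM !tpermK.
(* In the exceptional square either neither operation does anything, or both do: then the row
   exchange and the column exchange give the same state, and each removes the descent of the
   other. *)
have [/andP[/eqP fe cr]|ncr] := boolP ((a.1 (hi i) == a.1 (lo i)) &&
   (((g (hi i), g (lo i)) == (lo j, hi j)) || ((g (hi i), g (lo i)) == (hi j, lo j)))).
  have fs x : a.1 (sref i x) = a.1 x by rewrite f_sref.
  have fsE : [ffun x => a.1 (sref i x)] = a.1 by apply/ffunP => x; rewrite ffunE fs.
  case/orP: cr => /eqP[gh gl].
    have gl' : g' (hi j) = lo i by rewrite -gl gK.
    have gh' : g' (lo j) = hi i by rewrite -gh gK.
    have p : klt a (hi i) (lo i).
      by rewrite /klt fe ltnn eqxx /= -/g gh gl hi_val.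
    have q : kltc a (hi j) (lo j).
      by rewrite kltcE -/g' gl' gh' fe ltnn eqxx /= hi_val.
    rewrite p q E1 E2 gl' gh' fe ltnn eqxx /= gh gl !sref_lo !sref_hi.
    rewrite !hi_loF /=.
    rewrite /cmv /rmv fsE; congr (_, _); apply/permP => x; rewrite !permM -/g.
    have [->|xl] := eqVneq x (lo i); first by rewrite sref_lo gh gl sref_hi.
    have [->|xh] := eqVneq x (hi i); first by rewrite sref_hi gh gl sref_lo.
    rewrite (sref_fix xl xh) sref_fix //; first by rewrite -gh (inj_eq gI).
    by rewrite -gl (inj_eq gI).
  have gl' : g' (hi j) = hi i by rewrite -gh gK.
  have gh' : g' (lo j) = lo i by rewrite -gl gK.
  have p : klt a (hi i) (lo i) = false.
    by rewrite /klt fe ltnn eqxx /= -/g gh gl hi_val; lia.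
  have q : kltc a (hi j) (lo j) = false.
    by rewrite kltcE -/g' gl' gh' fe ltnn eqxx /= hi_val; lia.
  by rewrite !(p, q).
have F1 : klt (cmv j a) (hi i) (lo i) = klt a (hi i) (lo i).
  rewrite E1 /klt -/g; case: (a.1 (hi i) =P a.1 (lo i)) ncr => //= _.
  by rewrite negb_or => /andP[n1 n2]; rewrite sref_lt.
have F2 : kltc (rmv i a) (hi j) (lo j) = kltc a (hi j) (lo j).
  rewrite E2 kltcE -/g'; case: (_ =P _) => //= fe'.
  rewrite sref_lt //; apply: contra ncr => /eqP[h l]; rewrite -h -l !g'K ?eqxx ?orbT ?andbT /=.
    by rewrite fe' eqxx.
  by rewrite fe' eqxx.
case p : (klt a _ _); case q : (kltc a _ _); rewrite ?F1 ?F2 ?p ?q //.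
Qed.

Definition dop i a := cop i (rop i a).

Lemma dop_comm i j a : i.+1 < j -> dop i (dop j a) = dop j (dop i a).
Proof. by move=> ij; rewrite /dop !rop_cop rop_comm // cop_comm. Qed.

Lemma dop_braid i j a : j = i.+1 :> nat ->
  dop i (dop j (dop i a)) = dop j (dop i (dop j a)).
Proof. by move=> ij; rewrite /dop !rop_cop rop_braid // cop_braid. Qed.

Definition enc (p : seq (seq 'I_n)) a :=
  (forall x, a.1 x = string_index p x) /\ (forall x, a.2 x = deg_map p x).

Lemma enc_exists mu p : muinv mu p -> exists a, enc p a.
Proof.
move=> pI; have [_ gK _] := encode_good pI.
exists ([ffun x => string_index p x], perm (inv_inj gK)).
by split=> x /=; rewrite ?ffunE ?permE.
Qed.

Lemma enc_inj mu p q a : muinv mu p -> muinv mu q -> enc p a -> enc q a -> p = q.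
Proof.
move=> pI qI [p1 p2] [q1 q2]; apply: (muinv_ext pI qI) => x.
  by rewrite -p1 q1.
by rewrite -p2 q2.
Qed.

(** For an involution the row and the column test agree, so both exchanges take place and conjugate.
    If [g] exchanges i and i+1, the row exchange already sorts the columns, and a single
    multiplication by [s_i] remains, as in [stepg]. *)
Lemma enc_mact mu p a i : muinv mu p -> enc p a -> enc (Defs.mact i p) (dop i a).
Proof.
move=> pI [e1 e2]; have [_ gK fg] := encode_good pI.
have e2' x : (a.2^-1)%g x = deg_map p x.
  by apply: (@perm_inj _ a.2); rewrite permKV e2 gK.
have ka : klt a (hi i) (lo i) = low i p by rewrite /klt !e1 !e2.
rewrite /dop /rop ka; case lw: (low i p); last first.
  rewrite (mact_up pI) ?lw // copE kltcE !e2' !e1 !fg -/(lowfg _ _ i) -/(low i p) lw.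
  by [].
rewrite copE kltcE /rmv /= !ffunE invMg tpermV !permM !tpermK !e2' !e1 !fg.
split=> x.
  rewrite (string_index_mact pI lw) -e1.
  by case: ifP => _; rewrite /= ffunE.
rewrite (deg_map_mact pI lw) /stepg.
move: lw; rewrite /low /lowfg.
have [cr|nc] := boolP (deg_map p (lo i) == hi i).
  have gh : deg_map p (hi i) = lo i by rewrite -(eqP cr) gK.
  rewrite gh (eqP cr) sref_lo sref_hi.
  have fe : string_index p (hi i) = string_index p (lo i) by rewrite -(eqP cr) fg.
  rewrite fe ltnn eqxx /= => _; rewrite hi_loF /= permM e2.
  by have := stepg_cross gK cr (sref i x); rewrite srefK => <-.
have [fe|fne] := eqVneq (string_index p (hi i)) (string_index p (lo i)); last first.
  by rewrite orbF => -> /=; rewrite !permM e2.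
rewrite fe ltnn /= => lt; rewrite sref_lt.
- by rewrite lt /= !permM e2.
- by apply: contraNneq nc => -[_ ->].
by apply: contraTneq lt => -[-> ->]; rewrite hi_loF.
Qed.



Lemma muinv_foldr mu p t : muinv mu p -> muinv mu (foldr (@Defs.mact n) p t).
Proof. by move=> pI; elim: t => //= i t IH; apply: muinv_mact. Qed.

Lemma mact_matsumoto mu p (t u : seq 'I_n.-1) : muinv mu p -> reduced t -> reduced u ->
  (\prod_(i <- t) sref i = \prod_(i <- u) sref i)%g ->
  foldr (@Defs.mact n) p t = foldr (@Defs.mact n) p u.
Proof.
move=> pI rt ru e; have [a pa] := enc_exists pI.
have H v : enc (foldr (@Defs.mact n) p v) (foldr dop a v).
  elim: v => //= i v IH; apply: enc_mact IH; exact: muinv_foldr pI.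
apply: (enc_inj (muinv_foldr t pI) (muinv_foldr u pI) (H t)).
by rewrite (matsumoto dop_comm dop_braid a rt ru e).
Qed.

End Braid.

(** * Lower partners, words along which the length drops, and extremal elements *)

Section Words.

Variable n : nat.
Implicit Types (i j : 'I_n.-1) (x y : 'I_n) (w : 'S_n) (t u : seq 'I_n.-1).
Implicit Types (p q r : seq (seq 'I_n)) (mu : seq nat).

Local Notation mact := (@Defs.mact n).
Local Notation mstar := (@Defs.mstar n).
Local Notation prods t := (\prod_(i <- t) sref i)%g.

Lemma low_mact mu p i : muinv mu p -> ~~ low i (mact i p).
Proof.
move=> pI; case lw: (low i p); last by rewrite (mact_up pI) lw.
rewrite {1}/low /lowfg !(string_index_mact pI lw) !(deg_map_mact pI lw).
rewrite sref_lo sref_hi /stepg.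
have [_ gK fg] := encode_good pI.
move: lw; rewrite /low /lowfg negb_or -leqNgt.
have [cr|nc] := boolP (deg_map p (lo i) == hi i).
  have gh : deg_map p (hi i) = lo i by rewrite -(eqP cr) gK.
  rewrite gh (eqP cr) sref_lo sref_hi hi_loF andbF andbT => _.
  by rewrite -(eqP cr) fg.
rewrite sref_lo sref_hi => /orP[lt|/andP[/eqP -> lt]].
  by rewrite (ltnW lt) eq_sym (ltn_eqF lt).
rewrite leqnn eqxx /= sref_lt.
- by rewrite -leqNgt ltnW.
- by apply: contraTneq lt => -[-> ->]; rewrite -leqNgt hi_val leqnSn.
by apply: contraNneq nc => -[-> _].
Qed.

(** If both elements move by conjugation, or both by multiplication, [s_i] can be cancelled. The
    mixed case is impossible: the image of the element with two-cycle (i, i+1) fixes i and i+1, so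
    the other element fixes them too and is not low. *)
Lemma mact_inj_low mu p q i : muinv mu p -> muinv mu q -> low i p -> low i q ->
  mact i p = mact i q -> p = q.
Proof.
move=> pI qI pl ql e.
have E1 x : string_index p x = string_index q x.
  rewrite -[x](srefK i) -(string_index_mact pI pl) -(string_index_mact qI ql).
  by rewrite e.
have E2 x : stepg (deg_map p) i x = stepg (deg_map q) i x.
  by rewrite -(deg_map_mact pI pl) -(deg_map_mact qI ql) e.
apply: (muinv_ext pI qI) => [|x]; first exact: E1.
have [_ gK fg] := encode_good pI; have [_ hK fh] := encode_good qI.
move: pl ql; rewrite /low /lowfg !E1.
have aux (g h : 'I_n -> 'I_n) : involutive g -> involutive h ->
    stepg g i =1 stepg h i -> g (lo i) == hi i -> (h (lo i) != hi i) ->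
    ~~ (h (hi i) < h (lo i)).
  move=> gK' hK' E cr nc.
  have gh : g (hi i) = lo i by rewrite -(eqP cr) gK'.
  have := E (lo i); have := E (hi i).
  rewrite /stepg cr (negPf nc) gh (eqP cr) !sref_lo !sref_hi.
  move=> /(congr1 (sref i)); rewrite sref_hi srefK => <-.
  move=> /(congr1 (sref i)); rewrite sref_lo srefK => <-.
  by rewrite hi_loF.
have E2' y : stepg (deg_map q) i y = stepg (deg_map p) i y by rewrite E2.
have [cp|ncp] := boolP (deg_map p (lo i) == hi i).
  have fe : string_index q (hi i) = string_index q (lo i).
    by rewrite -(eqP cp) -!E1 fg.
  have [cq|ncq] := boolP (deg_map q (lo i) == hi i).
    move=> _ _; have := E2 x; rewrite /stepg cp cq.
    by move/(congr1 (sref i)); rewrite !srefK.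
  by rewrite fe ltnn eqxx /= => _; rewrite (negPf (aux _ _ gK hK E2 cp ncq)).
have [cq|ncq] := boolP (deg_map q (lo i) == hi i).
  have fe : string_index q (hi i) = string_index q (lo i) by rewrite -(eqP cq) fh.
  by rewrite fe ltnn eqxx /= (negPf (aux _ _ hK gK E2' cq ncp)).
move=> _ _; have := E2 (sref i x); rewrite /stepg (negPf ncp) (negPf ncq).
by move/(congr1 (sref i)); rewrite !srefK.
Qed.

(* The lower partner: conjugate by s_i, or merge two fixed points of the same
   string into a two-cycle. *)
Lemma mact_surj mu r i : muinv mu r -> ~~ low i r ->
  exists q, [/\ muinv mu q, low i q & mact i q = r].
Proof.
move=> rI up; have [fR gK fg] := encode_good rI.
set f := string_index r in fR fg *; set g := deg_map r in gK fg *.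
have gI := inv_inj gK.
pose fix2 := [&& g (lo i) == lo i, g (hi i) == hi i & f (lo i) == f (hi i)].
pose g' x := if fix2 then sref i (g x) else sref i (g (sref i x)).
pose f' x := f (sref i x).
have f's : fix2 -> forall x, f (sref i x) = f x.
  by case/and3P=> _ _ /eqP fe x; apply: f_sref.
have comm : fix2 -> forall x, g (sref i x) = sref i (g x).
  case/and3P=> /eqP gl /eqP gh _ x.
  have [->|xl] := eqVneq x (lo i); first by rewrite sref_lo gl gh sref_lo.
  have [->|xh] := eqVneq x (hi i); first by rewrite sref_hi gl gh sref_hi.
  rewrite (sref_fix xl xh) sref_fix //; first by rewrite -[lo i]gl (inj_eq gI).
  by rewrite -[hi i]gh (inj_eq gI).
have G : good (size mu) f' g'.
  rewrite /f' /g'; case fx: fix2; split=> // x.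
  - by rewrite comm // srefK gK.
  - by rewrite !f's // fg.
  - by rewrite srefK gK srefK.
  by rewrite srefK fg.
pose q := dec (size mu) f' g'.
have qI : muinv mu q by apply: (muinv_dec_perm (w := sref i) rI G).
have lw : low i q.
  rewrite /low /lowfg !(string_index_dec G) !(deg_map_dec G) /f' sref_lo sref_hi.
  move: up; rewrite /low /lowfg -/f -/g negb_or -leqNgt leq_eqVlt => /andP[].
  rewrite eq_sym; case/orP=> [/eqP fe|-> //]; rewrite fe eqxx ltnn /= => ngt.
  rewrite /g'; case fx: fix2.
    by move: fx => /and3P[/eqP -> /eqP -> _]; rewrite sref_lo sref_hi hi_val.
  rewrite sref_lo sref_hi sref_lt.
  - by rewrite ltn_neqAle leqNgt ngt andbT -ord_eqE (inj_eq gI) lo_hi.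
  - by apply: contraFneq fx => -[gl gh]; rewrite /fix2 gl gh fe !eqxx.
  apply: contraNneq ngt => -[-> ->]; by rewrite hi_val.
exists q; split=> //; apply: (muinv_ext (muinv_mact qI i) rI) => x.
  by rewrite (string_index_mact qI lw) (string_index_dec G) /f' srefK.
rewrite (deg_map_mact qI lw) /stepg !(deg_map_dec G) /g'.
case fx: fix2.
  move: (fx) => /and3P[/eqP gl _ _]; rewrite gl sref_lo eqxx srefK.
  by [].
rewrite !srefK sref_lo; case: eqP => // e.
have gh : g (hi i) = lo i by rewrite -[g _](srefK i) e sref_hi.
have gl : g (lo i) = hi i by rewrite -gh gK.
move: up; rewrite /low /lowfg -/f -/g gl gh hi_val ltnSn andbT.
by rewrite -gl fg eqxx orbT.
Qed.

Lemma mem_muinvs mu p : muinv mu p -> p \in muinvs n mu.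
Proof.
move=> pI; rewrite /muinvs mem_filter pI /=.
apply/mapP; exists (flatten p).
  by rewrite mem_permutations; case/and3P: pI.
by case/and3P: pI => /eqP <- _ _; rewrite flattenK.
Qed.

Lemma muinvs_muinv mu p : p \in muinvs n mu -> muinv mu p.
Proof. by rewrite mem_filter => /andP[]. Qed.

Lemma mstar_up mu r i : muinv mu r -> ~~ low i r ->
  [/\ muinv mu (mstar i r), low i (mstar i r) & mact i (mstar i r) = r].
Proof.
move=> rI up; have [q [qI lq qr]] := mact_surj rI up.
have sh : shape r = mu by case/and3P: rI => /eqP.
have low_of (u : seq (seq 'I_n)) : u \in [seq p <- muinvs n (shape r) | (p != r) && (mact i p == r)] ->
    [/\ muinv mu u, low i u & mact i u = r].
  rewrite mem_filter sh => /andP[/andP[ne /eqP e] /muinvs_muinv uI]; split=> //.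
  by apply: contraNT ne => nl; rewrite -e (mact_up uI).
rewrite /Defs.mstar; case E: [seq _ <- _ | _] => [|u s] /=.
  have : q \in [::] by rewrite -E mem_filter sh (mem_muinvs qI) qr eqxx !andbT;
    apply: contraTneq lq => ->.
  by [].
by apply: low_of; rewrite E mem_head.
Qed.

Lemma mstar_mact mu q i : muinv mu q -> low i q -> mstar i (mact i q) = q.
Proof.
move=> qI lq; have [mI lm e] := mstar_up (muinv_mact qI i) (low_mact i qI).
exact: mact_inj_low mI qI lm lq e.
Qed.

Lemma mstar_low mu r i : muinv mu r -> low i r -> mstar i r = r.
Proof.
move=> rI lr; rewrite /Defs.mstar.
have sh : shape r = mu by case/and3P: rI => /eqP.
rewrite (eq_in_filter (a2 := pred0)) ?filter_pred0 // => p.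
rewrite sh => /muinvs_muinv pI; apply/negbTE; rewrite negb_and negbK.
have [->|/eqP ne] := eqVneq p r; first by [].
apply/eqP => e; have := low_mact i pI; by rewrite e lr.
Qed.

Lemma muinv_mstar mu r i : muinv mu r -> muinv mu (mstar i r).
Proof.
move=> rI; have [lr|up] := boolP (low i r); first by rewrite (mstar_low rI).
by case: (mstar_up rI up).
Qed.

Lemma Lmu_mstar mu r i : muinv mu r -> Lmu (mstar i r) = Lmu r + ~~ low i r.
Proof.
move=> rI; have [lr|up] := boolP (low i r); first by rewrite (mstar_low rI lr) addn0.
have [mI lm e] := mstar_up rI up.
by rewrite (Lmu_mact mI lm) e addn1.
Qed.

Lemma Lmu_mact_le mu p i : muinv mu p -> Lmu p <= (Lmu (mact i p)).+1.
Proof.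
move=> pI; have [lw|up] := boolP (low i p); first by rewrite (Lmu_mact pI lw).
by rewrite (mact_up pI up).
Qed.

Lemma Lmu_foldr_le mu p t : muinv mu p -> Lmu p <= Lmu (foldr mact p t) + size t.
Proof.
move=> pI; elim: t => [|i t IH] /=; first by rewrite addn0.
by apply: leq_trans IH _; rewrite addnS -addSn leq_add2r (Lmu_mact_le _ (muinv_foldr t pI)).
Qed.

Lemma strict_cons mu p i t : muinv mu p ->
  Lmu p = Lmu (foldr mact p (i :: t)) + size (i :: t) ->
  Lmu p = Lmu (foldr mact p t) + size t /\ low i (foldr mact p t).
Proof.
move=> pI /= e; have qI := muinv_foldr t pI.
have := Lmu_foldr_le t pI; have := Lmu_mact_le i qI; move: e.
have [lw|up] := boolP (low i (foldr mact p t)).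
  by rewrite (Lmu_mact qI lw); split=> //; lia.
by rewrite (mact_up qI up); lia.
Qed.

(* A word along which the length drops at every step is reduced: otherwise the
   last letter would act on an element it already fixes. *)
Lemma strict_reduced mu p t : muinv mu p ->
  Lmu p = Lmu (foldr mact p t) + size t -> reduced t.
Proof.
move=> pI; elim: t => [_|i t IH]; first by rewrite /reduced big_nil ell1.
move=> /(strict_cons pI)[/IH rt lw].
apply: reduced_up => //; apply: desc_total; apply/negP => ds.
have [u [pu ru]] := reduced_exists (sref i * prods t)%g.
have riu : reduced (i :: u).
  apply: reduced_up => //; rewrite pu !permM sref_lo sref_hi.
  exact: ds.
have e : foldr mact p t = foldr mact p (i :: u).
  apply: (mact_matsumoto pI) => //.
  by rewrite big_cons pu mulgA tperm2 mul1g.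
by move: lw; rewrite e /= (negPf (low_mact i (muinv_foldr u pI))).
Qed.

Lemma act_word mu p t : muinv mu p -> Lmu p = Lmu (foldr mact p t) + size t ->
  Defs.act (prods t) p = foldr mact p t /\ ell (prods t) = size t.
Proof.
move=> pI e; have rt := strict_reduced pI e.
split; last by rewrite -(eqP rt).
apply: (mact_matsumoto pI) => //; first exact: reduced_redword.
by case: (redwordP (prods t)).
Qed.

Lemma shape_muinv mu p : muinv mu p -> shape p = mu.
Proof. by case/and3P=> /eqP. Qed.

(** A finite bound on the length, the measure for inductions that pass to lower partners. *)
Definition Lbound mu := \max_(p <- muinvs n mu) Lmu p.

Lemma Lmu_bound mu p : muinv mu p -> Lmu p <= Lbound mu.
Proof. by move/mem_muinvs => pI; apply: leq_bigmax_seq. Qed.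

Lemma climb mu p : muinv mu p -> exists q t,
  [/\ muinv mu q, forall i, ~~ low i q, foldr mact p t = q & Lmu p = Lmu q + size t].
Proof.
have [m] := ubnP (Lmu p); elim: m p => // m IH p pm pI.
have [/existsP[i lw]|no] := boolP [exists i, low i p]; last first.
  exists p, [::]; split=> //= [i|]; last by rewrite addn0.
  by move: no; rewrite negb_exists => /forallP.
have [|q [t [qI up e L]]] := IH (mact i p) _ (muinv_mact pI i).
  by rewrite (Lmu_mact pI lw) in pm.
exists q, (rcons t i); split=> //; first by rewrite foldr_rcons.
by rewrite (Lmu_mact pI lw) L size_rcons addnS.
Qed.

Lemma descend mu p : muinv mu p -> exists q t,
  [/\ muinv mu q, forall i, low i q, foldr mact q t = p & Lmu q = Lmu p + size t].
Proof.
have [m] := ubnP (Lbound mu - Lmu p); elim: m p => // m IH p pm pI.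
have [/existsP[i up]|no] := boolP [exists i, ~~ low i p]; last first.
  exists p, [::]; split=> //= [i|]; last by rewrite addn0.
  by move: no; rewrite negb_exists => /forallP/(_ i); rewrite negbK.
have [sI ls e] := mstar_up pI up.
have LE : Lmu (mstar i p) = (Lmu p).+1 by rewrite (Lmu_mstar i pI) up addn1.
have [|q [t [qI lw et L]]] := IH (mstar i p) _ sI.
  by have := Lmu_bound sI; move: pm; rewrite LE; lia.
exists q, (i :: t); split=> //=; first by rewrite et.
by rewrite L LE addnS addSn.
Qed.

Lemma pairwise_strings (lt : rel 'I_n) mu p : muinv mu p ->
  (forall x y, string_index p x < string_index p y -> lt x y) ->
  (forall x y, string_index p x = string_index p y -> x < y ->
     lt (deg_map p x) (deg_map p y)) ->
  pairwise lt (flatten p).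
Proof.
move=> pI H1 H2; have [fR gK fg] := encode_good pI.
rewrite (encodeK pI) /dec; elim: (size mu) => // R IH.
rewrite /mkseq -[R.+1]addn1 iotaD map_cat flatten_cat pairwise_cat -/(mkseq _ R) IH /=.
rewrite cats0; apply/andP; split.
  apply/allrelP => x y /flattenP[s /mapP[j]]; rewrite mem_iota add0n => /andP[_ jR] ->.
  move=> /mapP[x' + ->] /mapP[y' + ->]; rewrite !mem_letters => /eqP fx /eqP fy.
  by apply: H1; rewrite !fg fx fy.
rewrite pairwise_map.
have tr : transitive (fun x y : 'I_n => x < y) by move=> b a c; apply: ltn_trans.
have := letters_sorted (string_index p) R; rewrite (sorted_pairwise tr).
apply: sub_in_pairwise (allss _) => x y.
by rewrite !mem_letters => /eqP fx /eqP fy; apply: H2; rewrite fx fy.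
Qed.

(** The lexicographic key as one number, so that [adjacent_lt] turns a condition at all i into
    monotonicity. *)
Let key p x := string_index p x * n + deg_map p x.

Let key_lt p x y : key p x < key p y <->
  (string_index p x < string_index p y) ||
  (string_index p x == string_index p y) && (deg_map p x < deg_map p y).
Proof.
rewrite /key; have := ltn_ord (deg_map p x); have := ltn_ord (deg_map p y).
move: (string_index p x) (string_index p y) => a b.
case: (ltngtP a b) => [ab|ab|->] /= H1 H2.
- split=> // _; have : a.+1 * n <= b * n by rewrite leq_mul2r ab orbT.
  by rewrite mulSn; lia.
- split=> // H; have : b.+1 * n <= a * n by rewrite leq_mul2r ab orbT.
  by rewrite mulSn; lia.
by rewrite ltn_add2l.
Qed.

Lemma string_index_mono p : (forall i, ~~ low i p) -> (forall mu, muinv mu p ->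
  (forall x y, x < y -> string_index p x <= string_index p y) /\
  (forall x y, string_index p x = string_index p y -> x < y -> deg_map p x < deg_map p y)).
Proof.
move=> up mu pI; have [fR gK fg] := encode_good pI.
have inc x y : x < y -> key p x < key p y.
  apply: adjacent_lt => i; apply/key_lt; have := up i; rewrite /low /lowfg.
  rewrite negb_or -leqNgt leq_eqVlt => /andP[/orP[/eqP ->|->] //].
  rewrite eqxx ltnn /= -leqNgt leq_eqVlt => /orP[/eqP/val_inj/(inv_inj gK)/eqP|//].
  by rewrite (negPf (lo_hi i)).
split=> x y; first by move/inc/key_lt => /orP[/ltnW|/andP[/eqP ->]].
by move=> e /inc/key_lt; rewrite e ltnn eqxx.
Qed.

Lemma all_up_max mu p : muinv mu p -> (forall i, ~~ low i p) -> p = mumax n mu.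
Proof.
move=> pI up; have [H1 H2] := string_index_mono up pI.
have e : flatten p = enum 'I_n.
  apply: (@irr_sorted_eq _ (fun x y : 'I_n => x < y)) => //.
  - by move=> b a c; apply: ltn_trans.
  - by move=> x; apply: ltnn.
  - apply: pairwise_sorted; apply: (pairwise_strings pI) => // x y; apply: contraTltn.
    rewrite leq_eqVlt => /orP[/eqP/val_inj ->|/H1]; first by rewrite ltnn.
    by rewrite -leqNgt.
  - rewrite -letters0; exact: letters_sorted.
  by apply: perm_mem; case/and3P: pI.
by rewrite /mumax -e -(shape_muinv pI) flattenK.
Qed.

Lemma all_low_min mu p : muinv mu p -> (forall i, low i p) -> p = mumin n mu.
Proof.
move=> pI lw; have [fR gK fg] := encode_good pI.
(* [adjacent_lt] speaks of increasing functions, hence the subtraction from an upper bound of the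
   keys. *)
have dec_key x y : x < y -> key p y < key p x.
  have [m Hm] : exists m, forall x, key p x < m.
    exists (\max_x key p x).+1 => z; rewrite ltnS; exact: (leq_bigmax z).
  move=> xy; have := @adjacent_lt _ (fun x => m - key p x) _ x y xy.
  suff H : forall i, m - key p (lo i) < m - key p (hi i) by move/(_ H); lia.
  move=> i; have : key p (hi i) < key p (lo i) by apply/key_lt; apply: lw.
  by have := Hm (lo i); lia.
have e : flatten p = rev (enum 'I_n).
  apply: (@irr_sorted_eq _ (fun x y : 'I_n => y < x)) => //.
  - by move=> b a c ab ca; apply: ltn_trans ca ab.
  - by move=> x; apply: ltnn.
  - apply: pairwise_sorted; apply: (pairwise_strings pI) => x y.
      apply: contraTltn; rewrite leq_eqVlt => /orP[/eqP/val_inj ->|/dec_key/key_lt].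
        by rewrite ltnn.
      by rewrite -leqNgt => /orP[/ltnW|/andP[/eqP ->]].
    by move=> fe /dec_key/key_lt; rewrite fe ltnn eqxx.
  - rewrite rev_sorted -letters0; exact: letters_sorted.
  move=> x; rewrite mem_rev; apply: perm_mem; by case/and3P: pI.
by rewrite /mumin -e -(shape_muinv pI) flattenK.
Qed.

End Words.

(** * Compositions *)

Section Compositions.

Variable n : nat.
Implicit Types (mu nu : seq nat) (x y : 'I_n).

Local Notation psums mu := (scanl addn 0 mu).
Local Notation fmax mu := (string_index (mumax n mu)).

Lemma muinv_mumax mu : is_comp n mu -> muinv mu (mumax n mu).
Proof.
case/andP=> _ /eqP sn; have sz : size (enum 'I_n) = sumn mu by rewrite size_enum_ord.
rewrite /muinv /mumax reshapeKl ?sz // eqxx reshapeKr ?sz // perm_refl /=.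
have so : pairwise (fun x y : 'I_n => x < y) (flatten (reshape mu (enum 'I_n))).
  rewrite reshapeKr ?sz //.
  have tr : transitive (fun x y : 'I_n => x < y) by move=> b a c; apply: ltn_trans.
  by rewrite -(sorted_pairwise tr) -letters0 letters_sorted.
elim: (reshape _ _) so => //= s p IH; rewrite pairwise_cat => /and3P[_ ps /IH ->].
rewrite andbT; have al : alphabet s = s.
  by apply: alphabet_eq (pairwise_sorted ps) (perm_refl s).
have sm x : x \in s -> strmap s x = x by move=> xs; rewrite /strmap al nth_index.
by apply/allP => x xs; rewrite !sm.
Qed.

Lemma deg_map_mumax mu : is_comp n mu -> deg_map (mumax n mu) =1 id.
Proof.
move=> mc x; have mI := muinv_mumax mc.
have [fR gK fg] := encode_good mI; have [_ /eqP sn] := andP mc.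
have sz : size (enum 'I_n) = sumn mu by rewrite size_enum_ord.
have so : pairwise (fun x y : 'I_n => x < y) (flatten (mumax n mu)).
  rewrite reshapeKr ?sz //.
  have tr : transitive (fun x y : 'I_n => x < y) by move=> b a c; apply: ltn_trans.
  by rewrite -(sorted_pairwise tr) -letters0 letters_sorted.
have al : forall s, s \in mumax n mu -> alphabet s = s.
  elim: (mumax n mu) so => //= s p IH; rewrite pairwise_cat => /and3P[_ ps /IH H] t.
  by rewrite inE => /orP[/eqP ->|/H //]; apply: alphabet_eq (pairwise_sorted ps) (perm_refl s).
rewrite /deg_map /strmap al ?nth_index ?(mem_string_index mI) //.
by rewrite mem_nth // (string_index_lt mI).
Qed.

(** A letter lies in the first string whose partial sum exceeds its position. The offset [m] is the
    total length of the strings already cut off. *)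
Lemma find_reshape (s : seq 'I_n) mu m x : uniq s -> x \in s ->
  find (fun t : seq 'I_n => x \in t) (reshape mu s) =
  find (fun c => m + index x s < c) (scanl addn m mu).
Proof.
elim: mu s m => //= a mu IH s m us xs.
rewrite in_take // ltn_add2l; case: ltnP => // ax; congr _.+1.
have as_ : a <= size s by apply: leq_trans ax _; rewrite ltnW // index_mem.
have xt : x \notin take a s by rewrite in_take // -leqNgt.
have xd : x \in drop a s.
  by move: xs; rewrite -{1}(cat_take_drop a s) mem_cat (negPf xt).
rewrite (IH (drop a s) (m + a)) ?drop_uniq //.
rewrite -{2}(cat_take_drop a s) index_cat (negPf xt) size_takel // addnA.
by [].
Qed.

Lemma fmaxE mu x : fmax mu x = find (fun c => x < c) (psums mu).
Proof.
rewrite /string_index /mumax (find_reshape mu 0) ?enum_uniq ?mem_enum //.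
by rewrite add0n index_enum_ord.
Qed.

Lemma psums_path mu m : path leq m (scanl addn m mu).
Proof. by elim: mu m => //= a mu IH m; rewrite leq_addr IH. Qed.

Lemma fmax_lt mu x y : is_comp n mu ->
  (fmax mu x < fmax mu y) <-> exists2 c, c \in psums mu & x < c <= y.
Proof.
move=> mc; rewrite !fmaxE; split=> [lt|[c cp /andP[xc cy]]].
  have sx : find (fun c => x < c) (psums mu) < size (psums mu).
    by apply: leq_trans lt (find_size _ _).
  exists (nth 0 (psums mu) (find (fun c => x < c) (psums mu))); first exact: mem_nth.
  rewrite -has_find in sx; rewrite (nth_find 0 sx) /=.
  by have /negbT := before_find 0 lt; rewrite -leqNgt.
have so : sorted leq (psums mu) by apply: path_sorted (psums_path mu 0).
have ic : index c (psums mu) < size (psums mu) by rewrite index_mem.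
have fx : find (fun c => x < c) (psums mu) <= index c (psums mu).
  rewrite leqNgt; apply/negP => lt; have := before_find 0 lt.
  by rewrite nth_index // xc.
apply: leq_ltn_trans fx _; rewrite ltnNge; apply/negP => le.
have hy : find (fun c => y < c) (psums mu) < size (psums mu) by apply: leq_ltn_trans le ic.
have hh : has (fun c => y < c) (psums mu) by rewrite has_find.
have := nth_find 0 hh; apply/negP; rewrite -leqNgt; apply: leq_trans cy.
rewrite -(nth_index 0 cp).
by apply: (sorted_leq_nth leq_trans leqnn 0 so).
Qed.

Lemma mem_compI mu c : is_comp n mu ->
  (c \in compI mu) = (c \notin psums mu) && (0 < c < n).
Proof.
case/andP=> _ /eqP sn; rewrite mem_filter sn mem_iota; congr (_ && _).
by case: n => [|m]; lia.
Qed.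

Lemma refines_fmax mu nu : is_comp n mu -> is_comp n nu -> refines mu nu ->
  forall x y, fmax nu x < fmax nu y -> fmax mu x < fmax mu y.
Proof.
move=> mc nc ref x y /(fmax_lt _ _ nc)[c cn /andP[xc cy]].
apply/(fmax_lt _ _ mc); exists c; last by rewrite xc.
apply: contraTT cn => cm; have := ref c; rewrite !mem_compI // cm.
have -> : 0 < c < n by have := ltn_ord y; lia.
by move=> /(_ isT) /andP[].
Qed.

Lemma fmax_refines mu nu : is_comp n mu -> is_comp n nu ->
  (forall x y, y = x.+1 :> nat -> fmax nu x < fmax nu y -> fmax mu x < fmax mu y) ->
  refines mu nu.
Proof.
move=> mc nc H c; rewrite !mem_compI // => /andP[cm cb]; rewrite cb andbT.
apply: contra cm => cn.
have yn : c < n by lia. have xn : c.-1 < n by lia.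
have : fmax nu (Ordinal xn) < fmax nu (Ordinal yn).
  by apply/(fmax_lt _ _ nc); exists c => //=; lia.
have e : Ordinal yn = (Ordinal xn).+1 :> nat by rewrite /=; lia.
move/(H _ _ e)/(fmax_lt _ _ mc) => [c' cm' /= lt].
by have -> : c = c' by lia.
Qed.

Lemma scanl_inj mu nu m : scanl addn m mu = scanl addn m nu -> mu = nu.
Proof.
elim: mu nu m => [|a mu IH] [|b nu] m //= [/addnI -> /IH ->].
by [].
Qed.

(** A composition is determined by its partial sums. I(mu) records which of 1, ..., n-1 are not
    among them, and n, which I(mu) does not see, is a partial sum of every composition of n > 0. *)
Lemma refines_anti mu nu : is_comp n mu -> is_comp n nu ->
  refines mu nu -> refines nu mu -> mu = nu.
Proof.
move=> mc nc r1 r2; apply: (@scanl_inj _ _ 0).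
have so la m : all (fun a => 0 < a) la -> path ltn m (scanl addn m la).
  elim: la m => //= a la IH m /andP[a0 /IH ->]; rewrite andbT; lia.
have le la m : all (leq^~ (m + sumn la)) (scanl addn m la).
  elim: la m => //= a la IH m; rewrite addnA IH andbT; lia.
have ge la : is_comp n la -> all (fun c => 0 < c <= n) (psums la).
  move=> /andP[p0 /eqP sn]; apply/allP => c cl.
  have /allP/(_ c cl) := order_path_min ltn_trans (so la 0 p0).
  by have /allP/(_ c cl) := le la 0; rewrite add0n sn /= => -> ->.
have top la : is_comp n la -> 0 < n -> n \in psums la.
  move=> /andP[p0 /eqP sn] n0.
  have lst m : last m (scanl addn m la) = m + sumn la.
    by elim: (la) m => [|a la' IH] m /=; rewrite ?addn0 // IH addnA.
  have := lst 0; rewrite add0n sn => <-.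
  case: (la) sn => [|a la' _] /=; first by move=> e; rewrite -e in n0.
  exact: mem_last.
apply: (irr_sorted_eq ltn_trans ltnn).
- by apply: path_sorted (so mu 0 _); case/andP: mc.
- by apply: path_sorted (so nu 0 _); case/andP: nc.
have sub la lb : is_comp n la -> is_comp n lb -> refines la lb ->
    {subset psums lb <= psums la}.
  move=> lac lbc ref c cb.
  have /allP/(_ c cb)/andP[c0] := ge _ lbc.
  rewrite leq_eqVlt => /orP[/eqP cE|cn]; first by rewrite cE top // -cE.
  apply: contraTT cb => ca; have := ref c; rewrite !mem_compI // ca c0 cn.
  by move=> /(_ isT) /andP[].
by move=> c; apply/idP/idP; apply: sub.
Qed.

End Compositions.

(** * The covering relation from the formal properties of the Bruhat order *)

Section Order.

Variable n : nat.
Implicit Types (i j : 'I_n.-1) (w : 'S_n) (t u : seq 'I_n.-1).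
Implicit Types (p q r : seq (seq 'I_n)) (mu nu la : seq nat).

Local Notation mact := (@Defs.mact n).
Local Notation mstar := (@Defs.mstar n).
Local Notation prods t := (\prod_(i <- t) sref i)%g.
Local Notation Lm mu := (Lmu (mumax n mu)).

Definition dinv mu p : Prop := is_comp n mu /\ muinv mu p.

(* Everything about the Bruhat order that the covering theorem depends on. *)
Record bruhat_axioms (le : seq (seq 'I_n) -> seq (seq 'I_n) -> Prop) : Prop :=
  BruhatAxioms {
  ba_trans : forall q p r, le p q -> le q r -> le p r;
  ba_up : forall mu p i, dinv mu p -> le p (mact i p);
  ba_mono : forall mu nu p r i, dinv mu p -> dinv nu r -> le p r ->
    le (mact i p) (mact i r);
  ba_lift : forall mu nu p r i, dinv mu p -> dinv nu r -> low i p ->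
    le p (mact i r) -> le p r;
  ba_max : forall mu nu r, is_comp n mu -> dinv nu r -> le (mumax n mu) r ->
    refines mu nu /\ r = mumax n nu;
  ba_deg : forall mu nu, is_comp n mu -> is_comp n nu -> refines mu nu ->
    le (mumax n mu) (mumax n nu);
  ba_mumax : forall mu, is_comp n mu -> muinv mu (mumax n mu);
  ba_anti : forall mu nu, is_comp n mu -> is_comp n nu ->
    refines mu nu -> refines nu mu -> mu = nu }.

Variable le : seq (seq 'I_n) -> seq (seq 'I_n) -> Prop.
Hypothesis ax : bruhat_axioms le.

Lemma dinv_mact mu p i : dinv mu p -> dinv mu (mact i p).
Proof. by case=> c pI; split=> //; apply: muinv_mact. Qed.

Lemma dinv_mstar mu p i : dinv mu p -> dinv mu (mstar i p).
Proof. by case=> c pI; split=> //; apply: muinv_mstar. Qed.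

Lemma dinv_foldr mu p t : dinv mu p -> dinv mu (foldr mact p t).
Proof. by case=> c pI; split=> //; apply: muinv_foldr. Qed.

Lemma dinv_shape mu nu p : dinv mu p -> dinv nu p -> mu = nu.
Proof. by move=> [_ /shape_muinv <-] [_ /shape_muinv <-]. Qed.

Lemma le_foldr mu nu p r t : dinv mu p -> dinv nu r -> le p r ->
  le (foldr mact p t) (foldr mact r t).
Proof.
move=> pD rD pr; elim: t => //= i t IH.
by apply: (ba_mono ax) IH; apply: dinv_foldr; eassumption.
Qed.

(** Reflexivity is not among the axioms, so equality is kept as a separate case. *)
Lemma le_foldr_up mu p t : dinv mu p -> p = foldr mact p t \/ le p (foldr mact p t).
Proof.
move=> pD; elim: t => [|i t [IH|IH]] /=; [by left| |].
  by rewrite -IH; right; apply: (ba_up ax) pD.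
right; apply: (ba_trans ax) IH _; apply: (ba_up ax (mu := mu)).
exact: dinv_foldr.
Qed.

Lemma climb_max mu p : dinv mu p -> exists t,
  foldr mact p t = mumax n mu /\ Lmu p = Lm mu + size t.
Proof.
move=> [_ pI]; have [q [t [qI up e L]]] := climb pI.
by exists t; rewrite -(all_up_max qI up).
Qed.

(** The number [Lmu p - Lm mu] is the length of a word carrying [p] to its maximum. The same word
    carries [r] to its own maximum, and a word lowers [Lmu] by at most its length. *)
Lemma le_shape mu nu p r : dinv mu p -> dinv nu r -> le p r ->
  refines mu nu /\ Lmu r + Lm mu <= Lmu p + Lm nu.
Proof.
move=> pD rD pr; have [t [e L]] := climb_max pD.
have := le_foldr t pD rD pr; rewrite e => H.
have [ref er] := ba_max ax (proj1 pD) (dinv_foldr t rD) H.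
by split=> //; have := Lmu_foldr_le t (proj2 rD); rewrite er L; lia.
Qed.

Lemma max_or_low mu p : dinv mu p -> p = mumax n mu \/ exists i, low i p.
Proof.
move=> [_ pI]; have [/existsP|no] := boolP [exists i, low i p]; first by right.
left; apply: (all_up_max pI) => i.
by move: no; rewrite negb_exists => /forallP.
Qed.

(** Raise both elements by a descent i of [p]. If i were not a descent of [r], the raised pair would
    violate [le_shape]; so both are low, the raised elements agree by induction, and [s_i] is
    injective on low elements. *)
Lemma le_eq mu p r : dinv mu p -> dinv mu r -> le p r -> Lmu p = Lmu r -> p = r.
Proof.
have [m] := ubnP (Lmu p); elim: m p r => // m IH p r pm pD rD pr L.
have [pE|[i lp]] := max_or_low pD.
  by rewrite pE in pr *; have [_ ->] := ba_max ax (proj1 pD) rD pr.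
have Lp := Lmu_mact (proj2 pD) lp.
have pr' := ba_mono ax i pD rD pr.
have [_ Lle] := le_shape (dinv_mact i pD) (dinv_mact i rD) pr'.
have [lr|ur] := boolP (low i r); last first.
  by move: Lle; rewrite (mact_up (proj2 rD) ur); lia.
have Lr := Lmu_mact (proj2 rD) lr.
apply: (mact_inj_low (proj2 pD) (proj2 rD) lp lr).
apply: IH pr' _; [lia|exact: dinv_mact|exact: dinv_mact|lia].
Qed.

Lemma W_word mu p w : dinv mu p -> (w \in W p) =
  (foldr mact p (redword w) == mumax n mu) && (ell w + Lm mu == Lmu p).
Proof. by move=> [_ pI]; rewrite inE (shape_muinv pI). Qed.

Lemma W_nonempty mu p : dinv mu p -> exists w, w \in W p.
Proof.
move=> pD; have [t [e L]] := climb_max pD; have pI := proj2 pD.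
have [|e1 e2] := act_word (t := t) pI; first by rewrite e L.
exists (prods t); rewrite inE (shape_muinv pI) e1 e e2 L eqxx /=.
by rewrite addnC.
Qed.

Lemma le_W mu nu p r : dinv mu p -> dinv nu r -> le p r ->
  Lmu p + Lm nu = Lmu r + Lm mu -> W p \subset W r.
Proof.
move=> pD rD pr L; apply/subsetP => w.
rewrite (W_word _ pD) (W_word _ rD) => /andP[/eqP e /eqP lw].
have := le_foldr (redword w) pD rD pr; rewrite e => H.
have [_ ->] := ba_max ax (proj1 pD) (dinv_foldr _ rD) H.
by rewrite eqxx /=; apply/eqP; lia.
Qed.

(** Letters are peeled off one at a time: as the length of the left member drops at every letter, it
    is low there, and [ba_lift] cancels the letter on the right. *)
Lemma le_unwind mu nu p r t : dinv mu p -> dinv nu r ->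
  Lmu p = Lmu (foldr mact p t) + size t ->
  le (foldr mact p t) (foldr mact r t) -> le p r.
Proof.
move=> pD rD; elim: t => [|i t IH] //; move/(strict_cons (proj2 pD)) => [st lw] /= H.
apply: IH st _.
apply: (ba_lift ax (dinv_foldr t pD) (dinv_foldr t rD) lw).
by apply: (ba_trans ax) H; apply: (ba_up ax); apply: dinv_foldr pD.
Qed.

Lemma W_le mu nu p r : dinv mu p -> dinv nu r -> refines mu nu ->
  W p \subset W r -> le p r /\ Lmu p + Lm nu = Lmu r + Lm mu.
Proof.
move=> pD rD ref sub; have [w wp] := W_nonempty pD.
have := subsetP sub w wp; move: wp; rewrite (W_word _ pD) (W_word _ rD).
move=> /andP[/eqP e1 /eqP l1] /andP[/eqP e2 /eqP l2]; split; last by lia.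
apply: (le_unwind (t := redword w) pD rD).
  by rewrite e1 (redwordP w).2 -l1 addnC.
by rewrite e1 e2; apply: (ba_deg ax) ref; [case: pD|case: rD].
Qed.

Lemma le_neq_up mu p i : dinv mu p -> low i p -> mact i p <> p.
Proof. by move=> [_ pI] lw e; have := Lmu_mact pI lw; rewrite e; lia. Qed.

(** The first alternative exhibits an element strictly between, so a cover falls under the other
    two. If [p] is low at i and [r] is not, then [s_i . p] lies between them or equals [r]. If both
    are low, the alternative found for the raised pair is pulled back. *)
Lemma cover_cases mu nu p r : dinv mu p -> dinv nu r -> le p r -> p <> r ->
  [\/ exists la z, [/\ dinv la z, le p z, le z r, z <> p & z <> r],
      nu = mu /\ Lmu p = (Lmu r).+1 |
      covers (fun la => is_comp n la) refines mu nu /\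
      Lmu p + Lm nu = Lmu r + Lm mu].
Proof.
have [m] := ubnP (Lmu p); elim: m p r => // m IH p r pm pD rD pr pNr.
have [pE|[i lp]] := max_or_low pD.
  have muC := proj1 pD; have nuC := proj1 rD.
  rewrite pE in pr; have [ref rE] := ba_max ax muC rD pr.
  have mnN : mu <> nu by move=> e; apply: pNr; rewrite pE rE e.
  have [cov|ncov] := classic (covers (fun la => is_comp n la) refines mu nu).
    by constructor 3; split=> //; rewrite pE rE addnC.
  have [la [laC [r1 [r2 [n1 n2]]]]] : exists la, is_comp n la /\ refines mu la /\
      refines la nu /\ la <> mu /\ la <> nu.
    apply: NNPP => no; apply: ncov; split=> // la laC r1 r2.
    apply: NNPP => /not_or_and[n1 n2]; apply: no; by exists la.
  have laI := ba_mumax ax laC.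
  constructor 1; exists la, (mumax n la); split=> //.
  - by rewrite pE; apply: (ba_deg ax).
  - by rewrite rE; apply: (ba_deg ax).
  - by rewrite pE => e; apply: n1; apply: dinv_shape (_ : dinv _ (mumax n mu)); rewrite -?pE // pE -e; split.
  - by rewrite rE => e; apply: n2; apply: dinv_shape (_ : dinv _ (mumax n nu)); rewrite -?rE // rE -e; split.
have p'D := dinv_mact i pD; have Lp := Lmu_mact (proj2 pD) lp.
have pp' := ba_up ax i pD; have p'N := le_neq_up pD lp.
have [lr|ur] := boolP (low i r); last first.
  have := ba_mono ax i pD rD pr; rewrite (mact_up (proj2 rD) ur) => p'r.
  have [e|ne] := classic (mact i p = r).
    constructor 2; rewrite Lp e; split=> //.
    by apply: (dinv_shape rD); rewrite -e.
  by constructor 1; exists mu, (mact i p).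
have r'D := dinv_mact i rD; have Lr := Lmu_mact (proj2 rD) lr.
have p'r' := ba_mono ax i pD rD pr.
have ne' : mact i p <> mact i r.
  move=> e; apply: pNr; have nm : nu = mu.
    by apply: (dinv_shape (p := mact i r)) => //; rewrite -e.
  rewrite nm in rD; exact: (mact_inj_low (proj2 pD) (proj2 rD) lp lr e).
have [|[la [z [zD p'z zr' zN zN']]]|[nm L]|[cov L]] := IH _ _ _ p'D r'D p'r' ne'.
- by rewrite -ltnS -Lp.
(* If z is low, lifting gives z <= r and z itself serves, unless z = r; in that case [s_i . p] lies
   strictly between p and r. *)
- constructor 1; have [lz|uz] := boolP (low i z).
    have zr := ba_lift ax zD rD lz zr'.
    have [e|ne] := classic (z = r).
      exists mu, (mact i p); split=> //; first by rewrite -e.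
      by rewrite -e => /esym.
    exists la, z; split=> //; first exact: (ba_trans ax) pp' p'z.
    move=> e; have lam : la = mu by apply: (dinv_shape zD); rewrite e.
    rewrite e in p'z; have [_] := le_shape p'D pD p'z; lia.
  (* If z is not low, its lower partner serves: lifting compares it with p and with r. *)
  have [sI ls es] := mstar_up (proj2 zD) uz.
  have sD : dinv la (mstar i z) by apply: dinv_mstar.
  have sz : le (mstar i z) z by rewrite -{2}es; apply: (ba_up ax i sD).
  exists la, (mstar i z); split=> //.
  - apply: (ba_lift ax pD sD lp); rewrite es; exact: (ba_trans ax) pp' p'z.
  - apply: (ba_lift ax sD rD ls); exact: (ba_trans ax) sz zr'.
  - by move=> e; apply: zN; rewrite -es e.
  - by move=> e; apply: zN'; rewrite -es e.
- by constructor 2; split=> //; rewrite Lp L Lr.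
by constructor 3; split=> //; rewrite Lp Lr !addSn L.
Qed.

Lemma foldr_mstar_strict mu p u : dinv mu p ->
  Lmu (foldr mstar p u) <= Lmu p + size u.
Proof.
move=> pD; have pI := proj2 pD.
elim: u => [|i u IH] /=; first by rewrite addn0.
have uI : muinv mu (foldr mstar p u) by elim: (u) => //= j u' IH'; apply: muinv_mstar.
by rewrite (Lmu_mstar i uI) addnS -addn1 leq_add // leq_b1.
Qed.

Lemma dinv_foldr_mstar mu p u : dinv mu p -> dinv mu (foldr mstar p u).
Proof. by move=> pD; elim: u => //= i u IH; apply: dinv_mstar. Qed.

Lemma mstar_strict_cons mu p i u : dinv mu p ->
  Lmu (foldr mstar p (i :: u)) = Lmu p + size (i :: u) ->
  Lmu (foldr mstar p u) = Lmu p + size u /\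
  mact i (foldr mstar p (i :: u)) = foldr mstar p u.
Proof.
move=> pD /= e; have := foldr_mstar_strict u pD; have qD := dinv_foldr_mstar u pD.
move: e; rewrite (Lmu_mstar i (proj2 qD)).
have [lw|up] := boolP (low i (foldr mstar p u)); first by lia.
have [_ _ em] := mstar_up (proj2 qD) up; move=> H1 H2; split=> //; lia.
Qed.

Lemma le_star mu p r u : dinv mu p -> dinv mu r ->
  Lmu (foldr mstar p u) = Lmu p + size u -> Lmu (foldr mstar r u) = Lmu r + size u ->
  le (foldr mstar p u) (foldr mstar r u) -> le p r.
Proof.
move=> pD rD; elim: u => [|i u IH] //.
move=> /(mstar_strict_cons pD)[sp ep] /(mstar_strict_cons rD)[sr er] H.
apply: IH => //; rewrite -ep -er.
by apply: (ba_mono ax i _ _ H); apply: dinv_foldr_mstar; eassumption.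
Qed.

(** Each letter lowers the length, so it acts at a low element and the opposite action undoes it.
    The last letter to act is undone first, hence the reversed word. *)
Lemma foldr_mstar_mact mu x p u : dinv mu x ->
  foldr mact x (rev u) = p -> Lmu x = Lmu p + size u -> foldr mstar p u = x.
Proof.
move=> xD; elim: u x xD => [|i u IH] x xD; first by rewrite /rev.
rewrite rev_cons foldr_rcons /= => e L.
have le1 := Lmu_foldr_le (rev u) (proj2 (dinv_mact i xD)).
rewrite e size_rev in le1.
have lw : low i x.
  apply: contraT => up; rewrite (mact_up (proj2 xD) up) in le1.
  by move: le1; rewrite L; lia.
have Lx := Lmu_mact (proj2 xD) lw.
rewrite (IH (mact i x) (dinv_mact i xD) e); last by lia.
by rewrite (mstar_mact (proj2 xD) lw).
Qed.

Lemma prods_rev t : prods (rev t) = (prods t)^-1%g.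
Proof.
elim: t => [|i t IH]; first by rewrite !big_nil invg1.
by rewrite rev_cons -cats1 big_cat big_seq1 IH big_cons invMg tpermV.
Qed.

Lemma ell_inv w : ell w^-1 = ell w.
Proof.
have H (v : 'S_n) : ell v^-1 <= ell v.
  have [pv sv] := redwordP v.
  have := prods_rev (redword v); rewrite pv => <-.
  by rewrite -sv -size_rev; apply: ell_prods_le.
by apply/eqP; rewrite eqn_leq H -{1}(invgK w) H.
Qed.

(** Both elements are replaced by their lower partners at a common ascent as long as there is one.
    At the end any ascent i of [r] is a descent of [p]; then [s_i . p <= r] with equal lengths, so
    they are equal by [le_eq]. *)
Lemma cover_descend mu p r : dinv mu p -> dinv mu r -> le p r -> Lmu p = (Lmu r).+1 ->
  exists x y t i, [/\ dinv mu x /\ dinv mu y, foldr mact x t = p, foldr mact y t = r,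
    Lmu x = Lmu p + size t /\ Lmu y = Lmu r + size t & low i x /\ mact i x = y].
Proof.
have [m] := ubnP (Lbound n mu - Lmu p); elim: m p r => // m IH p r pm pD rD pr L.
have [/existsP[i /andP[up ur]]|no] := boolP [exists i, ~~ low i p && ~~ low i r].
  have [_ lp ep] := mstar_up (proj2 pD) up; have [_ lr er] := mstar_up (proj2 rD) ur.
  have p1D := dinv_mstar i pD; have r1D := dinv_mstar i rD.
  have Lp : Lmu (mstar i p) = (Lmu p).+1 by rewrite (Lmu_mstar i (proj2 pD)) up addn1.
  have Lr : Lmu (mstar i r) = (Lmu r).+1 by rewrite (Lmu_mstar i (proj2 rD)) ur addn1.
  have le1 : le (mstar i p) (mstar i r).
    apply: (ba_lift ax p1D r1D lp); rewrite er; apply: (ba_trans ax) pr.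
    by rewrite -{2}ep; apply: (ba_up ax i p1D).
  have [||x [y [t [j [D ex ey [Lx Ly] H]]]]] := IH _ _ _ p1D r1D le1.
  - by have := Lmu_bound (proj2 p1D); rewrite Lp; lia.
  - by rewrite Lp Lr L.
  exists x, y, (i :: t), j; split=> //=; rewrite ?ex ?ey //.
  by rewrite Lx Ly Lp Lr !addSnnS.
(* An element without ascents is the minimum, hence below [p], and then it cannot be shorter than
   [p]. *)
have [i ur] : exists i, ~~ low i r.
  apply: NNPP => nor; have rmin : r = mumin n mu.
    apply: (all_low_min (proj2 rD)) => i; apply: contraT => ur.
    by case: nor; exists i.
  have [q [t [qI lw et Lq]]] := descend (proj2 pD).
  have qmin := all_low_min qI lw.
  have rp : r = p \/ le r p by rewrite -et rmin -qmin; apply: le_foldr_up (conj (proj1 pD) qI).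
  case: rp => [e|rp]; first by move: L; rewrite e; lia.
  have [_] := le_shape rD pD rp; lia.
have lp : low i p.
  apply: contraT => up; case/negP: no; apply/existsP; exists i.
  by rewrite up ur.
exists p, r, [::], i; split=> //=; first by rewrite !addn0.
split=> //; have := ba_mono ax i pD rD pr; rewrite (mact_up (proj2 rD) ur) => H.
apply: (le_eq (dinv_mact i pD) rD H).
by have := Lmu_mact (proj2 pD) lp; lia.
Qed.

(** [star] uses whichever reduced word [redword] returns. Its reversal is a reduced word of the same
    element as [t], so by the braid relations it carries [x] to [p] as well. *)
Lemma star_word mu x p t : dinv mu x -> foldr mact x t = p -> Lmu x = Lmu p + size t ->
  Defs.star (prods (rev t)) p = x /\ ell (prods (rev t)) = size t.
Proof.
move=> xD e L; have rt : reduced t.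
  by apply: (strict_reduced (proj2 xD)); rewrite e.
have lv : ell (prods (rev t)) = size t by rewrite prods_rev ell_inv -(eqP rt).
split=> //; set u := redword (prods (rev t)).
have [pu su] := redwordP (prods (rev t)); rewrite -/u in pu su.
have pru : prods (rev u) = prods t by rewrite prods_rev pu prods_rev invgK.
have rru : reduced (rev u) by rewrite /reduced pru size_rev su lv.
apply: (foldr_mstar_mact xD); last by rewrite su lv.
by rewrite (mact_matsumoto (proj2 xD) rru rt pru).
Qed.

Lemma Winv_nonempty mu x : dinv mu x -> exists2 t,
  foldr mact (mumin n mu) t = x & Lmu (mumin n mu) = Lmu x + size t.
Proof.
move=> xD; have [q [t [qI lw et Lq]]] := descend (proj2 xD).
by exists t; rewrite -(all_low_min qI lw).
Qed.

Lemma mumin_dinv mu p : dinv mu p -> dinv mu (mumin n mu).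
Proof.
move=> pD; have [q [t [qI lw et Lq]]] := descend (proj2 pD).
by rewrite -(all_low_min qI lw); split=> //; case: pD.
Qed.

Lemma covers_bruhat mu nu p r : dinv mu p -> dinv nu r ->
  covers (@degenerate n) le p r <->
    (covers (fun la => is_comp n la) refines mu nu /\ W p \subset W r)
    \/
    (nu = mu /\
     exists (alpha : 'I_n.-1) (v : 'S_n),
       [/\ Lmu (star v p) = (Lmu p + ell v)%N /\
           Lmu (star v r) = (Lmu r + ell v)%N,
           mstar alpha (star v r) = star v p
         & [set (sref alpha * w)%g | w in Winv (star v p)]
             :&: Winv (star v r) != set0]).
Proof.
move=> pD rD; split.
  move=> [pr pNr cov].
  have [[la [z [zD pz zr zN zN']]]|[nm L]|[c L]] := cover_cases pD rD pr pNr.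
  - have zd : degenerate z by exists la; case: zD.
    by case: (cov z zd pz zr).
  - right; split=> //; rewrite nm in rD.
    have [x [y [t [i [[xD yD] ex ey [Lx Ly] [lx exy]]]]]] := cover_descend pD rD pr L.
    have [sx lv] := star_word xD ex Lx; have [sy _] := star_word yD ey Ly.
    exists i, (prods (rev t)); rewrite sx sy lv; split=> //.
      by rewrite -exy (mstar_mact (proj2 xD) lx).
    (* For (c): a word from the minimum to x, prolonged by the letter i, leads from the minimum to
       y, and the length drops at every letter. *)
    have [u eu Lu] := Winv_nonempty xD; have mD := mumin_dinv xD.
    have [|a1 l1] := act_word (t := u) (proj2 mD); first by rewrite eu.
    have e2 : foldr mact (mumin n mu) (i :: u) = y by rewrite /= eu.
    have L2 : Lmu (mumin n mu) = Lmu y + size (i :: u).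
      by rewrite Lu (Lmu_mact (proj2 xD) lx) exy /= addnS addSn.
    have [|a2 l2] := act_word (t := i :: u) (proj2 mD); first by rewrite e2.
    apply/set0Pn; exists (prods (i :: u)); rewrite inE; apply/andP; split.
      apply/imsetP; exists (prods u); last by rewrite big_cons.
      by rewrite inE (shape_muinv (proj2 xD)) a1 eu eqxx l1 Lu addnC eqxx.
    by rewrite inE (shape_muinv (proj2 yD)) a2 e2 eqxx l2 L2 addnC eqxx.
  - by left; split=> //; apply: le_W L.
case=> [[[ref mnN cov] sub]|[nm [i [v [[Lx Ly] exy ne]]]]].
  have [pr L] := W_le pD rD ref sub; split=> //.
    by move=> e; apply: mnN; apply: (dinv_shape pD); rewrite e.
  (* The composition of z is mu or nu, as nu covers mu. The bounds of [le_shape] then fix the length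
     of z, so z is p or r. *)
  move=> z [la laC zI] pz zr; have zD : dinv la z by [].
  have [r1 L1] := le_shape pD zD pz; have [r2 L2] := le_shape zD rD zr.
  case: (cov la laC r1 r2) => e; rewrite e in zD L1 L2.
    by left; apply/esym; apply: (le_eq pD zD pz); lia.
  by right; apply: (le_eq zD rD zr); lia.
rewrite nm in rD.
have [pv sv] := redwordP v; set u := redword v in pv sv.
set x := star v p in Lx exy ne; set y := star v r in Ly exy ne.
have xD : dinv mu x by apply: dinv_foldr_mstar.
have yD : dinv mu y by apply: dinv_foldr_mstar.
(* The equation for [mstar] holds by default when x = y and x is low. Condition (c) rules this out:
   for x = y, both w and s_alpha w would have the same length. *)
have xNy : x <> y.
  move=> e; case/set0Pn: ne => w; rewrite inE => /andP[/imsetP[w' + ->]].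
  rewrite -e !inE => /andP[_ /eqP l1] /andP[_ /eqP l2].
  by have := ell_sref_neq w' i; rewrite -(eqn_add2r (Lmu x)) l1 l2 eqxx.
have uy : ~~ low i y.
  by apply/negP => lw; apply: xNy; rewrite -exy (mstar_low (proj2 yD) lw).
have [_ lx ey] := mstar_up (proj2 yD) uy; rewrite exy in lx ey.
have xy : le x y by rewrite -ey; apply: (ba_up ax i xD).
have Lxy : Lmu x = (Lmu y).+1 by rewrite (Lmu_mact (proj2 xD) lx) ey.
have pr : le p r.
  by apply: (le_star (u := u) pD rD) xy; rewrite sv.
have L : Lmu p = (Lmu r).+1 by lia.
split=> //; first by move=> e; move: L; rewrite e; lia.
move=> z [la laC zI] pz zr; have zD : dinv la z by [].
have [r1 L1] := le_shape pD zD pz; have [r2 L2] := le_shape zD rD zr.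
(* Here z has the composition of p and r, and its length lies between two consecutive integers. *)
have e := ba_anti ax laC (proj1 pD) r2 r1; rewrite e in zD L1 L2.
have [Lz|Lz] : Lmu z = Lmu p \/ Lmu z = Lmu r by lia.
  by left; apply/esym; apply: (le_eq pD zD pz).
by right; apply: (le_eq zD rD zr).
Qed.

End Order.

(** * Minors *)

Definition enum_nth n (x0 : 'I_n) (I : {set 'I_n}) (a : nat) : 'I_n :=
  nth x0 (enum I) a.

(* Locked, so that distributivity lemmas do not see a sum inside a minor. *)
HB.lock Definition set_minor (R : comNzRingType) (n : nat) (x0 : 'I_n) (d : nat)
    (A : 'M[R]_n) (I J : {set 'I_n}) : R :=
  (\det (\matrix_(a < d, b < d) A (enum_nth x0 I a) (enum_nth x0 J b)))%R.

Section Minors.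


Variables (R : comNzRingType) (n : nat) (x0 : 'I_n).
Implicit Types (A B : 'M[R]_n) (I J K : {set 'I_n}) (d : nat).

Local Notation enum_nth := (enum_nth x0).
Local Notation set_minor := (set_minor x0).


Lemma big_enum_nth (T : Type) (idx : T) (op : Monoid.com_law idx) (F : 'I_n -> T) d I :
  #|I| = d -> \big[op/idx]_(a in I) F a = \big[op/idx]_(a < d) F (enum_nth I a).
Proof.
move=> <-; rewrite -big_enum /= (big_nth x0) -cardE big_mkord.
by apply: eq_bigr => a _.
Qed.

Lemma enum_nth_in I d (a : 'I_d) : #|I| = d -> enum_nth I a \in I.
Proof. by move=> dI; rewrite -mem_enum mem_nth // -cardE dI. Qed.

Lemma enum_nth_inj I d : #|I| = d -> injective (fun a : 'I_d => enum_nth I a).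
Proof.
move=> dI a b /eqP; rewrite nth_uniq ?enum_uniq -?cardE ?dI // => /eqP.
exact: val_inj.
Qed.

Local Open Scope ring_scope.

(* Grouping the row selections f by their image K is the Cauchy-Binet formula. *)
Lemma det_mul_rect d (M : 'M[R]_(d, n)) (N : 'M[R]_(n, d)) :
  \det (M *m N) = \sum_(K : {set 'I_n} | #|K| == d)
     \det (\matrix_(a, b) M a (enum_nth K b)) * \det (\matrix_(a, b) N (enum_nth K a) b).
Proof.
pose G (f : {ffun 'I_d -> 'I_n}) : R :=
  (\prod_i M i (f i)) * \det (\matrix_(a, b) N (f a) b).
have -> : \det (M *m N) = \sum_(f : {ffun 'I_d -> 'I_n}) G f.
  rewrite /determinant.
  under eq_bigr => s _.
    under eq_bigr => i _ do rewrite mxE.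
    rewrite bigA_distr_bigA /= big_distrr /=.
    over.
  rewrite exchange_big /=; apply: eq_bigr => f _.
  rewrite /G /determinant big_distrr /=; apply: eq_bigr => s _.
  rewrite big_split /= mulrCA; congr (_ * (_ * _)).
  by apply: eq_bigr => i _; rewrite mxE.
rewrite (bigID (fun f : {ffun 'I_d -> 'I_n} => injectiveb f)) /=.
rewrite [X in _ + X]big1 ?addr0; last first.
  move=> f /injectivePn[i [j ij eq_ij]]; rewrite /G.
  suff -> : \det (\matrix_(a, b) N (f a) b) = 0 by rewrite mulr0.
  by apply: (determinant_alternate ij) => c; rewrite !mxE eq_ij.
rewrite (partition_big (fun f : {ffun 'I_d -> 'I_n} => [set f a | a in 'I_d])
  (fun K : {set 'I_n} => #|K| == d)) /=; last first.
  by move=> f /injectiveP fI; rewrite card_imset // card_ord.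
apply: eq_bigr => K /eqP dK.
rewrite /determinant big_distrl /=.
pose h (s : 'S_d) : {ffun 'I_d -> 'I_n} := [ffun a => enum_nth K (s a)].
rewrite (reindex h) /=; last first.
  pose h' (f : {ffun 'I_d -> 'I_n}) : 'S_d :=
    odflt 1%g [pick s : 'S_d | h s == f].
  have hI : injective h.
    move=> s t /ffunP st; apply/permP => a; move: (st a).
    by rewrite !ffunE; apply: enum_nth_inj.
  exists h' => [s _ | f /andP[/injectiveP fI /eqP fK]].
    rewrite /h'; case: pickP => [t /eqP/hI //|/(_ s)].
    by rewrite eqxx.
  rewrite /h'; case: pickP => [t /eqP //|noS].
  have fin a : f a \in K by rewrite -fK imset_f.
  have idx a : (index (f a) (enum K) < d)%N.
    by rewrite -[X in (_ < X)%N]dK cardE index_mem mem_enum.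
  pose g a : 'I_d := Ordinal (idx a).
  have gI : injective g.
    move=> a b [] /(congr1 (nth x0 (enum K))).
    by rewrite !nth_index ?mem_enum // => /fI.
  suff: h (perm gI) = f by move/eqP; rewrite noS.
  by apply/ffunP => a; rewrite ffunE permE /enum_nth nth_index ?mem_enum.
apply: eq_big => [s|s _].
  have hI : injective (h s).
    by move=> a b; rewrite !ffunE => /(enum_nth_inj dK)/perm_inj.
  apply/andP; split; first exact/injectiveP.
  rewrite eqEcard card_imset // card_ord dK leqnn andbT.
  by apply/subsetP => x /imsetP[a _ ->]; rewrite ffunE enum_nth_in.
rewrite /G -mulrA mulrCA; congr (_ * _).
  by apply: eq_bigr => i _; rewrite mxE ffunE.
rewrite -(det_perm R s) -[X in _ = _ * X]/(\det _) -det_mulmx; congr (\det _).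
apply/matrixP => a b; rewrite !mxE (bigD1 (s a)) //= big1 => [|c cs].
  by rewrite !mxE eqxx mul1r addr0 ffunE.
by rewrite !mxE eq_sym (negPf cs) mul0r.
Qed.

Lemma set_minor_mul d A B I J :
  set_minor d (A *m B) I J =
  \sum_(K : {set 'I_n} | #|K| == d) set_minor d A I K * set_minor d B K J.
Proof.
rewrite !set_minor.unlock.
set M := \matrix_(a < d, c < n) A (enum_nth I a) c.
set N := \matrix_(c < n, b < d) B c (enum_nth J b).
have -> : \matrix_(a, b) (A *m B) (enum_nth I a) (enum_nth J b) = M *m N.
  by apply/matrixP => a b; rewrite !mxE; apply: eq_bigr => c _; rewrite !mxE.
rewrite det_mul_rect; apply: eq_bigr => K _; congr (_ * _); congr (\det _).
  by apply/matrixP => a b; rewrite !mxE.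
by apply/matrixP => a b; rewrite !mxE.
Qed.

Lemma set_minor_tr d A I J : set_minor d A^T I J = set_minor d A J I.
Proof.
by rewrite !set_minor.unlock -det_tr; congr (\det _); apply/matrixP => a b; rewrite !mxE.
Qed.

Section Weights.

Variables (e' e : 'I_n -> nat).

(** The torus weight, for the exponents [f], of the basis vector of the exterior power indexed by
    [I]. *)
Definition wt (f : 'I_n -> nat) I : nat := \sum_(a in I) f a.

(** A nonzero term of the expansion matches rows with columns along nonzero entries, each of which
    satisfies the inequality of weights. *)
Lemma set_minor_wt_le d A I K : #|I| = d -> #|K| = d ->
  (forall a b, A a b != 0 -> (e' a <= e b)%N) ->
  set_minor d A I K != 0 -> (wt e' I <= wt e K)%N.
Proof.
move=> dI dK supp; apply: contraR; rewrite -ltnNge => lt.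
rewrite !set_minor.unlock /determinant big1 // => s _.
have [i /eqP Ai0|noi] :=
  pickP (fun i : 'I_d => A (enum_nth I i) (enum_nth K (s i)) == 0).
  by rewrite (bigD1 i) //= mxE Ai0 mul0r mulr0.
suff: (wt e' I <= wt e K)%N by rewrite leqNgt lt.
rewrite /wt (big_enum_nth _ _ dI) (big_enum_nth _ _ dK) [X in (_ <= X)%N](reindex_inj (@perm_inj _ s)).
by apply: leq_sum => i _; apply: supp; rewrite noi.
Qed.

Definition lead A : 'M[R]_n :=
  \matrix_(a, b) if e' a == e b then A a b else 0.

(** When the total weights agree, a nonzero term has equality of weights in each factor, so only
    entries of [lead A] contribute. *)
Lemma set_minor_lead d A I K : #|I| = d -> #|K| = d ->
  (forall a b, A a b != 0 -> (e' a <= e b)%N) ->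
  wt e' I = wt e K -> set_minor d A I K = set_minor d (lead A) I K.
Proof.
move=> dI dK supp eqw; rewrite !set_minor.unlock /determinant; apply: eq_bigr => s _.
congr (_ * _).
have [i /eqP Ai0|noi] :=
  pickP (fun i : 'I_d => A (enum_nth I i) (enum_nth K (s i)) == 0).
  rewrite (bigD1 i) //= [RHS](bigD1 i) //= !mxE Ai0.
  by case: ifP; rewrite !mul0r.
have le (i : 'I_d) : true -> (e' (enum_nth I i) <= e (enum_nth K (s i)) ?= iff
    (e' (enum_nth I i) == e (enum_nth K (s i))))%N.
  by move=> _; apply/leqifP; case: ltngtP (supp _ _ (negbT (noi i))).
have [_] := leqif_sum le.
rewrite -(big_enum_nth _ e' dI) -(reindex_inj (@perm_inj _ s)
   (P := xpredT) (F := fun i : 'I_d => e (enum_nth K i))) -(big_enum_nth _ e dK).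
rewrite -/(wt _ _) -/(wt _ _) eqw eqxx => /esym/forallP H.
by apply: eq_bigr => i _; rewrite !mxE (eqP (H i)) eqxx.
Qed.

End Weights.

Lemma set_minor_graph d A (s : 'I_n -> 'I_n) I J : #|I| = d -> #|J| = d ->
  injective s -> (forall a b, A a b != 0 -> b = s a) ->
  set_minor d A I J != 0 -> J = [set s a | a in I].
Proof.
move=> dI dJ sI supp nz.
(* The weights are indicators of the complement of J: columns have total weight zero, so all rows
   must be sent into J. *)
have suppJ a b : A a b != 0 -> ((s a \notin J) <= (b \notin J))%N.
  by move=> /supp ->.
have := set_minor_wt_le dI dJ suppJ nz.
rewrite {2}/wt big1 => [|b ->] //; rewrite leqn0 sum_nat_eq0 => /forall_inP H.
apply/esym/eqP; rewrite eqEcard card_imset // dI dJ leqnn andbT.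
by apply/subsetP => x /imsetP[a aI ->]; have:= H _ aI; rewrite eqb0 negbK.
Qed.

Lemma set_minor_diag d (f : 'I_n -> R) I J : #|I| = d -> #|J| = d ->
  set_minor d (\matrix_(a, b) if a == b then f a else 0) I J =
  if I == J then \prod_(a in I) f a else 0.
Proof.
move=> dI dJ; case: (I =P J) => [<-|neq]; last first.
  apply/eqP; apply: contraT => nz; case: neq.
  rewrite (@set_minor_graph d _ id I J dI dJ _ _ nz) ?imset_id // => a b.
  by rewrite mxE; case: (a =P b) => //; rewrite eqxx.
rewrite (big_enum_nth _ _ dI) set_minor.unlock.
pose D := \row_(a < d) f (enum_nth I a).
have -> : \prod_(a < d) f (enum_nth I a) = \det (diag_mx D).
  by rewrite det_diag; apply: eq_bigr => a _; rewrite mxE.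
congr (\det _); apply/matrixP => a b; rewrite !mxE.
rewrite (inj_eq (enum_nth_inj dI)); by case: (a =P b) => // ->; rewrite ?mulr1n ?mulr0n.
Qed.

End Minors.

Lemma set_minor_map (R R' : comNzRingType) (f : {rmorphism R' -> R}) n (x0 : 'I_n) d
    (A : 'M[R']_n) I J :
  set_minor x0 d (map_mx f A) I J = f (set_minor x0 d A I J).
Proof.
rewrite !set_minor.unlock -det_map_mx; congr (\det _)%R.
by apply/matrixP => a b; rewrite !mxE.
Qed.

Lemma minorE (k : closedFieldType) n (x0 : 'I_n) (A : 'M[k]_n)
    (I J : {set 'I_n}) :
  #|I| = #|J| -> minor A I J = set_minor x0 #|I| A I J.
Proof.
move=> IJ; rewrite /minor set_minor.unlock; congr (\det _)%R; apply/matrixP => a b.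
rewrite !mxE /enum_nth; congr (A _ _); apply: set_nth_default => //.
  by rewrite -cardE.
by rewrite -cardE -IJ.
Qed.

(** * Multihomogeneous functions *)

Section Multihomogeneous.

Variables (k : closedFieldType) (n : nat).
Implicit Types (phi : mpoint k n -> k) (deg : nat -> nat).

Local Open Scope ring_scope.

(** A function represented by some multihomogeneous polynomial; functions are easier to compose with
    group elements. [deg d] is the degree in the coordinates of the d-th projective space. *)
Definition mhom deg phi : Prop :=
  exists2 f : {mpoly k[#|Defs.coord n|]},
    (forall m, m \in msupp f -> forall d : nat,
       (\sum_(j < #|Defs.coord n| | block (enum_val j) == d) m j)%N = deg d)
    & forall P : mpoint k n, f.@[fun j => P (enum_val j)] = phi P.

Lemma eq_mhom deg deg' phi phi' :
  deg =1 deg' -> phi =1 phi' -> mhom deg phi -> mhom deg' phi'.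
Proof.
move=> eqd eqp [f fh fE]; exists f => [m /fh H d|P]; first by rewrite H eqd.
by rewrite fE eqp.
Qed.

Lemma mhom_const c : mhom (fun=> 0%N) (fun=> c).
Proof.
exists c%:MP => [m|P]; last by rewrite mevalC.
move=> mc d; apply: big1 => j _; move: mc.
rewrite msuppC; case: eqP => //= _; rewrite inE => /eqP ->.
by rewrite mnm0E.
Qed.

Lemma mhom0 deg : mhom deg (fun=> 0).
Proof. by exists 0 => [m|P]; rewrite ?msupp0 // meval0. Qed.

Lemma mhomD deg phi psi : mhom deg phi -> mhom deg psi ->
  mhom deg (fun P => phi P + psi P).
Proof.
move=> [f fh fE] [g gh gE]; exists (f + g) => [m|P]; last first.
  by rewrite mevalD fE gE.
by move=> /msuppD_le; rewrite mem_cat => /orP[/fh|/gh].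
Qed.

Lemma mhomM deg deg' phi psi : mhom deg phi -> mhom deg' psi ->
  mhom (fun d => deg d + deg' d)%N (fun P => phi P * psi P).
Proof.
move=> [f fh fE] [g gh gE]; exists (f * g) => [m|P]; last first.
  by rewrite mevalM fE gE.
move=> /msuppM_le/allpairsP[[m1 m2] /= [/fh H1 /gh H2 ->]] d.
by rewrite -H1 -H2 -big_split; apply: eq_bigr => j _; rewrite mnmDE.
Qed.

Lemma mhom_coord (c : Defs.coord n) :
  mhom (fun d => block c == d) (fun P => P c).
Proof.
exists 'X_(enum_rank c) => [m|P]; last by rewrite mevalXU enum_rankK.
rewrite msuppX inE => /eqP -> d.
have [bc|bc] := eqVneq (block c) d.
  rewrite (bigD1 (enum_rank c)) /= ?enum_rankK ?bc // mnm1E eqxx.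
  by rewrite big1 ?addn0 // => j /andP[_ jc]; rewrite mnm1E eq_sym (negPf jc).
apply: big1 => j /eqP bj; rewrite mnm1E; case: eqP => // ej.
by move: bc; rewrite -bj -ej enum_rankK eqxx.
Qed.

Lemma mhom_sum (T : Type) (s : seq T) (A : pred T) deg (F : T -> mpoint k n -> k) :
  (forall i, A i -> mhom deg (F i)) ->
  mhom deg (fun P => \sum_(i <- s | A i) F i P).
Proof.
move=> H; elim: s => [|x s IH].
  by apply: eq_mhom (mhom0 deg) => // P; rewrite big_nil.
case Ax: (A x); last by apply: eq_mhom IH => // P; rewrite big_cons Ax.
by apply: eq_mhom (mhomD (H x Ax) IH) => // P; rewrite big_cons Ax.
Qed.

Lemma mhom_prod (T : Type) (s : seq T) (deg : T -> nat -> nat)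
    (F : T -> mpoint k n -> k) :
  (forall i, mhom (deg i) (F i)) ->
  mhom (fun d => \sum_(i <- s) deg i d)%N (fun P => \prod_(i <- s) F i P).
Proof.
move=> H; elim: s => [|x s IH].
  by apply: eq_mhom (mhom_const 1) => [d|P]; rewrite big_nil.
by apply: eq_mhom (mhomM (H x) IH) => [d|P]; rewrite big_cons.
Qed.

Lemma mhomZ deg phi c : mhom deg phi -> mhom deg (fun P => c * phi P).
Proof. by move=> H; apply: eq_mhom (mhomM (mhom_const c) H). Qed.

Lemma mhom_det m (deg : 'I_m -> nat -> nat) (S : mpoint k n -> 'M[k]_m) :
  (forall a b, mhom (deg a) (fun P => S P a b)) ->
  mhom (fun d => \sum_a deg a d)%N (fun P => \det (S P)).
Proof.
move=> H; rewrite /determinant; apply: mhom_sum => s _.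
by apply: mhomZ; apply: mhom_prod => a; apply: H.
Qed.

(** The bound on the size is uniform in the point, so that one Sylvester matrix size serves for all
    points. *)
Definition mhom_poly deg (Psi : mpoint k n -> {poly k}) : Prop :=
  (exists N, forall P, (size (Psi P) <= N)%N) /\
  forall j, mhom deg (fun P => (Psi P)`_j).

Lemma eq_mhom_poly deg deg' Psi Psi' :
  deg =1 deg' -> Psi =1 Psi' -> mhom_poly deg Psi -> mhom_poly deg' Psi'.
Proof.
move=> eqd eqp [[N HN] H]; split; first by exists N => P; rewrite -eqp.
by move=> j; apply: eq_mhom (H j) => // P; rewrite eqp.
Qed.

Lemma mhom_poly_const c : mhom_poly (fun=> 0%N) (fun=> c).
Proof. by split; [exists (size c)|move=> j; apply: mhom_const]. Qed.

Lemma mhom_polyC deg phi : mhom deg phi -> mhom_poly deg (fun P => (phi P)%:P).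
Proof.
move=> H; split; first by exists 1%N => P; rewrite size_polyC leq_b1.
case=> [|j]; first by apply: eq_mhom H => // P; rewrite coefC.
by apply: eq_mhom (mhom0 deg) => // P; rewrite coefC.
Qed.

Lemma mhom_polyM deg deg' Psi Phi : mhom_poly deg Psi -> mhom_poly deg' Phi ->
  mhom_poly (fun d => deg d + deg' d)%N (fun P => Psi P * Phi P).
Proof.
move=> [[N HN] H] [[N' HN'] H']; split.
  exists (N + N')%N => P; apply: leq_trans (size_polyMleq _ _) _.
  by apply: leq_trans (leq_pred _) _; rewrite leq_add.
move=> j; apply: eq_mhom (mhom_sum (A := xpredT)
  (F := fun (i : 'I_j.+1) P => (Psi P)`_i * (Phi P)`_(j - i))
  (index_enum 'I_j.+1) _) => [d|P|i _].
- by [].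
- by rewrite coefM.
- exact: mhomM.
Qed.

Lemma mhom_polyD deg Psi Phi : mhom_poly deg Psi -> mhom_poly deg Phi ->
  mhom_poly deg (fun P => Psi P + Phi P).
Proof.
move=> [[N HN] H] [[N' HN'] H']; split.
  exists (maxn N N') => P; apply: leq_trans (size_polyD _ _) _.
  by rewrite geq_max !leq_max HN HN' orbT.
by move=> j; apply: eq_mhom (mhomD (H j) (H' j)) => // P; rewrite coefD.
Qed.

Lemma mhom_poly_sum (T : Type) (s : seq T) (A : pred T) deg F :
  (forall i, A i -> mhom_poly deg (F i)) ->
  mhom_poly deg (fun P => \sum_(i <- s | A i) F i P).
Proof.
move=> H; elim: s => [|x s IH].
  by apply: eq_mhom_poly (mhom_polyC (mhom0 deg)) => // P; rewrite big_nil.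
case Ax: (A x); last by apply: eq_mhom_poly IH => // P; rewrite big_cons Ax.
by apply: eq_mhom_poly (mhom_polyD (H x Ax) IH) => // P; rewrite big_cons Ax.
Qed.

Lemma mhom_poly_prod (T : Type) (s : seq T) (deg : T -> nat -> nat) F :
  (forall i, mhom_poly (deg i) (F i)) ->
  mhom_poly (fun d => \sum_(i <- s) deg i d)%N (fun P => \prod_(i <- s) F i P).
Proof.
move=> H; elim: s => [|x s IH].
  by apply: eq_mhom_poly (mhom_poly_const 1) => [d|P]; rewrite big_nil.
by apply: eq_mhom_poly (mhom_polyM (H x) IH) => [d|P]; rewrite big_cons.
Qed.

Lemma mhom_polyX deg Psi m : mhom_poly deg Psi ->
  mhom_poly (fun d => m * deg d)%N (fun P => Psi P ^+ m).
Proof.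
move=> H; apply: eq_mhom_poly (mhom_poly_prod (iota 0 m) (fun=> H)) => [d|P].
  by rewrite big_const_seq count_predT size_iota iter_addn_0 mulnC.
by rewrite big_const_seq count_predT size_iota iter_mulr_1.
Qed.

Definition lfam (C : Defs.coord n -> Defs.coord n -> {poly k}) (t : k) (P : mpoint k n) :
  mpoint k n :=
  [ffun x => \sum_(y : Defs.coord n | block y == block x) (C x y).[t] * P y].

(** The family mixes coordinates of the same block only, so substituting it keeps the multidegree,
    and the parameter enters the coefficients alone. *)
Lemma mhom_lfam deg phi C : mhom deg phi ->
  exists2 Psi, mhom_poly deg Psi & forall t P, phi (lfam C t P) = (Psi P).[t].
Proof.
move=> [f fh fE].
pose L x (P : mpoint k n) : {poly k} := \sum_(y : Defs.coord n | block y == block x) C x y * (P y)%:P.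
exists (fun P => \sum_(m <- msupp f) (f@_m)%:P *
   \prod_(j < #|Defs.coord n|) L (enum_val j) P ^+ m j) => [|t P].
  have HL x : mhom_poly (fun d => block x == d) (L x).
    apply: mhom_poly_sum => y /eqP xy.
    apply: eq_mhom_poly
      (mhom_polyM (mhom_poly_const (C x y)) (mhom_polyC (mhom_coord y))) => // d.
    by rewrite add0n xy.
  have H (m : 'X_{1..#|Defs.coord n|}) : mhom_poly (fun d => \sum_(j < #|Defs.coord n|) m j * (block (enum_val j) == d))%N
     (fun P => (f@_m)%:P * \prod_(j < #|Defs.coord n|) L (enum_val j) P ^+ m j).
    have := mhom_poly_prod (index_enum 'I_#|Defs.coord n|)
       (fun j => mhom_polyX (m j) (HL (enum_val j))).
    by move/(mhom_polyM (mhom_poly_const (f@_m)%:P)).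
  have := fh; elim: (msupp f) => [|m s IH] Hs.
    apply: eq_mhom_poly (mhom_polyC (mhom0 deg)) => // P.
    by rewrite big_nil.
  have {}IH := IH (fun m' H' => Hs m' (mem_behead (s := m :: s) H')).
  have Hm : mhom_poly deg
     (fun P => (f@_m)%:P * \prod_(j < #|Defs.coord n|) L (enum_val j) P ^+ m j).
    apply: eq_mhom_poly (H m) => // d; rewrite -(Hs m (mem_head _ _) d).
    by rewrite [RHS]big_mkcond; apply: eq_bigr => j _; case: eqP; rewrite ?muln1 ?muln0.
  by apply: eq_mhom_poly (mhom_polyD Hm IH) => // P; rewrite big_cons.
rewrite -fE mevalE horner_sum; apply: eq_bigr => m _.
rewrite hornerM hornerC horner_prod; congr (_ * _); apply: eq_bigr => j _.
rewrite horner_exp ffunE horner_sum; congr (_ ^+ _); apply: eq_bigr => y _.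
by rewrite hornerM hornerC.
Qed.

Lemma mhom_comp_lfam deg phi C t : mhom deg phi ->
  mhom deg (fun P => phi (lfam C t P)).
Proof.
move=> /(mhom_lfam C) [Psi [[N HN] H] E].
apply: eq_mhom (mhom_sum (A := xpredT)
  (F := fun (j : 'I_N) P => t ^+ j * (Psi P)`_j) (index_enum 'I_N) _) => // [P|j _]; last exact: mhomZ.
by rewrite E (horner_coef_wide _ (HN P)); apply: eq_bigr => j _; rewrite mulrC.
Qed.

Lemma zariskiP (S : mpoint k n -> Prop) (P : mpoint k n) :
  zariski_closure S P <->
  is_mpoint P /\
  forall deg phi, mhom deg phi -> (forall Q, S Q -> phi Q = 0) -> phi P = 0.
Proof.
split=> [[PP H]|[PP H]]; split=> //.
  move=> deg phi [f fh fE] van; rewrite -fE; apply: H => [|Q /van].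
    by exists deg.
  by rewrite -fE.
move=> f [deg fh] van.
by apply: (H deg (fun P => f.@[fun j => P (enum_val j)])) => //; exists f.
Qed.

(** A closed field contains a point that is not a root of [Psi * q]. *)
Lemma poly_density (q Psi : {poly k}) : q != 0 ->
  (forall t, q.[t] != 0 -> Psi.[t] = 0) -> Psi = 0.
Proof.
move=> q0 H; apply/eqP; apply: contraT => P0.
have /closed_nonrootP[t] : Psi * q != 0 by rewrite mulf_neq0.
rewrite rootM negb_or => /andP[Pt qt].
by rewrite rootE H ?eqxx // -rootE in Pt.
Qed.

End Multihomogeneous.

(** * The action on complete quadrics *)

Section Action.

Variables (k : closedFieldType) (n : nat) (x0 : 'I_n).
Implicit Types (g h A : 'M[k]_n) (P : mpoint k n) (I J K : {set 'I_n}).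

Local Open Scope ring_scope.

Lemma card_cI (c : Defs.coord n) : #|cI c| = block c.
Proof. by []. Qed.

Lemma card_cJ (c : Defs.coord n) : #|cJ c| = block c.
Proof. by case: c => [[I J]] /= H; case/andP: (H) => /eqP. Qed.

Lemma block_bounds (c : Defs.coord n) : (0 < block c < n)%N.
Proof. by case: c => [[I J]] /= H; case/andP: (H). Qed.

Lemma sum_coord (R : nmodType) d (F : {set 'I_n} -> {set 'I_n} -> R) :
  (0 < d < n)%N ->
  \sum_(e : Defs.coord n | block e == d) F (cI e) (cJ e) =
  \sum_(K : {set 'I_n} | #|K| == d) \sum_(L : {set 'I_n} | #|L| == d) F K L.
Proof.
move=> dn; rewrite pair_big_dep /=.
rewrite (reindex_omap (fun e : Defs.coord n => val e) insub) /=; last first.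
  case=> K L /= /andP[/eqP dK /eqP dL]; rewrite insubT /= ?dK ?dL ?eqxx //.
apply: eq_big => [e|e _] //.
rewrite valK eqxx andbT -[X in X && _]/(block e == d) -[#|_| in RHS]/(#|cJ e|).
by rewrite card_cJ andbb.
Qed.

Lemma minorEc A (c e : Defs.coord n) : block e = block c ->
  (minor A (cI c) (cI e) = set_minor x0 (block c) A (cI c) (cI e)) *
  (minor A (cI c) (cJ e) = set_minor x0 (block c) A (cI c) (cJ e)) *
  (minor A (cJ c) (cJ e) = set_minor x0 (block c) A (cJ c) (cJ e)).
Proof.
by move=> ec; rewrite !(@minorE _ _ x0) ?card_cJ ?card_cI.
Qed.

Lemma gactE g P c : Defs.gact g P c =
  \sum_(e : Defs.coord n | block e == block c)
     set_minor x0 (block c) g (cI c) (cI e) * P e * set_minor x0 (block c) g (cJ c) (cJ e).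
Proof.
by rewrite ffunE; apply: eq_bigr => e /eqP ec; rewrite !(minorEc _ ec).
Qed.

Definition gfam (M : 'M[{poly k}]_n) (x y : Defs.coord n) : {poly k} :=
  set_minor x0 (block x) M (cI x) (cI y) * set_minor x0 (block x) M (cJ x) (cJ y).

Definition eval_mx (t : k) (M : 'M[{poly k}]_n) : 'M[k]_n := map_mx (horner_eval t) M.

Lemma gact_eval_mx M t P : Defs.gact (eval_mx t M) P = lfam (gfam M) t P.
Proof.
apply/ffunP => c; rewrite gactE ffunE; apply: eq_bigr => e /eqP ec.
by rewrite /eval_mx !set_minor_map /gfam hornerM mulrAC.
Qed.

Lemma eval_mx_polyC g t : eval_mx t (map_mx polyC g) = g.
Proof. by apply/matrixP => i j; rewrite !mxE /horner_eval hornerC. Qed.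

Lemma mhom_gact deg phi g : mhom deg phi -> mhom deg (fun P => phi (Defs.gact g P)).
Proof.
move=> /(mhom_comp_lfam (gfam (map_mx polyC g)) 0); apply: eq_mhom => // P.
by rewrite -gact_eval_mx eval_mx_polyC.
Qed.

Lemma mhom_eval_mx deg phi M : mhom deg phi ->
  exists2 Psi, mhom_poly deg Psi & forall t P, phi (Defs.gact (eval_mx t M) P) = (Psi P).[t].
Proof.
move=> /(mhom_lfam (gfam M)) [Psi H E]; exists Psi => // t P.
by rewrite -E gact_eval_mx.
Qed.

Definition diagm (f : 'I_n -> k) : 'M[k]_n :=
  \matrix_(a, b) if a == b then f a else 0.

Lemma gact_diagm f P :
  Defs.gact (diagm f) P =
    [ffun c => (\prod_(a in cI c) f a * \prod_(a in cJ c) f a) * P c].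
Proof.
apply/ffunP => c; rewrite gactE ffunE (bigD1 c) //= big1 ?addr0 => [|e].
  by rewrite !set_minor_diag ?card_cJ // !eqxx mulrAC.
case/andP=> /eqP ec nec; rewrite !set_minor_diag ?card_cJ // ?card_cI //.
case: eqP => EI; last by rewrite mul0r mul0r.
case: eqP => EJ; last by rewrite mulr0.
case/eqP: nec; apply: val_inj; rewrite [val e]surjective_pairing.
by rewrite [val c]surjective_pairing -/(cI e) -/(cJ e) -EI -EJ.
Qed.

Lemma diagm1 : diagm (fun=> 1) = 1%:M.
Proof. by apply/matrixP => a b; rewrite !mxE; case: eqP. Qed.

Lemma gact_id P : Defs.gact 1%:M P = P.
Proof.
by rewrite -diagm1 gact_diagm; apply/ffunP => c; rewrite ffunE !big1 // !mul1r.
Qed.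

(** Exterior powers are multiplicative by the Cauchy-Binet formula, applied to the row and to the
    column sets. *)
Lemma gact_mul g h P : Defs.gact (g *m h) P = Defs.gact g (Defs.gact h P).
Proof.
apply/ffunP => c; rewrite !gactE.
set d := block c; have dn : (0 < d < n)%N := block_bounds c.
under [RHS]eq_bigr => e /eqP ec do rewrite gactE -/(block e) ec.
under [LHS]eq_bigr => e _ do rewrite !set_minor_mul.
under [LHS]eq_bigr => e _.
  rewrite big_distrl /= big_distrl /=.
  under eq_bigr => K _ do rewrite big_distrr /=.
  over.
rewrite (eq_bigr (fun e : Defs.coord n => \sum_(f : Defs.coord n | block f == d)
   (set_minor x0 d g (cI c) (cI f) * set_minor x0 d h (cI f) (cI e) * P e *
     (set_minor x0 d g (cJ c) (cJ f) * set_minor x0 d h (cJ f) (cJ e))))); last first.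
  by move=> e _; rewrite (sum_coord (fun K L => set_minor x0 d g (cI c) K *
    set_minor x0 d h K (cI e) * P e * (set_minor x0 d g (cJ c) L * set_minor x0 d h L (cJ e)))).
rewrite exchange_big /=; apply: eq_bigr => f /eqP fc.
rewrite mulr_sumr mulr_suml; apply: eq_bigr => e _.
by rewrite !mulrA -!(mulrAC _ (set_minor x0 d g (cJ c) (cJ f))).
Qed.

Definition sat (e : 'I_n -> nat) I : bool :=
  [forall K : {set 'I_n}, (#|K| == #|I|) ==> (wt e I <= wt e K)%N].

(** The leading term, for the exponents [e], of the tuple of all minors of [A]; every [Qpoint] has
    this form. *)
Definition Qe (e : 'I_n -> nat) A : mpoint k n :=
  [ffun c => if sat e (cI c) && sat e (cJ c) then minor A (cI c) (cJ c) else 0].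

Lemma sat_leP e I :
  reflect (forall K, #|K| = #|I| -> (wt e I <= wt e K)%N) (sat e I).
Proof.
apply: (iffP forallP) => [H K /eqP KI|H K]; first exact: (implyP (H K)).
by apply/implyP => /eqP/H.
Qed.

Lemma sat_wt e I J : sat e I -> sat e J -> #|I| = #|J| -> wt e I = wt e J.
Proof.
move=> /sat_leP sI /sat_leP sJ IJ; apply/eqP.
by rewrite eqn_leq sI ?sJ.
Qed.

Lemma sat_trans e I J : sat e I -> #|I| = #|J| -> (wt e J <= wt e I)%N -> sat e J.
Proof.
move=> /sat_leP sI IJ le; apply/sat_leP => K KJ; apply: leq_trans le _.
by apply: sI; rewrite KJ.
Qed.

(* The group element only moves a vector to vectors of at most the same weight;
   the parts that lower the weight do not contribute to the leading term. *)
Lemma gact_Qe e' e g A :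
  (forall a b, g a b != 0 -> (e' a <= e b)%N) ->
  (forall I K : {set 'I_n}, sat e' I -> sat e K -> #|I| = #|K| -> wt e' I = wt e K) ->
  (forall I : {set 'I_n}, exists2 K : {set 'I_n}, #|I| = #|K| & sat e K) ->
  (forall K : {set 'I_n}, exists2 I : {set 'I_n}, #|I| = #|K| & sat e' I) ->
  Defs.gact g (Qe e A) = Qe e' (lead e' e g *m A *m (lead e' e g)^T).
Proof.
move=> supp eqs exK exI; apply/ffunP => c; rewrite gactE ffunE.
rewrite (minorEc _ (erefl _)).
set d := block c; have dn : (0 < d < n)%N := block_bounds c.
have dI : #|cI c| = d by [].
have dJ : #|cJ c| = d := card_cJ c.
have satI I K : #|I| = d -> #|K| = d -> sat e K -> set_minor x0 d g I K != 0 -> sat e' I.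
  move=> HI HK sK nz; have [I' cI' sI'] := exI K.
  apply: (sat_trans sI'); first by rewrite cI' HI HK.
  by rewrite (eqs _ _ sI' sK) //; apply: set_minor_wt_le nz.
have satK I K : #|I| = d -> #|K| = d -> sat e' I ->
    set_minor x0 d (lead e' e g) I K != 0 -> sat e K.
  move=> HI HK sI nz; have [K' cK' sK'] := exK I.
  apply: (sat_trans sK'); first by rewrite -cK' HI HK.
  rewrite -(eqs _ _ sI sK') //.
  apply: (@set_minor_wt_le _ _ x0 e e' d (lead e' e g)^T) => //.
    by move=> a b; rewrite !mxE; case: (e' b =P e a) => [->|]; rewrite ?eqxx.
  by rewrite set_minor_tr.
have smnE I K : #|I| = d -> #|K| = d -> sat e' I -> sat e K ->
   set_minor x0 d g I K = set_minor x0 d (lead e' e g) I K.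
  by move=> HI HK sI sK; apply: set_minor_lead => //; apply: eqs; rewrite ?HI ?HK.
case: ifP => [/andP[sI sJ]|nsat]; last first.
  apply: big1 => f /eqP fc; rewrite ffunE.
  case: ifP => [/andP[sfI sfJ]|]; last by rewrite mulr0 mul0r.
  have [->|nzI] := eqVneq (set_minor x0 d g (cI c) (cI f)) 0; first by rewrite !mul0r.
  have [->|nzJ] := eqVneq (set_minor x0 d g (cJ c) (cJ f)) 0; first by rewrite !mulr0.
  by move: nsat; rewrite (satI _ _ dI _ sfI nzI) // (satI _ _ dJ _ sfJ nzJ) // card_cJ.
rewrite set_minor_mul.
under [RHS]eq_bigr => L _ do rewrite set_minor_mul big_distrl /=.
rewrite exchange_big /=.
rewrite -(sum_coord (fun K L => set_minor x0 d (lead e' e g) (cI c) K * set_minor x0 d A K L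
   * set_minor x0 d (lead e' e g)^T L (cJ c)) dn).
apply: eq_bigr => f /eqP fc; rewrite set_minor_tr ffunE.
have fI : #|cI f| = d by rewrite -fc.
have fJ : #|cJ f| = d by rewrite card_cJ.
have -> : minor A (cI f) (cJ f) = set_minor x0 d A (cI f) (cJ f).
  by rewrite (minorEc _ (erefl _)) fc.
case: ifP => [/andP[sfI sfJ]|nsat]; first by rewrite !smnE.
rewrite mulr0 mul0r; apply/esym/eqP; apply: contraFT nsat.
rewrite !mulf_eq0 !negb_or => /andP[/andP[nzI _] nzJ].
by rewrite (satK _ _ dI _ sI nzI) // (satK _ _ dJ _ sJ nzJ).
Qed.

End Action.

(** * Orbit closures through vanishing of functions *)

Section Closure.

Variables (k : closedFieldType) (n : nat) (x0 : 'I_n).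
Implicit Types (g h A b : 'M[k]_n) (P Q R : mpoint k n).

Local Open Scope ring_scope.

Lemma closed_nthroot m (c : k) : (0 < m)%N -> exists z, z ^+ m = c.
Proof.
move=> m0; have /closed_rootP[z] : size ('X^m - c%:P : {poly k}) != 1%N.
  by rewrite size_XnsubC // eqSS -lt0n.
by rewrite rootE !hornerE subr_eq0 => /eqP; exists z.
Qed.

(** For nonzero [c] this is the same point of the product of projective spaces, in other
    multihomogeneous coordinates. *)
Definition scalept (kap : nat -> nat) (c : k) P : mpoint k n :=
  [ffun x => c ^+ kap (block x) * P x].

Lemma mhom_scalept deg (phi : mpoint k n -> k) kap : mhom deg phi ->
  exists K, forall c P, phi (scalept kap c P) = c ^+ K * phi P.
Proof.
move=> [f fh fE]; exists (\sum_(d < n) kap d * deg d)%N => c P.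
rewrite -!fE !mevalE big_distrr /=; apply: eq_big_seq => m mf.
rewrite mulrCA; congr (_ * _).
transitivity (\prod_(j < #|Defs.coord n|)
   (c ^+ (kap (block (enum_val j)) * m j) * P (enum_val j) ^+ m j)).
  by apply: eq_bigr => j _; rewrite ffunE exprMn exprM.
rewrite big_split /= prodrXr; congr (c ^+ _ * _).
rewrite (partition_big (fun j => Ordinal (proj2 (andP (block_bounds (enum_val j)))))
  xpredT) //=; apply: eq_bigr => d _.
rewrite -(fh m mf d) big_distrr /=; apply: eq_big => [j|j /eqP <-] //.
Qed.

Lemma gact_scalept g kap c P : Defs.gact g (scalept kap c P) = scalept kap c (Defs.gact g P).
Proof.
apply/ffunP => x; rewrite !ffunE big_distrr /=; apply: eq_bigr => y /eqP yx.
by rewrite ffunE yx mulrCA !mulrA.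
Qed.

Definition upper g := forall i j : 'I_n, (j < i)%N -> g i j = 0.

Lemma upper_mul g h : upper g -> upper h -> upper (g *m h).
Proof.
move=> ug uh i j ji; rewrite mxE big1 // => l _.
case: (ltnP l i) => [li|il]; first by rewrite ug ?mul0r.
by rewrite uh ?mulr0 //; apply: leq_trans il.
Qed.

Lemma upper_diag_neq0 g i : upper g -> g \in unitmx -> g i i != 0.
Proof.
move=> ug; rewrite unitmxE -det_tr det_trig ?unitfE; last first.
  by apply/is_trig_mxP => a b ab; rewrite mxE ug.
by move/prodf_neq0 => /(_ i isT); rewrite mxE.
Qed.

Lemma upper_inv g : upper g -> g \in unitmx -> upper (invmx g).
Proof.
move=> ug gU.
suff H m : forall i j : 'I_n, (n - i <= m)%N -> (j < i)%N -> invmx g i j = 0.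
  by move=> i j; apply: (H n); rewrite leq_subr.
elim: m => [|m IH] i j im ji.
  by move: im; rewrite leqn0 subn_eq0 leqNgt ltn_ord.
have := congr1 (fun M : 'M[k]_n => M i j) (mulmxV gU); rewrite !mxE.
rewrite (bigD1 i) //= big1 ?addr0 => [|l li].
  have -> : (i == j) = false by apply/eqP => ij; rewrite ij ltnn in ji.
  by move/eqP; rewrite mulf_eq0 (negPf (upper_diag_neq0 _ ug gU)) => /eqP.
case: (ltnP l i) => [l_i|il]; first by rewrite ug ?mul0r.
have {}il : (i < l)%N by rewrite ltn_neqAle il andbT eq_sym.
rewrite (IH l) ?mulr0 //; last exact: ltn_trans il.
rewrite -ltnS; apply: leq_trans im.
by rewrite ltn_sub2l // ltn_ord.
Qed.

Definition bvan Q (phi : mpoint k n -> k) := forall b, borel b -> phi (Defs.gact b Q) = 0.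

(** Membership of Q in the closure of the B-orbit of R, tested on functions. *)
Definition le_pt Q R :=
  forall deg phi, mhom deg phi -> bvan R phi -> phi Q = 0.

(** An invertible upper triangular matrix is a scalar times one of determinant 1, by an n-th root of
    the determinant, and scalars only rescale the components. *)
Lemma bvan_upper deg phi Q g : mhom deg phi -> bvan Q phi ->
  upper g -> g \in unitmx -> phi (Defs.gact g Q) = 0.
Proof.
move=> hom van ug gU.
have n0 : (0 < n)%N by case: (n) x0 => // - [].
have [z zn] := closed_nthroot (\det g) n0.
have z0 : z != 0.
  apply: contraTneq gU => z0; rewrite unitmxE -zn z0 expr0n.
  by rewrite (gtn_eqF n0) unitr0.
have -> : g = diagm (fun=> z) *m (z^-1 *: g).
  have -> : diagm (fun=> z) = z%:M :> 'M[k]_n.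
    by apply/matrixP => a b; rewrite !mxE; case: eqP.
  by rewrite mul_scalar_mx scalerA divff ?scale1r.
have bb : borel (z^-1 *: g).
  split; last by move=> i j ji; rewrite mxE ug ?mulr0.
  by rewrite detZ -zn -exprMn mulVf ?expr1n.
rewrite (gact_mul x0) (gact_diagm x0).
have [K HK] := mhom_scalept (fun d => d + d)%N hom.
rewrite (_ : finfun _ = scalept (fun d => d + d)%N z (Defs.gact (z^-1 *: g) Q)).
  by rewrite HK van ?mulr0.
by apply/ffunP => c; rewrite !ffunE !prodr_const card_cJ card_cI exprD.
Qed.

Lemma upper1 : upper 1%:M.
Proof. by move=> i j ji; rewrite mxE; case: eqP ji => // ->; rewrite ltnn. Qed.

Lemma borel1 : @borel k n 1%:M.
Proof. by split; [rewrite det1|apply: upper1]. Qed.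

Lemma le_pt_refl Q : le_pt Q Q.
Proof. by move=> deg phi hom /(_ _ borel1); rewrite (gact_id x0). Qed.

Lemma bvan_le Q R deg phi : le_pt Q R -> mhom deg phi -> bvan R phi -> bvan Q phi.
Proof.
move=> QR hom van b bb; apply: (QR deg (fun P => phi (Defs.gact b P))).
  exact: (mhom_gact x0).
move=> c bc; rewrite -(gact_mul x0); apply: van; case: bb bc => db ub [dc uc].
by split; [rewrite det_mulmx db dc mulr1|apply: upper_mul].
Qed.

Lemma le_pt_trans Q R P : le_pt P Q -> le_pt Q R -> le_pt P R.
Proof. by move=> PQ QR deg phi hom van; exact: (PQ _ _ hom (bvan_le QR hom van)). Qed.

Definition transv (i j : 'I_n) (t : k) : 'M[k]_n := 1%:M + t *: delta_mx i j.

Lemma mul_transv A i j t (a b : 'I_n) :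
  (A *m transv i j t) a b = A a b + t * A a i * (b == j)%:R.
Proof.
rewrite mulmxDr mulmx1 -scalemxAr !mxE (bigD1 i) //= big1 ?addr0 => [|l li].
  by rewrite !mxE eqxx mulrA.
by rewrite !mxE (negPf li) mulr0.
Qed.

Lemma transv_mul A i j t (a b : 'I_n) :
  (transv i j t *m A) a b = A a b + t * (a == i)%:R * A j b.
Proof.
rewrite mulmxDl mul1mx -scalemxAl !mxE (bigD1 j) //= big1 ?addr0 => [|l li].
  by rewrite !mxE eqxx andbT mulrA.
by rewrite !mxE (negPf li) andbF mul0r.
Qed.

Lemma transvK i j t : i != j -> transv i j t *m transv i j (- t) = 1%:M.
Proof.
move=> ij; apply/matrixP => a b; rewrite mul_transv !mxE (negPf ij) andbF.
by case: (a == i); case: (b == j) => /=; ring.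
Qed.

Lemma transv0 i j : transv i j 0 = 1%:M.
Proof. by rewrite /transv scale0r addr0. Qed.

Lemma transv_unit i j t : i != j -> transv i j t \in unitmx.
Proof. by move=> ij; case/mulmx1_unit: (transvK t ij). Qed.

Lemma upper_transv (i j : 'I_n) t : (i < j)%N -> upper (transv i j t).
Proof.
move=> ij a b ba; rewrite !mxE.
have -> : (a == b) = false by apply/eqP => ab; rewrite ab ltnn in ba.
case: (a =P i) => [ai|]; last by rewrite mulr0 addr0.
case: (b =P j) => [bj|]; last by rewrite mulr0 addr0.
by move: ba ij; rewrite ai bj => /ltn_trans H /H; rewrite ltnn.
Qed.

Definition transvX (i j : 'I_n) : 'M[{poly k}]_n := 1%:M + 'X *: delta_mx i j.

Lemma eval_mx_mul t (M N : 'M[{poly k}]_n) : eval_mx t (M *m N) = eval_mx t M *m eval_mx t N.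
Proof. exact: map_mxM. Qed.

Lemma eval_mx_transvX t i j : eval_mx t (transvX i j) = transv i j t.
Proof.
apply/matrixP => a b; rewrite !mxE /horner_eval hornerD hornerM hornerX.
by rewrite -!polyC_natr !hornerC.
Qed.

End Closure.

(** * Minimal parabolic subgroups *)

Section Parabolic.

Variables (k : closedFieldType) (n : nat) (l h : 'I_n).
Hypothesis lh : h = l.+1 :> nat.
Implicit Types (g A b : 'M[k]_n) (P Q R : mpoint k n).

Local Open Scope ring_scope.

Local Notation x0 := l.

Lemma lh_neq : l != h.
Proof. by rewrite -val_eqE /= lh ltn_eqF. Qed.

(* The minimal parabolic subgroup, as a set of not necessarily invertible
   matrices. *)
Definition parab g := forall i j : 'I_n, (j < i)%N -> (i, j) <> (h, l) -> g i j = 0.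

Lemma upper_parab g : upper g -> parab g.
Proof. by move=> ug i j ji _; apply: ug. Qed.

Lemma parab_upper g : parab g -> g h l = 0 -> upper g.
Proof.
move=> pg g0 i j ji; case: (eqVneq (i, j) (h, l)) => [[-> ->] //|/eqP].
exact: pg.
Qed.

(** This makes [parab] stable under products: as l and h are adjacent, for each intermediate index m
    one of the two factors is an entry forced to be zero. *)
Lemma between (i j m : 'I_n) : (j < i)%N -> (i, j) <> (h, l) ->
  (j < m)%N && ((m, j) != (h, l)) || (m < i)%N && ((i, m) != (h, l)).
Proof.
move=> ji neq; rewrite !xpair_eqE -!val_eqE /= lh.
have {}neq : ~~ ((i == l.+1 :> nat) && (j == l :> nat)).
  apply/negP => /andP[/eqP il /eqP jl]; apply: neq.
  by congr (_, _); apply: val_inj; rewrite //= lh.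
by move: ji neq; lia.
Qed.

Lemma parab_mul g A : parab g -> parab A -> parab (g *m A).
Proof.
move=> pg pA i j ji neq; rewrite mxE big1 // => m _.
case/orP: (between m ji neq) => /andP[lt /eqP ne].
  by rewrite (pA m j) ?mulr0.
by rewrite (pg i m) ?mul0r.
Qed.

Lemma parab_transv t : parab (transv h l t).
Proof.
move=> i j ji neq; rewrite !mxE.
have -> : (i == j) = false by apply/eqP => ij; rewrite ij ltnn in ji.
case: andP => [[/eqP ih /eqP jl]|]; last by rewrite mulr0 addr0.
by case: neq; rewrite ih jl.
Qed.

Definition pvan Q (phi : mpoint k n -> k) :=
  forall g, parab g -> g \in unitmx -> phi (Defs.gact g Q) = 0.

Lemma parab_pivot g t : parab g -> g h l = t * g h h -> upper (g *m transv h l (- t)).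
Proof.
move=> pg gt; apply: parab_upper; first exact: parab_mul (parab_transv _).
by rewrite mul_transv eqxx gt mulr1 mulNr subrr.
Qed.

(* [s] is 1 if both letters are fixed points and 0 otherwise. *)
Lemma pvan_generic deg phi Q s : mhom deg phi -> bvan Q phi ->
  (forall t, 1 + s * t ^+ 2 != 0 -> exists2 b, upper b /\ b \in unitmx &
     Defs.gact (transv h l t) Q = Defs.gact b Q) ->
  pvan Q phi.
Proof.
move=> hom van Hgen g pg gU.
(* A perturbation of g in the entry (h, h), specialising to g at 0. For generic values the pivot
   used to clear the entry (h, l) is nonzero. *)
pose M : 'M[{poly k}]_n := map_mx polyC g + 'X *: delta_mx h h.
have ME e : eval_mx e M = g + e *: delta_mx h h.
  apply/matrixP => a b; rewrite !mxE /horner_eval hornerD hornerM hornerX.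
  by rewrite -!polyC_natr !hornerC.
have [Psi HPsi E] := mhom_eval_mx x0 M hom.
(* The excluded values: where the matrix is singular, where the pivot vanishes, and where the
   numerator of 1 + s t^2 vanishes for t = g_hl / (X + g_hh). *)
pose q : {poly k} := \det M * ('X + (g h h)%:P) *
  (('X + (g h h)%:P) ^+ 2 + (s * g h l ^+ 2)%:P).
have q0 : q != 0.
  rewrite !mulf_neq0 //.
  - apply: contraTneq gU => M0; rewrite unitmxE.
    have -> : g = eval_mx 0 M by rewrite ME scale0r addr0.
    by rewrite /eval_mx det_map_mx M0 rmorph0 unitr0.
  - by rewrite -size_poly_eq0 size_XaddC.
  apply/eqP => /polyP/(_ 2%N); rewrite sqrrD -polyC_exp.
  rewrite !coefD coefXn !coefMC coefX !coefC /= mul0r !addr0.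
  by move/eqP; rewrite oner_eq0.
suff Psi0 : Psi Q = 0.
  by have := E 0 Q; rewrite ME scale0r addr0 Psi0 horner0.
apply: (poly_density q0) => e; rewrite !hornerM !mulf_eq0 !negb_or -E.
rewrite !(hornerD, horner_exp, hornerX, hornerC) => /andP[/andP[dU u0] v0].
set g' := eval_mx e M; set u := e + g h h in u0 v0.
have g'U : g' \in unitmx by rewrite unitmxE unitfE /g' /eval_mx det_map_mx.
have pg' : parab g'.
  move=> i j ji neq; rewrite /g' ME !mxE (pg _ _ ji neq).
  case: andP => [[/eqP ih /eqP jh]|]; last by rewrite mulr0 addr0.
  by move: ji; rewrite ih jh ltnn.
have g'hh : g' h h = u by rewrite /g' ME !mxE eqxx mulr1 addrC.
have g'hl : g' h l = g h l.
  by rewrite /g' ME !mxE (negPf lh_neq) andbF mulr0 addr0.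
pose t := g h l / u.
have tv_u : 1 + s * t ^+ 2 != 0.
  apply: contraNneq v0 => E0; apply/eqP.
  transitivity (u ^+ 2 * (1 + s * t ^+ 2)); last by rewrite E0 mulr0.
  by rewrite /t; field.
have [b [ub bU] yQ] := Hgen t tv_u.
have hl : h != l by rewrite eq_sym lh_neq.
have -> : g' = g' *m transv h l (- t) *m transv h l t.
  by rewrite -mulmxA -{2}[t]opprK transvK // mulmx1.
rewrite (gact_mul x0) yQ -(gact_mul x0); apply: (bvan_upper x0 hom van).
  apply: upper_mul ub; apply: parab_pivot => //.
  by rewrite g'hl g'hh /t mulfVK.
by rewrite !unitmx_mul g'U transv_unit // bU.
Qed.

Definition weightm (e : 'I_n -> nat) (c : k) : 'M[k]_n := diagm (fun a => c ^+ e a).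

Lemma diagmM (f1 f2 : 'I_n -> k) :
  diagm f1 *m diagm f2 = diagm (fun a => f1 a * f2 a).
Proof.
apply/matrixP => a b; rewrite mxE (bigD1 a) //= big1 => [|m ma].
  by rewrite !mxE eqxx; case: eqP; rewrite ?mulr0 addr0.
by rewrite !mxE eq_sym (negPf ma) mul0r.
Qed.

Lemma weightmM e (c c' : k) : weightm e c *m weightm e c' = weightm e (c * c').
Proof.
by rewrite diagmM; apply/matrixP => a b; rewrite !mxE exprMn.
Qed.

Lemma upper_weightm e c : upper (weightm e c).
Proof. by move=> i j ji; rewrite mxE; case: eqP ji => // ->; rewrite ltnn. Qed.

Lemma weightm1 e : weightm e 1 = 1%:M.
Proof. by apply/matrixP => a b; rewrite !mxE expr1n; case: eqP. Qed.

Lemma weightm_unit e c : c != 0 -> weightm e c \in unitmx.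
Proof.
move=> c0; have: weightm e c *m weightm e c^-1 = 1%:M.
  by rewrite weightmM divff // weightm1.
by case/mulmx1_unit.
Qed.

Lemma weightm_transv e c i j t : c != 0 ->
  weightm e c *m transv i j t = transv i j (c ^+ e i / c ^+ e j * t) *m weightm e c.
Proof.
move=> c0; rewrite mulmxDr mulmxDl mulmx1 mul1mx; congr (_ + _).
rewrite -scalemxAl -scalemxAr; apply/matrixP => a b; rewrite !mxE.
rewrite (bigD1 i) //= big1 => [|m mi]; last first.
  by rewrite !mxE (negPf mi) mulr0.
rewrite [in RHS](bigD1 j) //= big1 => [|m mj]; last first.
  by rewrite !mxE (negPf mj) andbF mul0r.
rewrite !mxE !eqxx andbT /= [j == b]eq_sym.
case: (a =P i) => [->|]; case: (b =P j) => /= [_|]; try by rewrite ?(mulr0, mul0r, addr0).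
by rewrite -mulrA mulr1 mul1r !addr0; field; rewrite expf_neq0.
Qed.

Lemma poly_eqP (p q : {poly k}) : (forall x, p.[x] = q.[x]) -> p = q.
Proof.
move=> pq; apply/eqP; rewrite -subr_eq0; apply/eqP.
apply: (poly_density (oner_neq0 {poly k})) => t _.
by rewrite hornerD hornerN pq subrr.
Qed.

(** The torus normalises B, so it preserves the functions vanishing on an orbit of B. Expanding phi
    along the torus subgroup in powers of the parameter gives weight vectors that still vanish on
    the orbit. *)
Lemma weight_component deg phi Q R e : mhom deg phi -> bvan R phi -> phi Q != 0 ->
  exists m f, [/\ mhom deg f, bvan R f, f Q != 0 &
    forall c P, f (Defs.gact (weightm e c) P) = c ^+ m * f P].
Proof.
move=> hom van nz.
pose M : 'M[{poly k}]_n := \matrix_(a, b) if a == b then 'X ^+ e a else 0.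
have ME c : eval_mx c M = weightm e c.
  apply/matrixP => a b; rewrite !mxE /horner_eval.
  by case: eqP; rewrite ?horner0 // hornerXn.
have [Psi [_ HPsi] E] := mhom_eval_mx x0 M hom.
have QP P : phi P = (Psi P).[1] by rewrite -E ME weightm1 (gact_id x0).
have Psi0 : Psi Q != 0 by apply: contraNneq nz => P0; rewrite QP P0 horner0.
(* The leading coefficient at Q is a component that does not vanish there. *)
pose m := (size (Psi Q)).-1.
exists m, (fun P => (Psi P)`_m); split => //.
- move=> b [db ub]; suff -> : Psi (Defs.gact b R) = 0 by rewrite coef0.
  apply: (poly_density (negbT (polyX_eq0 k))) => c; rewrite hornerX => c0.
  rewrite -E ME -(gact_mul x0); apply: (bvan_upper x0 hom van).
    by apply: upper_mul ub; apply: upper_weightm.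
  by rewrite unitmx_mul weightm_unit // unitmxE db unitr1.
- by rewrite -/(lead_coef _) lead_coef_eq0.
move=> c P.
have -> : Psi (Defs.gact (weightm e c) P) =
    \poly_(i < size (Psi P)) (c ^+ i * (Psi P)`_i).
  apply: poly_eqP => x; rewrite -E ME -(gact_mul x0) weightmM -ME E.
  rewrite horner_poly horner_coef; apply: eq_bigr => i _.
  by rewrite exprMn; ring.
rewrite coef_poly; case: ltnP => // le.
by rewrite [(Psi P)`_m]nth_default ?mulr0.
Qed.

End Parabolic.

(** * Elimination over the projective line B \ P_i *)

Section Lifting.

Variables (k : closedFieldType).

Local Open Scope ring_scope.

(* The Sylvester matrix, with oversized formal degrees, of p and of the
   reciprocal of q. *)
Definition sylvester N (p q : {poly k}) : 'M[k]_(N + N) :=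
  \matrix_(r, c) if (r < N)%N then (if (r <= c)%N then p`_(c - r) else 0)
                 else if (c <= r)%N then q`_(r - c) else 0.

(** The nonzero vector of powers of t lies in the kernel: row r reads t^r p(t) for r < N and t^r
    q(1/t) otherwise. *)
Lemma sylvester_root N (p q : {poly k}) t : (0 < N)%N ->
  (size p <= N)%N -> (size q <= N)%N -> t != 0 ->
  p.[t] = 0 -> q.[t^-1] = 0 -> \det (sylvester N p q) = 0.
Proof.
move=> N0 sp sq t0 pt qt; apply/eqP; rewrite -det_tr; apply/det0P.
have lt0 : (0 < N + N)%N by rewrite addn_gt0 N0.
exists (\row_c t ^+ c).
  apply/eqP => /rowP/(_ (Ordinal lt0)); rewrite !mxE expr0.
  by move/eqP; rewrite oner_eq0.
apply/rowP => r; rewrite !mxE.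
under eq_bigr => c _ do rewrite !mxE.
case: ltnP => rN.
  transitivity (t ^+ r * p.[t]); last by rewrite pt mulr0.
  rewrite (horner_coef_wide t (n := N + N - r)); last by apply: leq_trans sp _; lia.
  rewrite big_distrr /= -(big_mkord xpredT (fun i => t ^+ r * (p`_i * t ^+ i))).
  rewrite -(big_mkord xpredT (fun c => t ^+ c * (if (r <= c)%N then p`_(c - r) else 0))).
  rewrite (@big_cat_nat _ _ _ r) //=; last by apply: ltnW.
  rewrite big_nat big1 ?add0r => [|c /andP[_ cr]]; last by rewrite leqNgt cr mulr0.
  rewrite -{1}[r : nat]add0n big_addn; apply: eq_bigr => i _.
  by rewrite leq_addl addnK exprD; ring.
transitivity (t ^+ r * q.[t^-1]); last by rewrite qt mulr0.
rewrite (horner_coef_wide _ (n := r.+1)); last by apply: leq_trans sq _; lia.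
rewrite big_distrr /= -(big_mkord xpredT (fun i => t ^+ r * (q`_i * t^-1 ^+ i))).
rewrite -(big_mkord xpredT (fun c => t ^+ c * (if (c <= r)%N then q`_(r - c) else 0))).
rewrite (@big_cat_nat _ _ _ r.+1) //=.
rewrite [X in _ + X]big_nat [X in _ + X]big1 ?addr0 => [|c /andP[rc _]]; last first.
  by rewrite leqNgt rc mulr0.
rewrite big_nat_rev /= add0n; rewrite big_nat [RHS]big_nat; apply: eq_bigr => i.
rewrite /= ltnS subSS => ir; rewrite leq_subr subKn //.
rewrite -{2}(subnK ir) exprD exprVn; field.
by rewrite expf_neq0.
Qed.

(** For constant p the matrix is triangular. This is why it pays to make the first function constant
    along the root subgroup. *)
Lemma sylvester_const N c (q : {poly k}) :
  \det (sylvester N c%:P q) = c ^+ N * q`_0 ^+ N.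
Proof.
rewrite det_trig; last first.
  apply/is_trig_mxP => r s rs; rewrite mxE.
  case: ifP => _; last by rewrite leqNgt rs.
  rewrite (ltnW rs) coefC subn_eq0 leqNgt rs //.
rewrite big_split_ord /=; congr (_ * _).
  rewrite -[X in _ = c ^+ X]card_ord -prodr_const; apply: eq_bigr => i _.
  by rewrite mxE /= ltn_ord leqnn subnn coefC.
rewrite -[X in _ = _ ^+ X]card_ord -prodr_const; apply: eq_bigr => i _.
by rewrite mxE /= ltnNge leq_addr leqnn subnn.
Qed.

Variables (n : nat) (l h : 'I_n).
Hypothesis lh : h = l.+1 :> nat.
Implicit Types (g A b : 'M[k]_n) (P Q R : mpoint k n).

(** Membership in the group P_i is certified by an inverse of the same form. *)
Definition pvan2 R (F : mpoint k n -> k) := forall g g', parab l h g -> parab l h g' ->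
  g *m g' = 1%:M -> F (Defs.gact g R) = 0.

Lemma mul_tperm_mx A (a b : 'I_n) :
  (A *m tperm_mx l h) a b = A a (tperm l h b).
Proof. by rewrite -xcolE mxE. Qed.

Lemma inv_pair A B C : A *m B = 1%:M -> B *m C = 1%:M -> A = C :> 'M[k]_n.
Proof. by move=> AB BC; rewrite -[A]mulmx1 -BC mulmxA AB mul1mx. Qed.

Lemma tperm_mxK : tperm_mx l h *m tperm_mx l h = 1%:M :> 'M[k]_n.
Proof. by rewrite -perm_mxM tperm2 perm_mx1. Qed.

Lemma lift_pt e kap Q R : e l <> e h ->
  (forall c, c != 0 -> Defs.gact (weightm e c) Q = scalept kap c Q) ->
  le_pt Q (Defs.gact (tperm_mx l h) Q) ->
  (forall deg F, mhom deg F -> pvan2 R F -> F Q = 0) ->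
  le_pt Q R.
Proof.
move=> elh Hdiag Hs Hp deg phi hom van; apply: contra_not_eq (notF) => nz.
have lneh := lh_neq lh; have hnel : h != l by rewrite eq_sym.
(* Q lies in the closure of the orbit of s_i Q by [Hs]; so if s_i Q were in the closure of the orbit
   of R, then Q would be too. *)
have [degh [eta [heta veta nzeta]]] : exists degh eta,
    [/\ mhom degh eta, bvan R eta & eta (Defs.gact (tperm_mx l h) Q) != 0].
  apply: NNPP => no; case/eqP: nz; apply: (le_pt_trans l Hs _ hom van).
  move=> degh eta he ve.
  by apply/eqP; apply: contraT => ne; case: no; exists degh, eta.
have [m [f [homf vanf fQ fw]]] := weight_component l e hom van nz.
(* [Psi] and [Phi] read f and eta on the two charts B y(t) and B s_i x(u) of B \ P_i, with y and x
   the lower and upper root subgroups. On the overlap u = 1/t. *)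
have [Psi [[N1 HN1] HPsi] EPsi] := mhom_eval_mx l (transvX k h l) homf.
have [Phi [[N2 HN2] HPhi] EPhi] :=
  mhom_eval_mx l (map_mx polyC (tperm_mx l h) *m transvX k l h) heta.
pose N := maxn N1 N2.
have PsiE t P : f (Defs.gact (transv h l t) P) = (Psi P).[t] by rewrite -eval_mx_transvX EPsi.
have PhiE t P : eta (Defs.gact (tperm_mx l h *m transv l h t) P) = (Phi P).[t].
  by rewrite -EPhi eval_mx_mul eval_mx_polyC eval_mx_transvX.
have [K HK] := mhom_scalept kap homf.
(* The torus subgroup rescales t and multiplies both sides of the comparison by powers of c. At t =
   0, where f(Q) is nonzero, these powers are seen to agree; and as e l and e h differ, every
   nonzero t is reached from 1. *)
have PsiQ : Psi Q = (f Q)%:P.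
  have inv c t : c != 0 -> (Psi Q).[c ^+ e h / c ^+ e l * t] = (Psi Q).[t].
    move=> c0.
    have key t' : c ^+ m * (Psi Q).[t'] = c ^+ K * (Psi Q).[c ^+ e h / c ^+ e l * t'].
      rewrite -!PsiE -fw -(gact_mul l) weightm_transv // (gact_mul l) Hdiag //.
      by rewrite gact_scalept HK.
    have := key 0; rewrite mulr0 -PsiE transv0 (gact_id l) => /(mulIf fQ) cmK.
    have := key t; rewrite cmK => /mulfI -> //.
    by rewrite expf_neq0.
  have inv1 x : x != 0 -> (Psi Q).[x] = (Psi Q).[1].
    move=> x0; case: (ltngtP (e h) (e l)) => [lt|lt|]; last by move/esym.
      have [c cE] : exists c, c ^+ (e l - e h) = x.
        by apply: closed_nthroot; rewrite subn_gt0.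
      have c0 : c != 0.
        apply: contraNneq x0 => c0; rewrite -cE c0 expr0n subn_eq0 leqNgt lt.
        by rewrite eqxx.
      rewrite -(inv c x c0) -cE -{1}(subnK (ltnW lt)) exprD.
      by congr (_.[_]); field; rewrite !expf_neq0.
    have [c cE] : exists c, c ^+ (e h - e l) = x.
      by apply: closed_nthroot; rewrite subn_gt0.
    have c0 : c != 0.
      apply: contraNneq x0 => c0; rewrite -cE c0 expr0n subn_eq0 leqNgt lt.
      by rewrite eqxx.
    rewrite -(inv c 1 c0) -cE -{2}(subnK (ltnW lt)) exprD.
    by congr (_.[_]); field; rewrite expf_neq0.
  have E1 : Psi Q - ((Psi Q).[1])%:P = 0.
    apply: (poly_density (negbT (polyX_eq0 k))) => x; rewrite hornerX => x0.
    by rewrite hornerD hornerN hornerC inv1 ?subrr.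
  have {}E1 : Psi Q = ((Psi Q).[1])%:P by apply/eqP; rewrite -subr_eq0 E1.
  have fE : f Q = (Psi Q).[0] by rewrite -PsiE transv0 (gact_id l).
  by rewrite fE E1 hornerC.
have PhiQ : (Phi Q)`_0 != 0.
  by rewrite -horner_coef0 -PhiE transv0 mulmx1.
pose F P := \det (sylvester N (Psi P) (Phi P)).
have homF : mhom (fun d => \sum_(r < N + N) (if (r < N)%N then deg else degh) d)%N F.
  apply: (mhom_det (deg := fun r : 'I_(N + N) => if (r < N)%N then deg else degh)) => r c.
  have [rN|rN] := boolP (r < N)%N.
    case rc: (r <= c)%N.
      by apply: (eq_mhom _ _ (HPsi (c - r)%N)) => // P; rewrite mxE rN rc.
    by apply: eq_mhom (mhom0 _ _ _) => // P; rewrite mxE rN rc.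
  case rc: (c <= r)%N.
    by apply: (eq_mhom _ _ (HPhi (r - c)%N)) => // P; rewrite mxE (negPf rN) rc.
  by apply: eq_mhom (mhom0 _ _ _) => // P; rewrite mxE (negPf rN) rc.
have N0 : (0 < N)%N.
  rewrite leq_max; apply/orP; left; apply: leq_trans (HN1 Q).
  by rewrite PsiQ size_polyC fQ.
suff: F Q = 0.
  rewrite /F PsiQ sylvester_const => /eqP; rewrite mulf_eq0.
  by rewrite !expf_eq0 N0 (negPf fQ) (negPf PhiQ).
apply: (Hp _ _ homF) => g g' pg pg' gg'.
pose M : 'M[{poly k}]_n := map_mx polyC g *m transvX k h l.
have ME t : eval_mx t M = g *m transv h l t by rewrite eval_mx_mul eval_mx_polyC eval_mx_transvX.
have [Theta _ ETheta] := mhom_eval_mx l M homF.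
suff Theta0 : Theta R = 0.
  by have := ETheta 0 R; rewrite ME transv0 mulmx1 Theta0 horner0.
(* The inverse of g y(t) is y(-t) g'. Its entries (h, l) and (h, h) must be nonzero for g y(t) to be
   seen in both charts. Neither factor is zero, or a column of g' would vanish in rows l and h. *)
pose q : {poly k} := ((g' h l)%:P - g' l l *: 'X) * ((g' h h)%:P - g' l h *: 'X).
have lin (a b : k) : (a != 0) || (b != 0) -> a%:P - b *: 'X != 0 :> {poly k}.
  move=> ab; apply/eqP => /polyP ab0.
  have := ab0 0; have := ab0 1; rewrite !coefB !coefC !coefZ !coefX /=.
  rewrite mulr0 mulr1 subr0 sub0r => /eqP; rewrite oppr_eq0 => /eqP b0 a0.
  by move: ab; rewrite a0 b0 eqxx.
have gg'E (a b : 'I_n) := congr1 (fun A : 'M[k]_n => A a b) gg'.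
have q0 : q != 0.
  apply: mulf_neq0; apply: lin.
    apply: contraT; rewrite negb_or !negbK => /andP[/eqP H1 /eqP H2].
    have := gg'E l l; rewrite !mxE eqxx big1 => [/eqP|b _].
      by rewrite eq_sym oner_eq0.
    case: (ltngtP b l) => block2.
    - rewrite pg ?mul0r // => -[E _]; move: lneh; by rewrite E eqxx.
    - have [->|bh] := eqVneq b h; first by rewrite H1 mulr0.
      by rewrite pg' ?mulr0 // => -[E]; rewrite E eqxx in bh.
    - by rewrite (val_inj block2) H2 mulr0.
  apply: contraT; rewrite negb_or !negbK => /andP[/eqP H1 /eqP H2].
  have := gg'E h h; rewrite !mxE eqxx big1 => [/eqP|b _].
    by rewrite eq_sym oner_eq0.
  case: (ltngtP b h) => bh.
  - have [->|block2] := eqVneq b l; first by rewrite H2 mulr0.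
    by rewrite pg ?mul0r // => -[E]; rewrite E eqxx in block2.
  - by rewrite pg' ?mulr0 // => -[_ E]; move: lneh; rewrite E eqxx.
  - by rewrite (val_inj bh) H1 mulr0.
apply: (poly_density q0) => t; rewrite -ETheta ME.
rewrite !(hornerD, hornerN, hornerM, hornerC, hornerZ, hornerX) mulf_eq0 negb_or.
pose G := g *m transv h l t; pose G' := transv h l (- t) *m g'.
have GG' : G *m G' = 1%:M.
  by rewrite /G /G' mulmxA -(mulmxA g) transvK // mulmx1.
have pG' : parab l h G' by apply: parab_mul => //; apply: parab_transv.
have G'hl : G' h l = g' h l - g' l l * t by rewrite transv_mul eqxx mulr1 mulNr mulrC.
have G'hh : G' h h = g' h h - g' l h * t by rewrite transv_mul eqxx mulr1 mulNr mulrC.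
rewrite -G'hl -G'hh -/G => /andP[nl nh].
clearbody G G'.
(* The common root: both y(s) G and s_i x(1/s) G are upper triangular, so f and eta vanish there. *)
pose s := G' h l / G' h h.
have s0 : s != 0 by rewrite mulf_neq0 ?invr_neq0.
have G'U : G' \in unitmx by case: (mulmx1_unit GG').
rewrite /F; apply: (sylvester_root (t := s)) => //.
- by apply: leq_trans (HN1 _) _; apply: leq_maxl.
- by apply: leq_trans (HN2 _) _; apply: leq_maxr.
- rewrite -PsiE -(gact_mul l).
  set B := G' *m transv h l (- s).
  have uB : upper B by apply: parab_pivot => //; rewrite /s mulfVK.
  have BU : B \in unitmx by rewrite unitmx_mul G'U transv_unit.
  have -> : transv h l s *m G = invmx B.
    apply: (@inv_pair _ B); last by rewrite mulmxV.
    by rewrite /B mulmxA -(mulmxA _ G) GG' mulmx1 transvK.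
  by apply: (bvan_upper l homf vanf); [apply: upper_inv|rewrite unitmx_inv].
rewrite -PhiE -(gact_mul l).
set B := G' *m transv l h (- s^-1) *m tperm_mx l h.
have uB : upper B.
  move=> i j ji; rewrite mul_tperm_mx // mul_transv.
  case: tpermP => [jl|jh|/eqP jl /eqP jh].
  - rewrite eqxx mulr1; have [ih|ih] := eqVneq i h.
      by rewrite ih /s invf_div; field; rewrite nl.
    have hi : (h < i)%N.
      by rewrite ltn_neqAle eq_sym ih lh -jl.
    rewrite (pG' i h) ?(pG' i l) //; first by rewrite mulr0 addr0.
    - by apply: ltn_trans hi; rewrite lh.
    - by move=> -[E]; rewrite E eqxx in ih.
    - by move=> -[_ E]; move: hnel; rewrite E eqxx.
  - rewrite (negPf lneh) mulr0 addr0 pG' //.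
      by apply: leq_trans ji; rewrite jh lh.
    by move=> -[E]; move: ji; rewrite E jh ltnn.
  - rewrite (negPf jh) mulr0 addr0 pG' // => -[_ E].
    by rewrite E eqxx in jl.
have BU : B \in unitmx.
  by rewrite unitmx_mul (unitmx_mul G') G'U transv_unit //; case/mulmx1_unit: tperm_mxK.
have -> : tperm_mx l h *m transv l h s^-1 *m G = invmx B.
  apply: (@inv_pair _ B); last by rewrite mulmxV.
  rewrite /B !mulmxA -(mulmxA _ G) GG' mulmx1 -(mulmxA _ (transv l h s^-1)) transvK //.
  by rewrite mulmx1 tperm_mxK.
by apply: (bvan_upper l heta veta); [apply: upper_inv|rewrite unitmx_inv].
Qed.

End Lifting.

(** * Saturated sets as sets of minimal weight *)

Section Saturation.

Variable n : nat.
Implicit Types (I K : {set 'I_n}) (e f : 'I_n -> nat).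

Lemma set_of_card d : (d <= n)%N -> exists K : {set 'I_n}, #|K| = d.
Proof.
move=> dn; have : (d <= #|'I_n|)%N by rewrite card_ord.
by case/card_geqP => s [us <- _]; exists [set x in s]; rewrite cardsE; apply/card_uniqP.
Qed.

Lemma card_geq (c : nat) : #|[set x : 'I_n | (c <= x)%N]| = (n - c)%N.
Proof.
rewrite cardsE -sum1_card (eq_bigl (fun x : 'I_n => true && (c <= x))%N) //.
by rewrite -(big_geq_mkord c n xpredT (fun=> 1%N)) sum_nat_const_nat muln1.
Qed.

Lemma sat_exists e d : (d <= n)%N -> exists2 K : {set 'I_n}, #|K| = d & sat e K.
Proof.
move=> /set_of_card[K0 /eqP K0d].
case: (arg_minnP (P := fun K : {set 'I_n} => #|K| == d) (wt e) K0d) => K /eqP Kd min.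
by exists K => //; apply/sat_leP => L; rewrite Kd => /eqP /min.
Qed.

Lemma sat_exists_card e (I : {set 'I_n}) : exists2 K : {set 'I_n}, #|I| = #|K| & sat e K.
Proof.
have [|K cK sK] := @sat_exists e #|I|; last by exists K.
by rewrite -[X in (_ <= X)%N](card_ord n) max_card.
Qed.

Lemma wt_split e I K : wt e I = (wt e (I :&: K) + wt e (I :\: K))%N.
Proof. by rewrite /wt (big_setID K). Qed.

(** Exchanging a letter of [I] for a missing letter of a later string lowers the weight. Conversely,
    for saturated [I] no letter of I \ K is heavier than the lightest letter of K \ I, and these
    differences have equal size. *)
Lemma sat_saturated R f I : (forall x, f x < R)%N ->
  sat (fun x => R - f x)%N I = [forall a in I, forall b, (f a < f b)%N ==> (b \in I)].
Proof.
move=> fR; set e := fun x => (R - f x)%N.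
have eE a b : (e a <= e b)%N = (f b <= f a)%N by rewrite /e; have := fR a; have := fR b; lia.
apply/sat_leP/forall_inP => [H a aI|H K cK].
  apply/forallP => b; apply/implyP => ab; apply: contraT => bI.
  have := H (b |: (I :\ a)); rewrite cardsU1 !inE (negPf bI) andbF.
  rewrite (cardsD1 a I) aI => /(_ erefl); rewrite /wt big_setU1 ?inE ?(negPf bI) ?andbF //.
  rewrite (big_setD1 a aI) /= leq_add2r eE; lia.
rewrite (wt_split e I K) (wt_split e K I) setIC leq_add2l.
have cD : #|I :\: K| = #|K :\: I|.
  by apply/eqP; rewrite -(eqn_add2l #|I :&: K|) cardsID setIC cardsID cK.
have [K0|[b0 b0D]] := set_0Vmem (K :\: I).
  have I0 : I :\: K = set0 by apply/eqP; rewrite -cards_eq0 cD K0 cards0.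
  by rewrite I0 K0.
case: (arg_minnP (P := fun x => x \in K :\: I) e b0D) => b.
rewrite inE => /andP[bI bK] min.
apply: leq_trans (_ : #|I :\: K| * e b <= _)%N.
  rewrite -sum_nat_const; apply: leq_sum => a; rewrite inE => /andP[aK aI].
  rewrite eE leqNgt; apply: contra bI => ab.
  by have /forallP/(_ b)/implyP := H a aI; apply.
by rewrite cD -sum_nat_const; apply: leq_sum => c /min.
Qed.

End Saturation.

(** * Permutations and torus limits of leading terms *)

Section Points.

Variables (k : closedFieldType) (n : nat) (x0 : 'I_n).
Implicit Types (g A : 'M[k]_n) (P : mpoint k n) (e : 'I_n -> nat).

Local Open Scope ring_scope.

Lemma gact_Qe_self e g A : (forall a b, g a b != 0 -> (e a <= e b)%N) ->
  Defs.gact g (Qe e A) = Qe e (lead e e g *m A *m (lead e e g)^T).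
Proof.
move=> H; apply: (gact_Qe x0) => //.
- by move=> I K sI sK IK; apply: (sat_wt sI sK).
- by move=> I; apply: sat_exists_card.
by move=> K; have [I cI sI] := sat_exists_card e K; exists I.
Qed.

Lemma wt_perm e (s : 'S_n) (I : {set 'I_n}) :
  wt (fun x => e (s x)) I = wt e [set s x | x in I].
Proof. by rewrite /wt big_imset //= => x y _ _; apply: perm_inj. Qed.

Lemma gact_Qe_perm e (s : 'S_n) A :
  Defs.gact (perm_mx s) (Qe e A) = Qe (fun x => e (s x)) (perm_mx s *m A *m (perm_mx s)^T).
Proof.
have supp a b : (perm_mx s : 'M[k]_n) a b != 0 -> b = s a.
  by rewrite !mxE; case: (s a =P b) => [-> //|_]; rewrite eqxx.
have leadE : lead (fun x => e (s x)) e (perm_mx s) = perm_mx s :> 'M[k]_n.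
  apply/matrixP => a b; rewrite mxE; case: eqP => // ne.
  by apply/esym/eqP; apply: contraT => /supp bE; case: ne; rewrite bE.
rewrite -{2 3}leadE; apply: (gact_Qe x0).
- by move=> a b /supp ->.
- move=> I K /sat_leP sI /sat_leP sK IK; apply/eqP; rewrite eqn_leq; apply/andP; split.
    have := sI [set (s^-1)%g x | x in K]; rewrite card_imset; last exact: perm_inj.
    rewrite IK => /(_ erefl); rewrite [X in (_ <= X)%N -> _]wt_perm -imset_comp.
    by rewrite (eq_imset (g := id)) ?imset_id // => x /=; rewrite permKV.
  rewrite wt_perm; apply: sK; rewrite card_imset //; exact: perm_inj.
- by move=> I; apply: sat_exists_card.
by move=> K; have [I cI sI] := sat_exists_card (fun x => e (s x)) K; exists I.
Qed.

Definition leadpt e P : mpoint k n :=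
  [ffun c => if sat e (cI c) && sat e (cJ c) then P c else 0].

(** [leadpt e P] is the limit of the torus translates of [P] as c tends to 0. Dividing the d-th
    component by c to twice the minimal weight of d-sets, once for rows and once for columns, makes
    the family polynomial in c with the limit as its value at 0. *)
Lemma leadpt_limit deg phi e P : mhom deg phi ->
  (forall c, c != 0 -> phi (Defs.gact (weightm e c) P) = 0) -> phi (leadpt e P) = 0.
Proof.
move=> hom van.
pose mn d := if [pick K : {set 'I_n} | (#|K| == d) && sat e K] is Some K
  then wt e K else 0%N.
have mnP d : (d <= n)%N ->
    exists2 K : {set 'I_n}, #|K| = d & sat e K /\ wt e K = mn d.
  move=> /(sat_exists e)[K cK sK]; rewrite /mn; case: pickP => [L /andP[/eqP cL sL]|].
    by exists L.
  by move/(_ K); rewrite cK eqxx sK.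
have mn_le (I : {set 'I_n}) : (#|I| <= n)%N -> (mn #|I| <= wt e I)%N.
  move=> /mnP[K cK [/sat_leP sK <-]]; exact: sK.
have mn_eq (I : {set 'I_n}) : (#|I| <= n)%N -> (wt e I == mn #|I|) = sat e I.
  move=> In; have [K cK [sK wK]] := mnP _ In.
  apply/eqP/idP => [wI|sI]; first by apply: (sat_trans sK) => //; rewrite wI wK.
  by rewrite -wK; apply: sat_wt.
pose kap d := (mn d + mn d)%N.
pose w (c : Defs.coord n) := (wt e (cI c) + wt e (cJ c))%N.
pose C (x y : Defs.coord n) : {poly k} := if x == y then 'X^(w x - kap (block x)) else 0.
have CE t : lfam C t P = [ffun x => t ^+ (w x - kap (block x)) * P x].
  apply/ffunP => x; rewrite !ffunE (bigD1 x) //= big1 ?addr0 => [|y /andP[_ yx]].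
    by rewrite /C eqxx hornerXn.
  by rewrite /C eq_sym (negPf yx) horner0 mul0r.
have [Psi _ E] := mhom_lfam C hom.
have [K HK] := mhom_scalept kap hom.
have bn (c : Defs.coord n) : (block c <= n)%N by have := block_bounds c; lia.
have mnI (c : Defs.coord n) : (mn (block c) <= wt e (cI c))%N by apply: mn_le; apply: bn.
have mnJ (c : Defs.coord n) : (mn (block c) <= wt e (cJ c))%N.
  by rewrite -card_cJ; apply: mn_le; rewrite card_cJ.
have Psi0 : Psi P = 0.
  apply: (poly_density (negbT (polyX_eq0 k))) => t; rewrite hornerX => t0.
  rewrite -E; apply/eqP; rewrite -(mulrI_eq0 _ (x := t ^+ K)); last first.
    by apply/lregP; rewrite expf_neq0.
  rewrite -HK -(van t t0); apply/eqP; congr phi; rewrite CE (gact_diagm x0).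
  apply/ffunP => c; rewrite !ffunE !prodrXr mulrA -!exprD; congr (_ ^+ _ * _).
  by have := mnI c; have := mnJ c; rewrite /kap /w /wt; lia.
have := E 0 P; rewrite Psi0 horner0 => <-; congr phi; rewrite CE.
apply/ffunP => c; rewrite !ffunE expr0n.
have -> : (w c - kap (block c) == 0)%N = sat e (cI c) && sat e (cJ c).
  rewrite -!mn_eq ?card_cJ ?card_cI //.
  by have := mnI c; have := mnJ c; rewrite /kap /w; lia.
by case: ifP; rewrite ?mul1r ?mul0r.
Qed.

End Points.

(** * The distinguished points *)

Section Conjugation.

Variables (k : closedFieldType) (n : nat).
Implicit Types (A : 'M[k]_n).

Local Open Scope ring_scope.

Lemma mul_transvT A (i j : 'I_n) c (x y : 'I_n) :
  (A *m (transv i j c)^T) x y = A x y + c * (y == i)%:R * A x j.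
Proof.
by rewrite -[A *m _]trmxK trmx_mul trmxK mxE transv_mul !mxE.
Qed.

Lemma conj_transv A (i j : 'I_n) c (x y : 'I_n) :
  (transv i j c *m A *m (transv i j c)^T) x y =
  A x y + c * (x == i)%:R * A j y + c * (y == i)%:R * A x j
    + c ^+ 2 * (x == i)%:R * (y == i)%:R * A j j.
Proof. by rewrite mul_transvT !transv_mul; ring. Qed.

Variables (l h : 'I_n).
Hypothesis lh : l != h.

Definition block2 (a b c d : k) : 'M[k]_n := \matrix_(x, y)
  if x == l then a * (y == l)%:R + b * (y == h)%:R
  else if x == h then c * (y == l)%:R + d * (y == h)%:R else (x == y)%:R.

Lemma block2_mul a b c d A x y : (block2 a b c d *m A) x y =
  if x == l then a * A l y + b * A h y
  else if x == h then c * A l y + d * A h y else A x y.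
Proof.
rewrite mxE; under eq_bigr => z _ do rewrite mxE.
have sum2 (u v : k) : \sum_z (u * (z == l)%:R + v * (z == h)%:R) * A z y =
    u * A l y + v * A h y.
  have hl : h != l by rewrite eq_sym.
  rewrite (bigD1 l) //= (bigD1 h) //= big1 ?addr0 => [|z /andP[zl zh]].
    by rewrite !eqxx (negPf lh) (negPf hl) !mulr1 !mulr0 addr0 add0r.
  by rewrite (negPf zl) (negPf zh) !mulr0 addr0 mul0r.
case: eqP => [_|_]; first exact: sum2.
case: eqP => [_|_]; first exact: sum2.
rewrite (bigD1 x) //= big1 ?addr0 => [|z zx]; first by rewrite eqxx mul1r.
by rewrite eq_sym (negPf zx) mul0r.
Qed.

Lemma mul_block2T a b c d A (x y : 'I_n) : (A *m (block2 a b c d)^T) x y =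
  if y == l then a * A x l + b * A x h
  else if y == h then c * A x l + d * A x h else A x y.
Proof.
by rewrite -[A *m _]trmxK trmx_mul trmxK mxE block2_mul !mxE.
Qed.

Lemma block2_parab a b c d : h = l.+1 :> nat -> parab l h (block2 a b c d).
Proof.
move=> lhS x y yx neq; rewrite mxE.
have [xl|xl] := eqVneq x l.
  have -> : (y == l) = false by apply/eqP => yl; move: yx; rewrite xl yl ltnn.
  have -> : (y == h) = false by apply/eqP => yh; move: yx; rewrite xl yh lhS; lia.
  by rewrite !mulr0 addr0.
have [xh|xh] := eqVneq x h.
  have -> : (y == l) = false by apply/eqP => yl; case: neq; rewrite xh yl.
  have -> : (y == h) = false by apply/eqP => yh; move: yx; rewrite xh yh ltnn.
  by rewrite !mulr0 addr0.
by case: eqP => // xy; rewrite xy ltnn in yx.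
Qed.

End Conjugation.

Section DegeneratePoints.

Variables (k : closedFieldType) (n : nat).
Implicit Types (p : seq (seq 'I_n)) (i : 'I_n.-1).

Local Open Scope ring_scope.

Lemma eq_Qe (e e' : 'I_n -> nat) (A B : 'M[k]_n) : e =1 e' -> A = B -> Qe e A = Qe e' B.
Proof.
move=> ee ->; apply/ffunP => c; rewrite !ffunE.
have W J : wt e J = wt e' J by apply: eq_bigr => a _; rewrite ee.
have S I : sat e I = sat e' I by apply: eq_forallb => K; rewrite !W.
by rewrite !S.
Qed.

(** Weights decrease along the strings, so that minimal weight favours the last strings, as
    [saturated] does. *)
Definition idx_wt p (x : 'I_n) : nat := (size p - string_index p x)%N.

Local Notation Q p := (Qpoint k p).
Local Notation gr p := (gram k p).

Section OnePoint.

Variables (mu : seq nat) (p : seq (seq 'I_n)).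
Hypothesis p_inv : muinv mu p.

Local Notation f := (string_index p).
Local Notation g := (deg_map p).
Local Notation e := (idx_wt p).
Local Notation G := (gram k p).

Let gK : involutive g. Proof. by case: (encode_good p_inv). Qed.
Let gI : injective g := inv_inj gK.
Let fg : forall x, f (g x) = f x. Proof. by case: (encode_good p_inv). Qed.
Let f_lt : forall x, (f x < size p)%N := string_index_lt p_inv.

Lemma idx_wt_le x y : (e x <= e y)%N = (f y <= f x)%N.
Proof. by rewrite /idx_wt; have := f_lt x; have := f_lt y; lia. Qed.

Lemma idx_wt_eq x y : (e x == e y) = (f x == f y).
Proof. by rewrite !eqn_leq !idx_wt_le andbC. Qed.

Lemma idx_wt_g x : e (g x) = e x.
Proof. by rewrite /idx_wt fg. Qed.

Lemma saturatedE I : saturated p I = sat e I.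
Proof. by rewrite /idx_wt (sat_saturated _ f_lt). Qed.

Lemma QpointE : Q p = Qe e G.
Proof. by apply/ffunP => c; rewrite !ffunE !saturatedE. Qed.

Definition gram_coef x : k := if g x == x then 1 else 2%:R^-1.

Hypothesis char_k : 2%:R != 0 :> k.

Lemma gram_coef_neq0 x : gram_coef x != 0.
Proof. by rewrite /gram_coef; case: ifP => _; rewrite ?oner_neq0 // invr_neq0. Qed.

Lemma gram_coef_g x : gram_coef (g x) = gram_coef x.
Proof. by rewrite /gram_coef gK eq_sym. Qed.

Lemma gramE x y : G x y = gram_coef x * (g x == y)%:R.
Proof.
rewrite mxE /gram_coef; have [<-|] := eqVneq (g x) y; last by rewrite mulr0.
by rewrite mulr1 eq_sym.
Qed.

Lemma gram_sym x y : G x y = G y x.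
Proof.
rewrite !gramE; have [<-|ne] := eqVneq (g x) y; first by rewrite gK eqxx gram_coef_g.
have -> : (g y == x) = false by apply: contraNF ne => /eqP <-; rewrite gK.
by rewrite !mulr0.
Qed.

Lemma gram_trmx : G^T = G.
Proof. by apply/matrixP => x y; rewrite mxE gram_sym. Qed.

Lemma gram_supp x y : G x y != 0 -> y = g x.
Proof. by rewrite gramE; case: (g x =P y) => [->|_] //; rewrite mulr0 eqxx. Qed.

Lemma gram_sq : G *m G = diagm (fun x => gram_coef x ^+ 2).
Proof.
apply/matrixP => x y; rewrite !mxE (bigD1 (g x)) //= big1 ?addr0 => [|z zx].
  by rewrite !gramE eqxx mulr1 gram_coef_g gK; case: eqP => _; rewrite ?mulr1 ?mulr0.
by rewrite gramE eq_sym (negPf zx) mulr0 mul0r.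
Qed.

Lemma gram_unit : G \in unitmx.
Proof.
have: G *m (G *m diagm (fun x => (gram_coef x ^+ 2)^-1)) = 1%:M.
  rewrite mulmxA gram_sq diagmM -diagm1; apply/matrixP => x y; rewrite !mxE.
  by rewrite divff // expf_neq0 // gram_coef_neq0.
by case/mulmx1_unit.
Qed.

Lemma Qpoint_support (c : Defs.coord n) : Q p c != 0 ->
  [/\ sat e (cI c), sat e (cJ c) & cJ c = [set g x | x in cI c]].
Proof.
rewrite QpointE ffunE; case: ifP => [/andP[sI sJ]|]; last by rewrite eqxx.
have xI : exists x, x \in cI c.
  by apply/card_gt0P; have := block_bounds c => /andP[].
case: xI => x _.
rewrite (minorEc x G (erefl _)) => nz; split=> //.
by apply: (set_minor_graph (x0 := x) (d := block c)) nz; rewrite ?card_cJ // => a b /gram_supp.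
Qed.

Lemma wt_imset_g (e' : 'I_n -> nat) (I : {set 'I_n}) :
  wt e' [set g x | x in I] = wt (fun x => e' (g x)) I.
Proof. by rewrite /wt big_imset //= => x y _ _; apply: gI. Qed.

(** The nonzero coordinates have row set I saturated and column set g I, so the torus acts on them
    through the weights of I and of g I. *)
Lemma Qpoint_weight (x0 : 'I_n) (e' : 'I_n -> nat) kap :
  (forall I : {set 'I_n}, sat e I -> (wt e' I + wt (fun x => e' (g x)) I)%N = kap #|I|) ->
  forall c, Defs.gact (weightm e' c) (Q p) = scalept kap c (Q p).
Proof.
move=> H c; rewrite (gact_diagm x0); move: (Q p) Qpoint_support => q supp.
apply/ffunP => x; rewrite !ffunE.
have [->|/supp[sI sJ eJ]] := eqVneq (q x) 0; first by rewrite !mulr0.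
by rewrite !prodrXr -exprD -/(wt _ _) -/(wt _ _) eJ wt_imset_g H.
Qed.

(** For K saturated, Cauchy-Binet expands the (K, K) minor of [G *m G] into a single term, L = g K.
    Since the square is diagonal and invertible, the minor of [G] at (K, g K) is nonzero. *)
Lemma is_mpoint_Qpoint : is_mpoint (Q p).
Proof.
move=> d /andP[d0 dn].
have [K cK sK] := sat_exists e (ltnW dn).
have cgK : #|[set g x | x in K]| = d by rewrite card_imset.
have sgK : sat e [set g x | x in K].
  apply: (sat_trans sK); first by rewrite cgK cK.
  by rewrite wt_imset_g /wt; apply: leq_sum => x _; rewrite idx_wt_g.
have cP : (#|K| == #|[set g x | x in K]|) && (0 < #|K| < n)%N.
  by rewrite cgK cK eqxx d0 dn.
exists (exist _ (K, [set g x | x in K]) cP); first by rewrite /block /cI.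
rewrite QpointE ffunE /cI /cJ /= sK sgK /=.
have x0 : 'I_n by case: (n) dn => // m _; exact: ord0.
rewrite (minorE x0) ?cgK //.
have := set_minor_mul x0 #|K| G G K K; rewrite gram_sq set_minor_diag // eqxx => E.
apply: contraTneq (isT) => z.
have : \prod_(a in K) gram_coef a ^+ 2 = 0 :> k.
  rewrite E big1 // => L /eqP cL.
  have [->|nz] := eqVneq (set_minor x0 #|K| G K L) 0; first by rewrite mul0r.
  have eL : L = [set g x | x in K].
    by apply: (set_minor_graph (x0 := x0) (d := #|K|)) nz => // a b /gram_supp.
  by rewrite eL z mul0r.
by move/eqP; rewrite prodf_seq_eq0 => /hasP[a _ /andP[_]]; rewrite expf_eq0 (negPf (gram_coef_neq0 a)).
Qed.

End OnePoint.

End DegeneratePoints.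

(** * Minimal parabolic subgroups acting on the distinguished points *)

Section Steps.

Variables (k : closedFieldType) (n : nat).
Hypothesis char_k : (2%:R != 0 :> k)%R.
Implicit Types (p : seq (seq 'I_n)) (i : 'I_n.-1).

Local Open Scope ring_scope.

Variables (mu : seq nat) (p : seq (seq 'I_n)) (i : 'I_n.-1).
Hypothesis p_inv : muinv mu p.

Local Notation f := (string_index p).
Local Notation g := (deg_map p).
Local Notation e := (idx_wt p).
Local Notation G := (gram k p).
Local Notation gamma := (gram_coef k p).
Local Notation l := (lo i).
Local Notation h := (hi i).

Let gK : involutive g. Proof. by case: (encode_good p_inv). Qed.
Let gI : injective g := inv_inj gK.
Let fg : forall x, f (g x) = f x. Proof. by case: (encode_good p_inv). Qed.
Let lh : l != h := lo_hi i.
Let hl : h != l. Proof. by rewrite eq_sym lo_hi. Qed.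
Let two : 2%:R^-1 + 2%:R^-1 = 1 :> k.
Proof. by field. Qed.

Lemma Qpoint_flag (M : 'M[k]_n) : (forall x y, M x y != 0 -> f x = f y) ->
  Defs.gact M (Qpoint k p) = Qe e (M *m G *m M^T).
Proof.
move=> H; have eE x y : M x y != 0 -> e x = e y by move=> /H; rewrite /idx_wt => ->.
have leadE : lead e e M = M.
  apply/matrixP => x y; rewrite mxE; case: eqP => // ne.
  by apply/esym/eqP; apply: contraT => /eE.
rewrite (QpointE k p_inv) -{2 3}leadE; apply: (gact_Qe_self l).
by move=> x y /eE ->.
Qed.

(** With u^2 = -1, the rows (1, 1) and (u, -u) form an orthonormal basis for the form x_l x_h, which
    becomes a sum of two squares. *)
Lemma gram_step_cross : g l = h -> f l = f h -> low i p ->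
  exists M M' : 'M[k]_n, [/\ parab l h M, parab l h M', M *m M' = 1%:M &
    Defs.gact M (Qpoint k p) = Qpoint k (Defs.mact i p)].
Proof.
move=> gl fe lw; have gh : g h = l by rewrite -gl gK.
have [u u2] : exists u : k, u ^+ 2 = -1 by apply: closed_nthroot.
pose M := block2 l h 1 1 u (- u); pose a : k := 2%:R^-1.
pose M' := block2 l h a (- u * a) a (u * a).
have hlS : h = l.+1 :> nat := hi_val i.
exists M, M'; split; [exact: block2_parab|exact: block2_parab| |].
  apply/matrixP => x y; rewrite block2_mul // !mxE !eqxx (negPf hl).
  have [->|xl] := eqVneq x l.
    rewrite [l == y]eq_sym; case: eqP => _; case: eqP => _; rewrite ?mulr0 ?mulr1 /a /=; by [ring | field].
  have [->|xh] := eqVneq x h.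
    have E : u * (- u * a) + - u * (u * a) = 1.
      transitivity (- (u ^+ 2) * (a + a)); first by ring.
      by rewrite u2 opprK mul1r two.
    rewrite [h == y]eq_sym; have [->|yl] := eqVneq y l.
      by rewrite (negPf lh) !mulr1 !mulr0 !addr0 /=; ring.
    have [_|yh] := eqVneq y h; last by rewrite !mulr0 !addr0 !mulr0 addr0.
    by rewrite !mulr0 !mulr1 !add0r E.
  by rewrite ?(negPf xl) ?(negPf xh).
rewrite Qpoint_flag => [|x y]; last first.
  rewrite mxE; case: (x =P l) => [->|_]; [|case: (x =P h) => [->|_]].
  - case: (y =P l) => [-> //|_]; case: (y =P h) => [->|_]; first by rewrite fe.
    by rewrite !mulr0 addr0 eqxx.
  - case: (y =P l) => [->|_]; first by rewrite fe.
    case: (y =P h) => [-> //|_].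
    by rewrite !mulr0 addr0 eqxx.
  by case: (x =P y) => [-> //|_]; rewrite eqxx.
have mI := muinv_mact p_inv i.
rewrite (QpointE k mI); apply: eq_Qe => [x|].
  rewrite /idx_wt (muinv_size mI) (muinv_size p_inv) (string_index_mact p_inv lw).
  by rewrite f_sref.
have gx x : deg_map (Defs.mact i p) x = sref i (g x).
  by rewrite (deg_map_mact p_inv lw) /stepg gl eqxx.
have Gll : G l l = 0 by rewrite gramE // gl (negPf hl) mulr0.
have Ghh : G h h = 0 by rewrite gramE // gh (negPf lh) mulr0.
have Glh : G l h = a by rewrite gramE // gl eqxx mulr1 /gamma gl (negPf hl).
have Ghl : G h l = a by rewrite (gram_sym k p_inv).
apply/matrixP => x y; rewrite mul_block2T // !block2_mul // !gramE /gram_coef !gx.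
have other z : z != l -> z != h -> sref i (g z) = g z /\ (g z == l = false) /\ (g z == h = false).
  move=> zl zh; have z1 : g z != l by rewrite -gh (inj_eq gI).
  have z2 : g z != h by rewrite -gl (inj_eq gI).
  by rewrite (sref_fix z1 z2) (negPf z1) (negPf z2).
have Gzl z : z != l -> z != h -> (G z l = 0) * (G z h = 0).
  by move=> zl zh; rewrite !gramE //; have [_ [-> ->]] := other z zl zh; rewrite !mulr0.
have Glz z : z != l -> z != h -> (G l z = 0) * (G h z = 0).
  by move=> zl zh; rewrite !(gram_sym k p_inv _ z) !Gzl.
have [xl|xl] := eqVneq x l; [|have [xh|xh] := eqVneq x h];
  (have [yl|yl] := eqVneq y l; [|have [yh|yh] := eqVneq y h]);
  rewrite ?xl ?xh ?yl ?yh ?Gll ?Ghh ?Glh ?Ghl ?Gzl ?Glz // ?gl ?gh ?sref_lo ?sref_hi ?eqxx ?(negPf lh) ?(negPf hl);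
  rewrite ?mulr0 ?mulr1 ?addr0 ?add0r ?two //.
- by field.
- by ring.
- by rewrite ![_ == y]eq_sym (negPf yl) (negPf yh) !mulr0 addr0.
- by ring.
- transitivity (- (u ^+ 2) * (2%:R^-1 + 2%:R^-1)); first by ring.
  by rewrite u2 opprK mul1r two.
- by rewrite ![_ == y]eq_sym (negPf yl) (negPf yh) !mulr0 addr0.
- by have [-> [-> ->]] := other x xl xh; rewrite !mulr0 addr0.
- by have [-> [-> ->]] := other x xl xh; rewrite !mulr0 addr0.
by have [-> _] := other x xl xh.
Qed.

Lemma gact_sref (p' : seq (seq 'I_n)) : muinv mu p' ->
  (forall x, string_index p' x = f (sref i x)) ->
  (forall x, deg_map p' x = sref i (g (sref i x))) ->
  Defs.gact (tperm_mx l h) (Qpoint k p) = Qpoint k p'.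
Proof.
move=> pI' fE gE; rewrite (QpointE k p_inv) (QpointE k pI') (gact_Qe_perm l).
apply: eq_Qe => [x|]; first by rewrite /idx_wt fE (muinv_size pI') (muinv_size p_inv).
apply/matrixP => x y; rewrite tr_perm_mx -row_permE -col_permE !mxE gE.
rewrite -/(sref i) (inj_eq (inv_inj (srefK i))).
by rewrite -(inj_eq (inv_inj (srefK i)) (g _)) srefK.
Qed.

(* A one-parameter subgroup of the torus that fixes the point and on which the
   root attached to i is not trivial; it exists unless i and i+1 are two fixed
   points of the same string. *)
Lemma torus_weight : low i p -> exists e' kap, e' l <> e' h /\
  forall c, Defs.gact (weightm e' c) (Qpoint k p) = scalept kap c (Qpoint k p).
Proof.
move=> lw; have [fe|fne] := eqVneq (f l) (f h); last first.
  pose kap d := (if [pick K : {set 'I_n} | (#|K| == d) && sat e K] is Some K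
    then wt e K else 0%N).*2.
  exists e, kap; split; first by apply/eqP; rewrite (idx_wt_eq p_inv).
  apply: (Qpoint_weight p_inv l) => I sI; rewrite /kap.
  have -> : wt (fun x => e (g x)) I = wt e I.
    by apply: eq_bigr => x _; rewrite (idx_wt_g p_inv).
  case: pickP => [K /andP[/eqP cK sK]|/(_ I)]; last by rewrite eqxx sI.
  by rewrite addnn (sat_wt sI sK).
(* z is a letter among l and h moved by g. Exponent 2 at z, 0 at g z and 1 elsewhere makes the
   exponents of x and g x always add up to 2, while l and h get different ones. *)
have [z [zg e'lh]] : exists z, g z <> z /\
   (if l == z then 2 else if l == g z then 0 else 1)%N <>
   (if h == z then 2 else if h == g z then 0 else 1)%N.
  move: lw; rewrite /low /lowfg fe ltnn eqxx /= => lt.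
  have [gl|gl] := eqVneq (g l) l.
    exists h; have gh : g h != h by apply: contraTneq lt => ->; rewrite gl hi_loF.
    split; first by apply/eqP.
    rewrite (negPf lh) eqxx.
    have -> : (l == g h) = false by rewrite -gl (inj_eq gI) (negPf lh).
    by [].
  exists l; split; first by apply/eqP.
  rewrite eqxx (negPf hl); by case: ifP.
pose e' x := (if x == z then 2 else if x == g z then 0 else 1)%N.
exists e', (fun d => 2 * d)%N; split=> //.
apply: (Qpoint_weight p_inv l) => I _.
rewrite mulnC -sum_nat_const /wt -big_split; apply: eq_bigr => x _ /=.
rewrite /e' (inj_eq gI) (inv_eq gK).
have [->|xz] := eqVneq x z.
  by case: eqP => // zz; case: zg.
by case: eqP.
Qed.

Lemma gamma_gx x : gamma (g x) = gamma x.
Proof. by rewrite /gram_coef gK eq_sym. Qed.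

Lemma transv_supp (t : k) (x y a b : 'I_n) :
  transv x y t a b != 0 -> a = b \/ (a = x /\ b = y).
Proof.
rewrite !mxE; have [->|ab] := eqVneq a b; first by left.
have [->|_] := eqVneq a x; last by rewrite /= mulr0 addr0 eqxx.
have [->|_] := eqVneq b y; last by rewrite /= mulr0 addr0 eqxx.
by right.
Qed.

Lemma transv_flag (t : k) (x y : 'I_n) : f x = f y ->
  forall a b, transv x y t a b != 0 -> f a = f b.
Proof. by move=> fxy a b /transv_supp[->|[-> ->]]. Qed.

(** At a non-descent, the change that the lower root subgroup makes to the Gram matrix can also be
    made by an upper triangular matrix, for generic t when both letters are fixed points. *)
Lemma root_orbit : ~~ low i p -> exists s, forall t, 1 + s * t ^+ 2 != 0 ->
  exists2 b, upper b /\ b \in unitmx &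
    Defs.gact (transv h l t) (Qpoint k p) = Defs.gact b (Qpoint k p).
Proof.
rewrite /low /lowfg negb_or -leqNgt leq_eqVlt => /andP[/orP[/eqP fe|flt] nlt]; last first.
  (* In different strings, the off-diagonal entry strictly changes the weight, so the leading part
     of y(t) is the identity. *)
  exists 0 => t _; exists 1%:M; first by split; [exact: upper1|exact: unitmx1].
  rewrite (QpointE k p_inv) (gact_id l) (gact_Qe_self l) => [|x y]; last first.
    by case/transv_supp => [->|[-> ->]] //; rewrite (idx_wt_le p_inv) (ltnW flt).
  have -> : lead e e (transv h l t) = 1%:M.
    apply/matrixP => x y; rewrite [LHS]mxE [RHS]mxE.
    have [->|xy] := eqVneq x y.
      rewrite eqxx !mxE eqxx; case: eqP => [->|]; last by rewrite mulr0 addr0.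
      by rewrite (negPf hl) mulr0 addr0.
    case: eqP => // exy; apply/eqP; apply: contraT => /transv_supp[e1|[e1 e2]].
      by rewrite e1 eqxx in xy.
    move/eqP: exy; rewrite (idx_wt_eq p_inv) e1 e2 => /eqP E.
    by rewrite E ltnn in flt.
  by rewrite mul1mx trmx1 mulmx1.
move: nlt; rewrite fe eqxx /= -leqNgt leq_eqVlt => /orP[/eqP/val_inj/gI/eqP|lt].
  by rewrite (negPf lh).
have Qtv t : Defs.gact (transv h l t) (Qpoint k p) = Qe e (transv h l t *m G *m (transv h l t)^T).
  by apply: Qpoint_flag; apply: transv_flag.
have [/andP[/eqP gl /eqP gh]|nf] := boolP ((g l == l) && (g h == h)).
  exists 1 => t; rewrite mul1r => t1.
  (* On two fixed points the Gram matrix becomes y(t) y(t)^T, factored as b b^T with b upper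
     triangular; its corner entry is c, with c^2 = 1 + t^2. *)
  have [c c2] : exists c : k, c ^+ 2 = 1 + t ^+ 2 by apply: closed_nthroot.
  have c0 : c != 0 by apply: contraNneq t1 => c0; rewrite -c2 c0 expr0n.
  pose b := block2 l h (c^-1) (t / c) 0 c.
  have bU : b \in unitmx.
    have: b *m block2 l h c (- (t / c)) 0 c^-1 = 1%:M.
      apply/matrixP => x y; rewrite block2_mul // !mxE !eqxx (negPf hl).
      have [->|xl] := eqVneq x l.
        rewrite ![l == y]eq_sym; case: (y == l); case: (y == h); by [field|rewrite /=; field].
      have [->|xh] := eqVneq x h => //.
      rewrite ![h == y]eq_sym; case: (y == l); case: (y == h); by [field|rewrite /=; field].
    by case/mulmx1_unit.
  exists b; first split=> //.
    apply: (parab_upper (l := l) (h := h)); first exact: block2_parab (hi_val i).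
    by rewrite mxE (negPf hl) !eqxx (negPf lh) mul0r mulr0 addr0.
  rewrite Qtv Qpoint_flag => [|x y]; last first.
    rewrite mxE; case: (x =P l) => [->|_]; [|case: (x =P h) => [->|_]].
    - case: (y =P l) => [-> //|_]; case: (y =P h) => [-> //|_].
      by rewrite !mulr0 addr0 eqxx.
    - case: (y =P l) => [-> //|_].
      case: (y =P h) => [-> //|_].
      by rewrite !mulr0 addr0 eqxx.
    by case: (x =P y) => [-> //|_]; rewrite eqxx.
  congr Qe; apply/matrixP => x y; rewrite conj_transv mul_block2T // !block2_mul //.
  have Gl z : G l z = (z == l)%:R by rewrite gramE /gram_coef gl eqxx mul1r eq_sym.
  have Gh z : G h z = (z == h)%:R by rewrite gramE /gram_coef gh eqxx mul1r eq_sym.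
  have Gl' z : G z l = (z == l)%:R by rewrite (gram_sym k p_inv).
  have Gh' z : G z h = (z == h)%:R by rewrite (gram_sym k p_inv).
  have ct : c^-1 * c^-1 * (1 + t ^+ 2) = 1 by rewrite -c2; field.
  have [->|xl] := eqVneq x l; [|have [->|xh] := eqVneq x h];
    (have [->|yl] := eqVneq y l; [|have [->|yh] := eqVneq y h]);
    rewrite ?Gl ?Gh ?Gl' ?Gh' ?eqxx ?(negPf lh) ?(negPf hl) ?(negPf xl) ?(negPf xh)
      ?(negPf yl) ?(negPf yh) /=.
  all: try by [ring|field].
    transitivity (c^-1 * c^-1 * (1 + t ^+ 2)); first by rewrite ct; ring.
    by field.
  transitivity (c ^+ 2); first by rewrite c2; ring.
  by ring.
have nc : g l != h.
  apply: contraTneq lt => gl; have gh : g h = l by rewrite -gl gK.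
  by rewrite gl gh hi_loF.
exists 0 => t _; rewrite Qtv.
have ga0 : gamma l != 0 by apply: gram_coef_neq0.
have gb0 : gamma h != 0 by apply: gram_coef_neq0.
have GlE z : G l z = gamma l * (z == g l)%:R by rewrite gramE eq_sym.
have GlE' z : G z l = gamma l * (z == g l)%:R by rewrite (gram_sym k p_inv).
have Ggh z : G (g h) z = gamma h * (z == h)%:R by rewrite gramE gK gamma_gx eq_sym.
have Ggh' z : G z (g h) = gamma h * (z == h)%:R by rewrite (gram_sym k p_inv).
have ab : (g l < g h)%N by [].
have abn : g l != g h by rewrite (inj_eq gI).
have conj2 (T1 T2 : 'M[k]_n) : T1 *m T2 *m G *m (T1 *m T2)^T = T1 *m (T2 *m G *m T2^T) *m T1^T.
  by rewrite trmx_mul !mulmxA.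
have fa : f (g l) = f (g h) by rewrite !fg.
have [gh|ngh] := eqVneq (g h) h.
  have gl : g l != l by apply: contraNneq nf => ->; rewrite gh !eqxx.
  have al : (g l < l)%N.
    move: ab gl; rewrite gh hi_val ltnS leq_eqVlt => /orP[/eqP/val_inj ->|//].
    by rewrite eqxx.
  (* [C] reproduces the new entries t gamma_l at (h, g l) and (g l, h), creating C^2 at (g l, g l);
     [c] cancels the latter through the pairing of l with g l. *)
  pose C := t * gamma l; pose c := - C ^+ 2 / (2%:R * gamma l).
  exists (transv (g l) h C *m transv (g l) l c).
    split; last by rewrite unitmx_mul !transv_unit.
    by apply: upper_mul; apply: upper_transv => //; rewrite -gh.
  rewrite Qpoint_flag; last first.
    move=> x y; rewrite mxE => nz.
    have [z zP] : exists z, transv (g l) h C x z * transv (g l) l c z y != 0.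
      apply/existsP; apply: contraNT nz; rewrite negb_exists => /forallP H.
      by rewrite big1 // => z _; apply/eqP; rewrite -[_ == _]negbK H.
    move: zP; rewrite mulf_eq0 negb_or => /andP[n1 n2].
    transitivity (f z); first by apply: transv_flag n1; rewrite fg fe.
    by apply: transv_flag n2; rewrite fg.
  congr Qe; rewrite conj2; apply/matrixP => x y; rewrite !conj_transv.
  have Gh z : G h z = (z == h)%:R by rewrite gramE /gram_coef gh eqxx mul1r eq_sym.
  have Gh' z : G z h = (z == h)%:R by rewrite (gram_sym k p_inv).
  have ha : (h == g l) = false by rewrite eq_sym (negPf nc).
  rewrite !GlE !GlE' !Gh !Gh' ha eqxx [l == g l]eq_sym (negPf gl) /=.
  by rewrite /c /C; field; rewrite ga0 char_k.
(* [C] again produces the entries at (g l, h) and (h, g l), now through the pairing of h with g h.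
   [c] produces the new diagonal entry at h, which is nonzero only if t is and l is fixed. *)
pose C := t * gamma l / gamma h; pose c := t ^+ 2 * G l l / (2%:R * gamma h).
have ngb : g h != l by apply: contraNneq nc => <-; rewrite gK.
have uh : upper (transv h (g h) c).
  have [gl|gl] := eqVneq (g l) l.
    apply: upper_transv; rewrite ltn_neqAle -ord_eqE eq_sym ngh hi_val.
    by move: ab; rewrite gl.
  by rewrite /c GlE eq_sym (negPf gl) !mulr0 mul0r transv0; apply: upper1.
exists (transv (g l) (g h) C *m transv h (g h) c).
  split; last by rewrite unitmx_mul !transv_unit // eq_sym.
  by apply: upper_mul => //; apply: upper_transv.
rewrite Qpoint_flag; last first.
  move=> x y; rewrite mxE => nz.
  have [z zP] : exists z, transv (g l) (g h) C x z * transv h (g h) c z y != 0.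
    apply/existsP; apply: contraNT nz; rewrite negb_exists => /forallP H.
    by rewrite big1 // => z _; apply/eqP; rewrite -[_ == _]negbK H.
  move: zP; rewrite mulf_eq0 negb_or => /andP[n1 n2].
  transitivity (f z); first exact: transv_flag n1.
  by apply: transv_flag n2; rewrite fg.
congr Qe; rewrite conj2; apply/matrixP => x y; rewrite !conj_transv.
rewrite /c /C !Ggh !Ggh' !GlE !GlE' (negPf ngh) /=.
by field; rewrite gb0 char_k.
Qed.

End Steps.

(** * The Bruhat order *)

Section Bruhat.

Variables (k : closedFieldType) (n : nat).
Hypothesis char_k : (2%:R != 0 :> k)%R.
Hypothesis n_ge2 : 2 <= n.
Implicit Types (p r : seq (seq 'I_n)) (i : 'I_n.-1) (mu nu : seq nat).

Local Open Scope ring_scope.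

Local Notation Q p := (Qpoint k p).
Local Notation mact := (@Defs.mact n).

(** The element of P_i is the identity if p is not low, the change of basis of [gram_step_cross] on
    the two-cycle (i, i+1), and the permutation matrix of s_i otherwise. *)
Lemma Qpoint_mact mu p i : muinv mu p -> exists M M' : 'M[k]_n,
  [/\ parab (lo i) (hi i) M, parab (lo i) (hi i) M', M *m M' = 1%:M &
    Defs.gact M (Q p) = Q (mact i p)].
Proof.
move=> pI; have P1 : parab (lo i) (hi i) (1%:M : 'M[k]_n) by apply/upper_parab/upper1.
have [lw|up] := boolP (low i p); last first.
  by exists 1%:M, 1%:M; rewrite mulmx1 (mact_up pI up) (gact_id (lo i)).
have [_ gK fg] := encode_good pI.
have [cr|nc] := eqVneq (deg_map p (lo i)) (hi i).
  by apply: (gram_step_cross char_k pI cr) => //; rewrite -cr fg.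
have PT : parab (lo i) (hi i) (tperm_mx (lo i) (hi i) : 'M[k]_n).
  move=> x y yx neq; rewrite !mxE.
  case: tpermP => [xl|xh|/eqP xl /eqP xh].
  - case: eqP => // yh; move: yx; rewrite -yh xl hi_val; lia.
  - by case: eqP => // yl; case: neq; rewrite xh yl.
  by case: eqP => // xy; rewrite xy ltnn in yx.
exists (tperm_mx (lo i) (hi i)), (tperm_mx (lo i) (hi i)); rewrite tperm_mxK; split=> //.
apply: (gact_sref k pI (muinv_mact pI i)) => x; first exact: (string_index_mact pI lw).
by rewrite (deg_map_mact pI lw) /stepg (negPf nc).
Qed.

(** The P_i-orbits of both points coincide, and [s_i . r] is not low, so that P_i maps its point
    generically into its own B-orbit by [root_orbit]. *)
Lemma parab_Qpoint mu r i deg (phi : mpoint k n -> k) (M : 'M[k]_n) :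
  muinv mu r -> mhom deg phi -> bvan (Q (mact i r)) phi ->
  parab (lo i) (hi i) M -> M \in unitmx -> phi (Defs.gact M (Q r)) = 0.
Proof.
move=> rI hom van pM MU; have rI' := muinv_mact rI i.
have [s Hs] := root_orbit char_k rI' (low_mact i rI).
have pv := pvan_generic (hi_val i) hom van Hs.
have [M1 [M2 [p1 p2 e12 E]]] := Qpoint_mact i rI.
have e21 : M2 *m M1 = 1%:M by apply: mulmx1C.
rewrite -[M]mulmx1 -e21 mulmxA (gact_mul (lo i)) E; apply: pv.
  exact: (parab_mul (hi_val i) pM p2).
by rewrite unitmx_mul MU; case/mulmx1_unit: e21.
Qed.

Definition qle p r := le_pt (Q p) (Q r).

Lemma qle_up mu p i : muinv mu p -> qle p (mact i p).
Proof.
move=> pI deg phi hom van; rewrite -(gact_id (lo i) (Q p)).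
apply: (parab_Qpoint pI hom van); last exact: unitmx1.
exact/upper_parab/upper1.
Qed.

Lemma qle_mono mu nu p r i : muinv mu p -> muinv nu r -> qle p r ->
  qle (mact i p) (mact i r).
Proof.
move=> pI rI pr deg phi hom van.
have [M [M' [pM pM' e <-]]] := Qpoint_mact i pI.
have MU : M \in unitmx by case/mulmx1_unit: e.
apply: (pr deg (fun P => phi (Defs.gact M P))); first exact: (mhom_gact (lo i)).
move=> b [db ub]; rewrite -(gact_mul (lo i)); apply: (parab_Qpoint rI hom van).
  by apply: (parab_mul (hi_val i) pM); apply: upper_parab.
by rewrite unitmx_mul MU unitmxE db unitr1.
Qed.

Lemma qle_lift mu nu p r i : muinv mu p -> muinv nu r -> low i p ->
  qle p (mact i r) -> qle p r.
Proof.
move=> pI rI lw pr.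
have [e' [kap [ne Hw]]] := torus_weight k pI lw.
apply: (lift_pt (hi_val i) ne (kap := kap)) => [c _||deg F homF pv].
- exact: Hw.
(* The permutation matrix sends Q_p to Q_p itself on the two-cycle (i, i+1), and to the point of
   [s_i . p] otherwise. *)
- have [_ gK fg] := encode_good pI.
  have [cr|nc] := eqVneq (deg_map p (lo i)) (hi i).
    rewrite (gact_sref k pI pI) => [|x|x]; first exact: le_pt_refl (lo i) _.
      by rewrite f_sref // -cr fg.
    by rewrite (stepg_cross gK) // cr.
  rewrite (gact_sref k pI (muinv_mact pI i)) => [|x|x]; first exact: qle_up pI.
    exact: (string_index_mact pI lw).
  by rewrite (deg_map_mact pI lw) /stepg (negPf nc).
apply: (pr deg F homF) => b [db ub].
have [M [M' [pM pM' e <-]]] := Qpoint_mact i rI.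
have bU : b \in unitmx by rewrite unitmxE db unitr1.
rewrite -(gact_mul (lo i)); apply: (pv _ (M' *m invmx b)).
- by apply: (parab_mul (hi_val i) _ pM); apply: upper_parab.
- by apply: (parab_mul (hi_val i) pM'); apply/upper_parab/upper_inv.
by rewrite mulmxA -(mulmxA b) e mulmx1 mulmxV.
Qed.

Let x0 : 'I_n := Ordinal (ltnW n_ge2).

(** The point is a torus limit of the tuple of minors of the nonsingular matrix [gram k p]. *)
Lemma complete_Qpoint mu p : muinv mu p -> complete_quadric (Q p).
Proof.
move=> pI; apply/zariskiP; split; first exact: (is_mpoint_Qpoint pI char_k).
move=> deg phi hom van.
pose P : mpoint k n := [ffun c => minor (gram k p) (cI c) (cJ c)].
have -> : Q p = leadpt (idx_wt p) P.
  by apply/ffunP => c; rewrite (QpointE k pI) !ffunE.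
apply: (leadpt_limit x0 hom) => c c0; apply: van.
pose D : 'M[k]_n := weightm (idx_wt p) c.
exists (D *m gram k p *m D^T); split.
- by rewrite !trmx_mul trmxK (gram_trmx k pI) mulmxA.
- have DU : D \in unitmx by apply: weightm_unit.
  by rewrite !unitmx_mul unitmx_tr DU (gram_unit pI char_k).
apply/ffunP => d; rewrite [RHS]ffunE (minorEc x0 _ (erefl _)) (gactE x0).
rewrite set_minor_mul; under [RHS]eq_bigr => L _ do rewrite set_minor_mul big_distrl /=.
rewrite exchange_big /= -(sum_coord (fun K L => set_minor x0 (block d) D (cI d) K *
  set_minor x0 (block d) (gram k p) K L * set_minor x0 (block d) D^T L (cJ d)) (block_bounds d)).
apply: eq_bigr => c' /eqP cd; rewrite set_minor_tr ffunE.
by rewrite (minorEc x0 _ (erefl _)) cd.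
Qed.

(** Orbit closures are B-stable and [Qpoint p] lies in its own, so inclusion can be tested at this
    single point. *)
Lemma bruhat_leP mu nu p r : muinv mu p -> muinv nu r -> bruhat_le k p r <-> qle p r.
Proof.
move=> pI rI; split=> [le deg phi hom van|le P [cP /zariskiP[mP H]]].
  have [|_ /zariskiP[_ H]] := le (Q p).
    split; first exact: complete_Qpoint pI.
    apply/zariskiP; split; first exact: (is_mpoint_Qpoint pI char_k).
    move=> deg' psi _; apply; exists 1%:M; first exact: borel1.
    by rewrite (gact_id x0).
  by apply: H hom _ => P [b bb ->]; apply: van.
split=> //; apply/zariskiP; split=> // deg phi hom van.
apply: (H deg phi hom) => P' [b bb ->].
apply: (bvan_le x0 le hom) bb => c cb; apply: van; by exists c.
Qed.

(** * Comparison with the maximal elements *)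

Definition upset (y : 'I_n) : {set 'I_n} := [set x : 'I_n | (y <= x)%N].

Lemma upset_coordP (y : 'I_n) (I J : {set 'I_n}) : (0 < y)%N ->
  #|I| = (n - y)%N -> #|J| = (n - y)%N -> (#|I| == #|J|) && (0 < #|I| < n)%N.
Proof. by move=> y0 -> ->; rewrite eqxx /=; have := ltn_ord y; lia. Qed.

Lemma card_upset (y : 'I_n) : #|upset y| = (n - y)%N.
Proof. exact: card_geq. Qed.

(** Upper triangular matrices move indices upwards only, and a final segment has nowhere to go.
    Hence the coordinates at final segments are semi-invariants of B. *)
Lemma upper_upset (b : 'M[k]_n) (y : 'I_n) (K : {set 'I_n}) : upper b ->
  #|K| = (n - y)%N -> set_minor x0 (n - y) b (upset y) K != 0 -> K = upset y.
Proof.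
move=> ub cK nz; apply/eqP; rewrite eqEcard card_upset cK leqnn andbT.
have supp (a c : 'I_n) : b a c != 0 -> ((y <= a)%N <= (y <= c)%N)%N.
  move=> bac; have ac : (a <= c)%N.
    by rewrite leqNgt; apply: contra bac => ca; rewrite ub.
  by case: (leqP y a) => // ya; rewrite (leq_trans ya ac).
have := set_minor_wt_le (card_upset y) cK supp nz; rewrite {1}/wt.
rewrite (eq_bigr (fun=> 1%N)) => [|a]; last by rewrite inE => ->.
rewrite sum1_card card_upset -cK -sum1_card /wt => le.
apply/subsetP => c cK'; rewrite inE; apply: contraLR le => yc; rewrite -ltnNge.
rewrite (bigD1 c) //= [X in (_ < X)%N](bigD1 c) //= (negPf yc) add0n add1n ltnS.
by apply: leq_sum => z _; apply: leq_b1.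
Qed.

Lemma gram_max mu : is_comp n mu -> gram k (mumax n mu) = diagm (fun=> 1).
Proof.
move=> mc; apply/matrixP => x y; rewrite gramE !mxE /gram_coef !deg_map_mumax //= eqxx mul1r.
by case: eqP.
Qed.

Lemma Qpoint_max mu (c : Defs.coord n) : is_comp n mu -> Q (mumax n mu) c =
  if sat (idx_wt (mumax n mu)) (cI c) && (cI c == cJ c) then 1 else 0.
Proof.
move=> mc; rewrite (QpointE k (muinv_mumax mc)) ffunE (minorEc x0 _ (erefl _)).
rewrite gram_max // set_minor_diag ?card_cJ //; case: (cI c =P cJ c) => [<-|]; last first.
  by rewrite andbF; case: ifP.
by rewrite andbb andbT; case: ifP => // _; rewrite big1.
Qed.

Lemma mumax_mono mu (x y : 'I_n) : is_comp n mu -> (x <= y)%N ->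
  (string_index (mumax n mu) x <= string_index (mumax n mu) y)%N.
Proof.
move=> mc xy; rewrite leqNgt; apply/negP => /(fmax_lt _ _ mc)[c _]; lia.
Qed.

Lemma sat_upset mu (y : 'I_n) : is_comp n mu -> sat (idx_wt (mumax n mu)) (upset y).
Proof.
move=> mc; rewrite -(saturatedE (muinv_mumax mc)).
apply/forall_inP => a; rewrite inE => ya; apply/forallP => b; apply/implyP => ab.
rewrite inE; apply: leq_trans ya _; rewrite leqNgt; apply/negP => ba.
by move: ab; rewrite ltnNge mumax_mono // ltnW.
Qed.

(** This coordinate is a semi-invariant of B: if it vanished at [Q r] it would vanish on the closure
    of the orbit, but at the point of the maximum it equals 1. *)
Lemma qle_max_upset mu r (y : 'I_n) (y0 : (0 < y)%N) : is_comp n mu ->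
  qle (mumax n mu) r ->
  Q r (exist _ (upset y, upset y) (upset_coordP y0 (card_upset y) (card_upset y))) != 0.
Proof.
move=> mc le; set c := exist _ _ _; apply: contraT => /negPn/eqP Qc.
have := le _ _ (mhom_coord k c); rewrite Qpoint_max // /cI /cJ /= eqxx sat_upset //=.
have H : bvan (Q r) (fun P : mpoint k n => P c).
  move=> b [_ ub]; rewrite (gactE x0) big1 // => e /eqP ec.
  have bc : block c = (n - y)%N by rewrite -card_upset.
  have [->|nI] := eqVneq (set_minor x0 (block c) b (cI c) (cI e)) 0; first by rewrite !mul0r.
  have [->|nJ] := eqVneq (set_minor x0 (block c) b (cJ c) (cJ e)) 0; first by rewrite !mulr0.
  rewrite bc in nI nJ ec.
  have eI := upper_upset ub (ec : #|cI e| = _) nI.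
  have eJ := upper_upset ub (etrans (card_cJ e) ec) nJ.
  suff -> : e = c by rewrite Qc mulr0 mul0r.
  by apply: val_inj; rewrite [LHS]surjective_pairing -/(cI e) -/(cJ e) eI eJ.
by move/(_ H)/eqP; rewrite oner_eq0.
Qed.

(** By the support of [Qpoint], every final segment is saturated and stable under the involution of
    [r]. Stability makes the involution nondecreasing at each letter, hence trivial; saturation
    excludes descents between strings. *)
Lemma qle_max_eq mu nu r : is_comp n mu -> muinv nu r -> qle (mumax n mu) r ->
  r = mumax n nu.
Proof.
move=> mc rI le; have [_ gK fg] := encode_good rI.
have H (y : 'I_n) : (0 < y)%N -> sat (idx_wt r) (upset y) /\
    upset y = [set deg_map r x | x in upset y].
  by move=> y0; have /(Qpoint_support rI)[] := qle_max_upset y0 mc le.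
have ge (x : 'I_n) : (x <= deg_map r x)%N.
  have [->//|] := posnP x => x0'; have [_ E] := H x x0'.
  have : deg_map r x \in upset x by rewrite E imset_f // inE.
  by rewrite inE.
have gid x : deg_map r x = x.
  by apply/val_inj/eqP; rewrite eqn_leq ge andbT -{2}(gK x) ge.
apply: (all_up_max rI) => i; rewrite /low /lowfg !gid hi_loF andbF orbF.
have [|sI _] := H (hi i); first by rewrite hi_val.
apply/negP => lt; move: sI; rewrite -(saturatedE rI) => /forall_inP/(_ (hi i)).
rewrite inE leqnn => /(_ isT)/forallP/(_ (lo i)); rewrite lt inE /= hi_val; lia.
Qed.

Lemma saturated_upset_unique nu (x y : 'I_n) (K : {set 'I_n}) : is_comp n nu ->
  y = x.+1 :> nat ->
  (string_index (mumax n nu) x < string_index (mumax n nu) y)%N ->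
  #|K| = (n - y)%N -> sat (idx_wt (mumax n nu)) K -> K = upset y.
Proof.
move=> nc yx lt cK; rewrite -(saturatedE (muinv_mumax nc)) => /forall_inP sK.
apply/eqP; rewrite eq_sym eqEcard card_upset cK leqnn andbT.
apply/subsetP => b; rewrite inE => yb; apply: contraT => bK.
have [a aK ay] : exists2 a, a \in K & (a < y)%N.
  apply/exists_inP; apply: contraT; rewrite negb_exists => /forallP no.
  have : K \subset upset y :\ b.
    apply/subsetP => a aK; rewrite !inE; have := no a; rewrite aK /= -leqNgt => ->.
    by rewrite andbT; apply: contraNneq bK => <-.
  move/subset_leq_card; rewrite cK; have := cardsD1 b (upset y).
  by rewrite card_upset inE yb; have := ltn_ord y; lia.
have /forallP/(_ b)/implyP H := sK a aK; rewrite (negPf bK) in H; apply: H.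
apply: leq_ltn_trans (_ : _ <= string_index (mumax n nu) x)%N _.
  by apply: mumax_mono => //; rewrite -ltnS -yx.
by apply: leq_trans lt _; apply: mumax_mono.
Qed.

(* If a part of nu ends at y, the component of degree n - y of the points of the
   orbit of nu has rank one, hence so has that of the smaller point. *)
Lemma qle_max_refines mu nu : is_comp n mu -> is_comp n nu ->
  qle (mumax n mu) (mumax n nu) -> refines mu nu.
Proof.
move=> mc nc le; apply: (fmax_refines mc nc) => x y yx lt; rewrite ltnNge; apply/negP => ge.
have fe : string_index (mumax n mu) x = string_index (mumax n mu) y.
  by apply/eqP; rewrite eqn_leq ge (mumax_mono mc) // yx.
(* As x and y lie in one part of mu, exchanging them in the final segment keeps it saturated for
   mu. *)
pose J := x |: (upset y :\ y).
have xy : x \notin upset y :\ y by rewrite !inE; lia.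
have cJ' : #|J| = (n - y)%N.
  rewrite cardsU1 xy /=; have := cardsD1 y (upset y); rewrite card_upset inE leqnn.
  by move=> ->.
have y0 : (0 < y)%N by lia.
have sJ : sat (idx_wt (mumax n mu)) J.
  apply: (sat_trans (sat_upset y mc)); first by rewrite card_upset cJ'.
  rewrite /wt big_setU1 //= [X in (_ <= X)%N](big_setD1 y) ?inE //=.
  by rewrite leq_add2r /idx_wt fe.
have JU : J != upset y.
  apply/eqP => E; have : x \in upset y by rewrite -E !inE eqxx.
  by rewrite inE yx ltnn.
pose cc A B cA cB : Defs.coord n := exist _ (A, B) (upset_coordP y0 cA cB).
pose cUU := cc _ _ (card_upset y) (card_upset y). pose cJJ := cc _ _ cJ' cJ'.
pose cUJ := cc _ _ (card_upset y) cJ'. pose cJU := cc _ _ cJ' (card_upset y).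
(* A 2 x 2 minor of the component of degree n - y. At the point of mu the diagonal coordinates are 1
   and the other two vanish, so it takes the value 1. *)
pose phi (P : mpoint k n) := P cUU * P cJJ + (-1) * (P cUJ * P cJU).
have hom : mhom (fun d => (n - y == d) + (n - y == d))%N phi.
  have H c : block c = (n - y)%N -> mhom (fun d => (n - y == d)%N : nat) (fun P : mpoint k n => P c).
    by move=> <-; apply: mhom_coord.
  by apply: mhomD; [|apply: mhomZ]; apply: mhomM; apply: H; (exact: card_upset || exact: cJ').
have van : bvan (Q (mumax n nu)) phi.
  move=> b _; pose q := Q (mumax n nu) cUU.
  have E A B cA cB : Defs.gact b (Q (mumax n nu)) (cc A B cA cB) =
     set_minor x0 (n - y) b A (upset y) * q * set_minor x0 (n - y) b B (upset y).
    rewrite (gactE x0); have bc : block (cc A B cA cB) = (n - y)%N by rewrite -cA.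
    rewrite bc (bigD1 cUU) /=; last by apply/eqP; rewrite -card_upset.
    rewrite big1 ?addr0 // => c /andP[/eqP cb cU].
    rewrite Qpoint_max //; case: ifP => [/andP[sc /eqP ec]|]; last by rewrite mulr0 mul0r.
    have cE := saturated_upset_unique nc yx lt (cb : #|cI c| = _) sc.
    case/eqP: cU; apply: val_inj.
    by rewrite [LHS]surjective_pairing -/(cI c) -/(cJ c) -ec cE.
  by rewrite /phi !E; ring.
have := le _ _ hom van; rewrite /phi !Qpoint_max // /cI /cJ /= !eqxx (negPf JU).
rewrite sat_upset // sJ [upset y == J]eq_sym (negPf JU) !andbF /= mulr0 mulr0 addr0 mulr1.
by move/eqP; rewrite oner_eq0.
Qed.

(** Saturation for mu is the stronger condition, so the point of mu is the leading part, for the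
    weights of mu, of the point of nu. *)
Lemma qle_max_deg mu nu : is_comp n mu -> is_comp n nu -> refines mu nu ->
  qle (mumax n mu) (mumax n nu).
Proof.
move=> mc nc ref deg phi hom van.
have sub I : sat (idx_wt (mumax n mu)) I -> sat (idx_wt (mumax n nu)) I.
  rewrite -(saturatedE (muinv_mumax mc)) -(saturatedE (muinv_mumax nc)).
  move=> /forall_inP sI; apply/forall_inP => a /sI/forallP H.
  apply/forallP => b; apply/implyP => /(refines_fmax mc nc ref) lt.
  by have := H b; rewrite lt.
have -> : Q (mumax n mu) = leadpt (idx_wt (mumax n mu)) (Q (mumax n nu)).
  apply/ffunP => c; rewrite [RHS]ffunE !Qpoint_max //.
  case: (cI c =P cJ c) => [<-|]; last by rewrite !andbF if_same.
  by rewrite !andbT andbb; case: ifP => // /sub ->.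
apply: (leadpt_limit x0 hom) => c c0; apply: (bvan_upper x0 hom van).
  exact: upper_weightm.
exact: weightm_unit.
Qed.

Lemma bruhat_le_axioms : bruhat_axioms (@bruhat_le k n).
Proof.
split.
- by move=> q p r pq qr P /pq/qr.
- by move=> mu p i [_ pI]; apply/(bruhat_leP pI (muinv_mact pI i)); apply: qle_up pI.
- move=> mu nu p r i [_ pI] [_ rI] /(bruhat_leP pI rI) pr.
  by apply/(bruhat_leP (muinv_mact pI i) (muinv_mact rI i)); apply: qle_mono pI rI pr.
- move=> mu nu p r i [_ pI] [_ rI] lw /(bruhat_leP pI (muinv_mact rI i)) pr.
  by apply/(bruhat_leP pI rI); apply: qle_lift pI rI lw pr.
- move=> mu nu r mc [nc rI] /(bruhat_leP (muinv_mumax mc) rI) le.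
  have rE := qle_max_eq mc rI le; split=> //; apply: qle_max_refines => //.
  by rewrite -rE.
- move=> mu nu mc nc ref; apply/(bruhat_leP (muinv_mumax mc) (muinv_mumax nc)).
  exact: qle_max_deg.
- exact: muinv_mumax.
exact: refines_anti.
Qed.

End Bruhat.

Theorem theorem1p1 (k : closedFieldType) (char_k : (2%:R != 0 :> k)%R)
    (n : nat) (n_ge2 : (2 <= n)%N)
    (mu nu : seq nat) (mu_comp : is_comp n mu) (nu_comp : is_comp n nu)
    (p r : seq (seq 'I_n)) (p_inv : muinv mu p) (r_inv : muinv nu r) :
  covers (@degenerate n) (@bruhat_le k n) p r <->
    (covers (fun la => is_comp n la) refines mu nu /\ W p \subset W r)
    \/
    (nu = mu /\
     exists (alpha : 'I_n.-1) (v : 'S_n),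
       [/\ Lmu (star v p) = (Lmu p + ell v)%N /\
           Lmu (star v r) = (Lmu r + ell v)%N,
           mstar alpha (star v r) = star v p
         & [set (sref alpha * w)%g | w in Winv (star v p)]
             :&: Winv (star v r) != set0]).
Proof. by apply: (covers_bruhat (bruhat_le_axioms char_k n_ge2)). Qed.
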